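(* Let $V\subset\mathbb R_\tau\times(\mathbb R_+)_\phi$ be a domain adjacent to an interval $J=(a,b)\times\{0\}$. Let $\widetilde F:V\cup J\to\mathbb R_\tau\times(\mathbb R_{\ge0})_\phi$ be a $C^\infty$-smooth mapping of the type $$\widetilde F(\tau,\phi)=(\tau+\phi+\mathrm{flat}(\phi),\ \phi+\mathrm{flat}(\phi))$$ (no area-preserving property is assumed). 1) There exist a domain $W\subset V$ adjacent to $J$ and an $\widetilde F$-invariant $C^\infty$-smooth function $\tilde\phi$ on $W\cup J$ of the type $\tilde\phi(\tau,\phi)=\phi+\mathrm{flat}(\phi)$ with $\frac{\partial\tilde\phi}{\partial\phi}>0$. 2) For every function $\tilde\phi$ as in 1) one can shrink the domain $W$ (keeping it adjacent to $J$) so that there exists a $C^\infty$-smooth function $\tilde\tau(\tau,\phi)=\tau+\mathrm{flat}(\phi)$ such that the map $(\tau,\phi)\mapsto(\tilde\tau,\tilde\phi)$ is a $C^\infty$-smooth diffeomorphism on $W\cup J$ (onto its image) that conjugates $\widetilde F$ to the map $$\widehat F:(\tilde\tau,\tilde\phi)\mapsto(\tilde\tau+\tilde\phi,\ \tilde\phi).$$ 3) There exists a continuum of functions $\tilde\phi$ satisfying statement 1) such that the corresponding foliations $\tilde\phi=const$ are $C^\infty$-smooth on the same subset $W\cup J$ and form an infinite-dimensional family of foliations with distinct boundary germs.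
   Context: A domain $U\subset\mathbb R\times\mathbb R_+$ is adjacent to $J=(a,b)\times\{0\}$ if $J\subset\partial U$ and $U\cup J$ contains a neighborhood in $\mathbb R\times\mathbb R_{\ge0}$ of each point of $J$. Flat functions. A $C^\infty$-smooth function $f(\tau,\phi)$ on $V\cup J$ is $\phi$-flat if $f(\tau,0)\equiv0$ and $f$ tends to zero together with all its partial derivatives as $\phi\to0$, the convergence being uniform on compact subsets of the $\tau$-interval $(a,b)$ for $f$ and for each individual derivative. The symbol $\mathrm{flat}(\phi)$ denotes some $\phi$-flat function. Invariance of $\tilde\phi$ means $\tilde\phi(\widetilde F(z))=\tilde\phi(z)$ whenever $z,\widetilde F(z)\in W\cup J$. ''$\tilde\phi=const$'' denotes the foliation by connected components of level curves. A collection of $C^\infty$-smooth foliations on $W\cup J$ with $J$ being a leaf is an infinite-dimensional family of foliations with distinct boundary germs if their germs at each point of $J$ are pairwise distinct and the collection contains a $C^\infty$-smooth $N$-parametric family of foliations for every $N\in\mathbb N$. *)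

(* Defs.v *)
From HB Require Import structures.
From mathcomp Require Import all_boot all_order all_algebra.
From mathcomp Require Import all_classical all_reals all_analysis.

Set Implicit Arguments.
Unset Strict Implicit.
Unset Printing Implicit Defensive.

Import Order.TTheory GRing.Theory Num.Theory.
Import numFieldNormedType.Exports.

Local Open Scope classical_set_scope.
Local Open Scope ring_scope.

Section Smooth.
Context {R : realType} {V W : normedModType R}.

Definition iter_derive (vs : seq V) (f : V -> W) : V -> W :=
  foldr (fun v g => 'D_v g) f vs.

(* Used only for finite-dimensional V, where it is the usual C^oo condition:
   all iterated directional derivatives exist and are differentiable. *)
Definition smooth_open (U : set V) (f : V -> W) : Prop :=
  forall vs p, U p -> differentiable (iter_derive vs f) p.

(* Smoothness on an arbitrary subset A: local extendability to a smooth map on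
   an open set of V. The values of f outside A are irrelevant. *)
Definition smooth_on (A : set V) (f : V -> W) : Prop :=
  forall p, A p -> exists (U : set V) (g : V -> W),
    [/\ open U, U p, smooth_open U g & forall q, U q -> A q -> g q = f q].

End Smooth.

Section Plane.
Context {R : realType}.
Implicit Types (U V W A : set (R * R)) (f h phi : R * R -> R) (a b : \bar R).

(* Points of the plane are pairs (tau, phi). The endpoints a and b are allowed
   to be infinite. *)
Definition boundary_interval a b : set (R * R) :=
  [set p | (a < p.1%:E)%E /\ (p.1%:E < b)%E /\ p.2 = 0].

Definition with_boundary a b U : set (R * R) := U `|` boundary_interval a b.

Definition domain_adjacent a b U : Prop :=
  [/\ open U, connected U, U `<=` [set p | 0 < p.2],
      boundary_interval a b `<=` closure U `\` interior U &
      forall p, boundary_interval a b p ->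
        \forall q \near p, 0 <= q.2 -> with_boundary a b U q].

Definition partial (i j : nat) f : R * R -> R :=
  iter i (fun g => 'D_((1, 0) : R * R) g)
    (iter j (fun g => 'D_((0, 1) : R * R) g) f).

(* The partial derivatives are evaluated in U only: for K compact in (a, b),
   K x {y} lies in the open set U for all small y > 0. *)
Definition flat a b U f : Prop :=
  [/\ smooth_on (with_boundary a b U) f,
      forall p, boundary_interval a b p -> f p = 0 &
      forall (i j : nat) (K : set R), compact K ->
        K `<=` [set t | (a < t%:E)%E /\ (t%:E < b)%E] ->
        {uniform K, (fun y t => partial i j f (t, y)) @ 0^'+ --> (fun=> 0 : R)}].

Definition invariant_on A (F : R * R -> R * R) phi : Prop :=
  forall z, A z -> A (F z) -> phi (F z) = phi z.

(* The quotient is one-sided so as to make sense on the boundary interval as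
   well; at interior points its limit is the usual partial derivative. *)
Definition dphi_right f (p : R * R) : R :=
  lim ((fun h : R => h^-1 * (f (p.1, p.2 + h) - f p)) @ 0^'+).

Definition flat_first_integral a b W (F : R * R -> R * R) phi : Prop :=
  [/\ smooth_on (with_boundary a b W) phi,
      flat a b W (fun p => phi p - p.2),
      invariant_on (with_boundary a b W) F phi &
      forall p, with_boundary a b W p -> 0 < dphi_right phi p].

(* Surjectivity is onto the image H @` A, in which H's inverse G is smooth. *)
Definition smooth_embedding A (H : R * R -> R * R) : Prop :=
  smooth_on A H /\
  exists G : R * R -> R * R,
    smooth_on (H @` A) G /\ forall p, A p -> G (H p) = p.

Definition shear (p : R * R) : R * R := (p.1 + p.2, p.2).

(* A foliation of A is given by its leaf map: L p is the leaf through p. *)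
Definition foliation := R * R -> set (R * R).

Definition level_foliation A f : foliation :=
  fun p => connected_component (A `&` [set q | f q = f p]) p.

Definition restrict_foliation (L : foliation) U : foliation :=
  fun p => connected_component (L p `&` U) p.

Definition is_foliation A (L : foliation) : Prop :=
  (forall p, A p -> [/\ L p p, L p `<=` A & connected (L p)]) /\
  (forall p q, A p -> L p q -> L q = L p).

(* In U, the foliation L of A is h = const for a function h without critical
   points in U. *)
Definition locally_level A (L : foliation) U h : Prop :=
  (forall q, U q -> exists v : R * R, 'D_v h q != 0) /\
  (forall q, A q -> U q ->
    restrict_foliation L U q = level_foliation (A `&` U) h q).

Definition smooth_foliation A (L : foliation) : Prop :=
  is_foliation A L /\
  forall p, A p -> exists U h,
    [/\ open U, U p, smooth_on U h & locally_level A L U h].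

Definition same_germ A (L1 L2 : foliation) (p : R * R) : Prop :=
  exists U, [/\ open U, U p &
    forall q, A q -> U q ->
      restrict_foliation L1 U q = restrict_foliation L2 U q].

(* Locally the foliations L s are h(s, .) = const with h smooth jointly in the
   parameter s and the point. *)
Definition smooth_parametric_family (N : nat) A
    (B : set 'rV[R]_N.+1) (L : 'rV[R]_N.+1 -> foliation) : Prop :=
  (forall s, B s -> smooth_foliation A (L s)) /\
  forall s0 p, B s0 -> A p ->
    exists (O : set 'rV[R]_N.+1) U (h : 'rV[R]_N.+1 * (R * R) -> R),
      [/\ open O /\ O s0, open U /\ U p, smooth_on (O `*` U) h &
          forall s, O s -> B s ->
            locally_level A (L s) U (fun q => h (s, q))].

(* The collection is indexed by the elements of I. The N-parametric subfamilies
   are required to be injective in the parameter, since otherwise a constant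
   family would do; the parameters range over an open set of R^(N+1), that is,
   the number of parameters is any positive integer. *)
Definition infinite_dimensional_family (T : Type) a b W
    (I : set T) (L : T -> foliation) : Prop :=
  let A := with_boundary a b W in
  let J := boundary_interval a b in
  [/\ forall i, I i ->
        smooth_foliation A (L i) /\ (forall p, J p -> L i p = J),
      forall i j, I i -> I j -> i <> j ->
        forall p, J p -> ~ same_germ A (L i) (L j) p &
      forall N : nat, exists (B : set 'rV[R]_N.+1) (c : 'rV[R]_N.+1 -> T),
        [/\ open B /\ B !=set0,
            forall s, B s -> I (c s),
            forall s t, B s -> B t -> c s = c t -> s = t &
            smooth_parametric_family A B (fun s => L (c s))]].

End Plane.

(* Main.v *)
Require Import Defs.
From HB Require Import structures.
From mathcomp Require Import all_boot all_order all_algebra.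
From mathcomp Require Import all_classical all_reals all_analysis.
From mathcomp Require Import ring lra.
Import Order.TTheory GRing.Theory Num.Theory.
Import numFieldNormedType.Exports.
Local Open Scope classical_set_scope.
Local Open Scope ring_scope.

(** Write [F = (tau + phi + f1, phi + f2)] with [f1] and [f2] flat. Extended by
    zero to [phi <= 0], flat functions become smooth functions on a neighborhood
    of the boundary interval that vanish for [phi <= 0] ([flat_ext0]), and
    conversely ([flat_of_flat_smooth]); all the work is done with such functions.

    Everything rests on the cohomological equation [u o F - u = g], which has a
    flat solution [u] for every flat [g] ([coboundary]). With [g = - f2] it makes
    [phi + u] invariant. If [phi + v] is any flat invariant perturbation of
    [phi], the solution [w] for [g = v - f1] makes [(tau + w, phi + v)] a conjugacy of [F]
    with the shear; a flat perturbation of the identity is a diffeomorphism near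
    the boundary interval ([flat_inverse]).

    To solve the equation, [g] is cut into a part supported on the left and a
    part supported on the right. For the first one, the solution is minus the sum
    of [g o F^n]: an orbit moves to the right by at least [phi / 2] at each step,
    hence leaves the support of [g]. The number of steps is of order [1 / phi],
    so that the flatness of the sum has to be proved. A derivative in [phi] of a
    pullback by [F] contains a derivative in [tau] without any small factor;
    when each derivative in [phi] is weighted by [phi], however, one step
    multiplies the derivatives up to a given order by at most [1 + O(phi)]
    ([pullback_bound]). The barrier [phi ^ M * exp (- K tau)] decreases by a
    larger factor when [K] is large ([barrier_step]) and therefore dominates all
    the sums ([forward_sum_bound]), for every [M]. The second part follows from
    the first one, applied to the inverse of [F] after a reflection.

    For the family of foliations, let [(x, y)] be normal coordinates, in which [F] is
    [(x + y, y)]. The functions [exp (- 1 / y) * sin (2 pi x / y) ^ j] are flat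
    and invariant. Adding to [y] their combinations with coefficients in a
    weighted unit ball of polynomials [P] gives invariant functions whose level
    curves are graphs. Suppose that the foliations of [P] and [P'] have the same
    germ at a boundary point, and take a common leaf through a nearby point with
    [sin (2 pi x / y) = 0]. The two functions take there the same value [y],
    hence agree on the whole leaf, so that all values of the sine on it are roots
    of [(P - P') * 'X]. If [P] and [P'] differ, the sine is zero on the leaf; then
    [y] is constant on it while [x] covers an interval, which is absurd
    ([distinct_germs]). The polynomials of bounded degree form the
    finite-parameter subfamilies, and the real polynomials have the cardinality
    of the continuum ([card_admissible]). *)

Set Implicit Arguments.
Unset Strict Implicit.
Unset Printing Implicit Defensive.

(** * Smooth functions on open sets *)

Section LocalCongruence.
Context {R : realType} {V W : normedModType R}.
Implicit Types (U : set V) (f g : V -> W).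

Lemma near_eq_differentiable f g (p : V) :
  {near p, f =1 g} -> differentiable f p -> differentiable g p.
Proof.
move=> fg df; have [dfc dfE] := (diff_locallyP p f).1 df.
have gE : g \o shift p = cst (g p) + 'd f p +o_ 0 id.
  apply/eqaddoP => e e0.
  have /eqaddoP/(_ e e0) := dfE.
  have fgp : f p = g p by apply: (nbhs_singleton fg).
  have fgh : \forall h \near 0, f (h + p) = g (h + p).
    have : (fun h : V => h + p) @ 0 --> p.
      rewrite -[X in _ --> X]add0r; apply: cvgD; [exact: cvg_id|exact: cvg_cst].
    by move=> /(_ _ fg).
  by apply: filterS2 fgh => h /= fgE; rewrite !fctE /= fgE fgp.
by apply/diff_locallyP; rewrite (diff_unique dfc gE).
Qed.

Lemma open_near_eq U f g p : open U -> U p -> {in U, f =1 g} ->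
  {near p, f =1 g}.
Proof.
move=> oU Up fg; have : \near p, U p by exact: open_nbhs_nbhs.
by apply: filterS => q Uq; apply: fg; rewrite inE.
Qed.

End LocalCongruence.

Section Ck.
Context {R : realType} {V W : normedModType R}.
Implicit Types (U : set V) (f g : V -> W).

(** Being [n] times differentiable, in a form suited to induction on [n]: the
    closure properties of smooth functions are proved for it first. *)
Fixpoint diff_upto (n : nat) (U : set V) (f : V -> W) : Prop :=
  (forall p, U p -> differentiable f p) /\
  if n is m.+1 then forall v, diff_upto m U ('D_v f) else True.

Lemma diff_upto_differentiable n U f p :
  diff_upto n U f -> U p -> differentiable f p.
Proof. by case: n => [|n] [+ _]; apply. Qed.

Lemma smooth_derive U f v : smooth_open U f -> smooth_open U ('D_v f).
Proof.
move=> sf vs p Up; have := sf (rcons vs v) p Up.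
by rewrite /iter_derive foldr_rcons.
Qed.

Lemma smooth_differentiable U f p :
  smooth_open U f -> U p -> differentiable f p.
Proof. by move=> sf; apply: (sf [::]). Qed.

Lemma smooth_uptoP U f : smooth_open U f <-> forall n, diff_upto n U f.
Proof.
split.
  move=> + n; elim: n f => [|n IH] f sf.
    by split => // p; apply: smooth_differentiable.
  split; first by move=> p; apply: smooth_differentiable.
  by move=> v; apply/IH/smooth_derive.
move=> + vs; elim/last_ind: vs f => [|vs v IH] f uf p Up.
  exact: diff_upto_differentiable (uf 0) Up.
rewrite /iter_derive foldr_rcons; apply: (IH ('D_v f)) => // n.
exact: (uf n.+1).2.
Qed.

Lemma diff_uptoW n U f : diff_upto n.+1 U f -> diff_upto n U f.
Proof.
elim: n f => [|n IH] f [df df']; first by split.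
by split => // v; apply: IH.
Qed.

Lemma eq_derive U f g v : open U -> (forall p, U p -> f p = g p) ->
  forall p, U p -> 'D_v f p = 'D_v g p.
Proof.
move=> oU fg p Up; apply: near_eq_derive; apply: (open_near_eq oU Up).
by move=> q; rewrite inE => /fg.
Qed.

Lemma eq_diff_upto n U f g : open U -> (forall p, U p -> f p = g p) ->
  diff_upto n U f -> diff_upto n U g.
Proof.
move=> oU.
have dfg f' g' : (forall p, U p -> f' p = g' p) ->
    (forall p, U p -> differentiable f' p) ->
    (forall p, U p -> differentiable g' p).
  move=> fg df p Up; apply: near_eq_differentiable (df p Up).
  by apply: (open_near_eq oU Up) => q; rewrite inE; apply: fg.
elim: n f g => [|n IH] f g fg [df df']; first by split => //; apply: dfg df.
split; first exact: dfg df.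
by move=> v; apply: IH (df' v); apply: eq_derive.
Qed.

Lemma eq_smooth U f g : open U -> (forall p, U p -> f p = g p) ->
  smooth_open U f -> smooth_open U g.
Proof.
by move=> oU fg /smooth_uptoP sf; apply/smooth_uptoP => n; apply: eq_diff_upto (sf n).
Qed.

Lemma smooth_openS U U' f : U' `<=` U -> smooth_open U f -> smooth_open U' f.
Proof. by move=> UU sf vs p /UU; apply: sf. Qed.

Lemma smooth_open_local U f : (forall p, U p -> exists U' g,
    [/\ open U', U' p, smooth_open U' g & forall q, U' q -> f q = g q]) ->
  smooth_open U f.
Proof.
move=> H vs p /H[U' [g [oU U'p sg fg]]].
by apply: (eq_smooth oU _ sg) => // q /fg ->.
Qed.

Lemma iter_derive_eq U f g vs : open U -> (forall p, U p -> f p = g p) ->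
  forall p, U p -> iter_derive vs f p = iter_derive vs g p.
Proof.
move=> oU fg; elim: vs => [|v vs IH] p Up; first exact: fg.
exact: (eq_derive v oU IH Up).
Qed.

Lemma iter_derive_cat vs ws f :
  iter_derive (vs ++ ws) f = iter_derive vs (iter_derive ws f).
Proof. by rewrite /iter_derive foldr_cat. Qed.

Lemma smooth_iter_derive U f vs :
  smooth_open U f -> smooth_open U (iter_derive vs f).
Proof. by move=> sf ws p Up; rewrite -iter_derive_cat; apply: sf. Qed.

Lemma smooth_continuous U f p : smooth_open U f -> U p ->
  {for p, continuous f}.
Proof.
by move=> sf Up; apply: differentiable_continuous; apply: smooth_differentiable sf Up.
Qed.

Lemma diff_upto_cst n U (c : W) : diff_upto n U (fun=> c).
Proof.
have dc (c' : W) p : differentiable (fun=> c' : W) p by exact: differentiable_cst.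
elim: n c => [|n IH] c; first by split.
split=> // v; have -> : 'D_v (fun=> c : W) = (fun=> 0 : W).
  by apply/funext => x; rewrite (derive_cst c).
exact: IH.
Qed.

Lemma smooth_cst U (c : W) : smooth_open U (fun=> c).
Proof. by apply/smooth_uptoP => n; exact: diff_upto_cst. Qed.

Lemma diff_uptoD n U f g : open U -> diff_upto n U f -> diff_upto n U g ->
  diff_upto n U (fun p => f p + g p).
Proof.
move=> oU; elim: n f g => [|n IH] f g [df df'] [dg dg']; split => //.
- by move=> p Up; apply: differentiableD; [exact: df|exact: dg].
- by move=> p Up; apply: differentiableD; [exact: df|exact: dg].
move=> v; apply: (@eq_diff_upto _ _ (fun p => 'D_v f p + 'D_v g p)) => //.
  by move=> p Up; rewrite deriveD//; apply: diff_derivable; [exact: df|exact: dg].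
by apply: IH; [exact: df'|exact: dg'].
Qed.

Lemma smoothD U f g : open U -> smooth_open U f -> smooth_open U g ->
  smooth_open U (fun p => f p + g p).
Proof.
move=> oU /smooth_uptoP sf /smooth_uptoP sg; apply/smooth_uptoP => n.
exact: diff_uptoD.
Qed.

Lemma smooth_linear U (f : {linear V -> W}) : continuous f -> smooth_open U f.
Proof.
move=> cf; apply/smooth_uptoP => -[|n]; split => //.
- by move=> p _; apply: linear_differentiable.
- by move=> p _; apply: linear_differentiable.
move=> v; have -> : 'D_v f = (fun=> f v).
  apply/funext => p; rewrite deriveE; last exact: linear_differentiable.
  by rewrite diff_lin.
exact: diff_upto_cst.
Qed.

End Ck.

Section SmoothReal.
Context {R : realType} {V : normedModType R}.
Implicit Types (U : set V) (f g : V -> R).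

Lemma derive_mul f g v p : differentiable f p -> differentiable g p ->
  'D_v (fun q => f q * g q) p = f p * 'D_v g p + g p * 'D_v f p.
Proof. by move=> df dg; rewrite deriveM//; apply: diff_derivable. Qed.

Lemma diff_uptoM n U f g : open U -> diff_upto n U f -> diff_upto n U g ->
  diff_upto n U (fun p => f p * g p).
Proof.
move=> oU; elim: n f g => [|n IH] f g df dg; split => //.
- by move=> p Up; apply: differentiableM; [exact: df.1|exact: dg.1].
- by move=> p Up; apply: differentiableM; [exact: df.1|exact: dg.1].
move=> v; apply: (@eq_diff_upto _ _ _ _ _
  (fun p => f p * 'D_v g p + g p * 'D_v f p)) => //.
  by move=> p Up; rewrite derive_mul//; [exact: df.1|exact: dg.1].
apply: diff_uptoD => //; apply: IH; try exact: diff_uptoW.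
  exact: dg.2.
exact: df.2.
Qed.

Lemma smoothM U f g : open U -> smooth_open U f -> smooth_open U g ->
  smooth_open U (fun p => f p * g p).
Proof.
move=> oU /smooth_uptoP sf /smooth_uptoP sg; apply/smooth_uptoP => n.
exact: diff_uptoM.
Qed.

Lemma smoothZ U (c : R) f : open U -> smooth_open U f ->
  smooth_open U (fun p => c * f p).
Proof. by move=> oU; apply: smoothM => //; exact: smooth_cst. Qed.

Lemma smoothN U f : open U -> smooth_open U f ->
  smooth_open U (fun p => - f p).
Proof.
move=> oU /(smoothZ (-1) oU); apply: eq_smooth => // p _; by rewrite mulN1r.
Qed.

Lemma smoothB U f g : open U -> smooth_open U f -> smooth_open U g ->
  smooth_open U (fun p => f p - g p).
Proof. by move=> oU sf sg; apply: smoothD => //; apply: smoothN. Qed.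

Lemma smooth_sum (I : Type) (r : seq I) U (f : I -> V -> R) : open U ->
  (forall i, smooth_open U (f i)) ->
  smooth_open U (fun p => \sum_(i <- r) f i p).
Proof.
move=> oU sf; elim: r => [|i r IH].
  by apply: (eq_smooth oU _ (@smooth_cst R V R U 0)) => p _; rewrite big_nil.
apply: (@eq_smooth _ _ _ _ (fun p => f i p + \sum_(j <- r) f j p)) => //.
  by move=> p _; rewrite big_cons.
exact: smoothD.
Qed.

Lemma smoothV U f : open U -> (forall p, U p -> f p != 0) -> smooth_open U f ->
  smooth_open U (fun p => (f p)^-1).
Proof.
move=> oU f0 /smooth_uptoP sf; apply/smooth_uptoP => n.
elim: n => [|n IH]; split => //.
- by move=> p Up; apply: differentiableV; [exact: (sf 0).1|exact: f0].
- by move=> p Up; apply: differentiableV; [exact: (sf 0).1|exact: f0].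
move=> v; apply: (@eq_diff_upto _ _ _ _ _
  (fun p => -1 * ((f p)^-1 * (f p)^-1) * 'D_v f p)) => //.
  move=> p Up; rewrite deriveV ?f0//; last first.
    by apply: diff_derivable; exact: (sf 0).1.
  by rewrite -[_ *: _]/(_ * _) mulN1r -invfM expr2.
apply: diff_uptoM => //; last exact: (sf n.+1).2.
apply: diff_uptoM => //; first exact: diff_upto_cst.
exact: diff_uptoM.
Qed.

End SmoothReal.

Section Composition.
Context {R : realType} {V : normedModType R}.
Implicit Types (U : set V) (f g : V -> R) (h : R * R -> R).

Definition e1 : R * R := (1, 0).
Definition e2 : R * R := (0, 1).

Lemma planeE (v : R * R) : v = v.1 *: e1 + v.2 *: e2.
Proof.
case: v => x y; apply: injective_projections => /=.
  by rewrite -[x *: _]/(x * 1) -[y *: _]/(y * 0); ring.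
by rewrite -[x *: _]/(x * 0) -[y *: _]/(y * 1); ring.
Qed.

Lemma deriveE_plane h p v : differentiable h p ->
  'D_v h p = v.1 * 'D_e1 h p + v.2 * 'D_e2 h p.
Proof.
by move=> dh; rewrite !deriveE// {1}(planeE v) linearD !linearZ.
Qed.

Lemma differentiable_comp2 (f g : V -> R) h p :
  differentiable f p -> differentiable g p -> differentiable h (f p, g p) ->
  differentiable (fun q => h (f q, g q)) p.
Proof.
move=> df dg dh.
exact: (differentiable_comp (differentiable_pair df dg) dh).
Qed.

Lemma derive_comp2 (f g : V -> R) h p v :
  differentiable f p -> differentiable g p -> differentiable h (f p, g p) ->
  'D_v (fun q => h (f q, g q)) p =
  'D_v f p * 'D_e1 h (f p, g p) + 'D_v g p * 'D_e2 h (f p, g p).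
Proof.
move=> df dg dh; have dfg := differentiable_pair df dg.
rewrite deriveE; last exact: differentiable_comp2.
have := @diff_comp _ _ _ _ _ h p dfg dh.
rewrite /comp => /(congr1 (fun F => F v)) ->.
rewrite -deriveE// deriveE_plane//=.
by rewrite diff_pair//= -!deriveE.
Qed.

Lemma diff_upto_comp2 n U (U' : set (R * R)) f g h : open U ->
  (forall p, U p -> U' (f p, g p)) ->
  diff_upto n U f -> diff_upto n U g -> diff_upto n U' h ->
  diff_upto n U (fun p => h (f p, g p)).
Proof.
move=> oU UU'; elim: n f g h UU' => [|n IH] f g h UU' df dg dh; split => //.
- move=> p Up; apply: differentiable_comp2; [exact: df.1|exact: dg.1|].
  by apply: dh.1; exact: UU'.
- move=> p Up; apply: differentiable_comp2; [exact: df.1|exact: dg.1|].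
  by apply: dh.1; exact: UU'.
move=> v; apply: (@eq_diff_upto _ _ _ _ _ (fun p =>
   'D_v f p * 'D_e1 h (f p, g p) + 'D_v g p * 'D_e2 h (f p, g p))) => //.
  move=> p Up; rewrite derive_comp2//; [exact: df.1|exact: dg.1|].
  by apply: dh.1; exact: UU'.
apply: diff_uptoD => //; apply: diff_uptoM => //; try exact: df.2; try exact: dg.2.
- by apply: (IH f g ('D_e1 h)) => //;
    [exact: diff_uptoW|exact: diff_uptoW|exact: dh.2].
- by apply: (IH f g ('D_e2 h)) => //;
    [exact: diff_uptoW|exact: diff_uptoW|exact: dh.2].
Qed.

Lemma smooth_comp2 U (U' : set (R * R)) f g h : open U ->
  (forall p, U p -> U' (f p, g p)) ->
  smooth_open U f -> smooth_open U g -> smooth_open U' h ->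
  smooth_open U (fun p => h (f p, g p)).
Proof.
move=> oU UU' /smooth_uptoP sf /smooth_uptoP sg /smooth_uptoP sh.
by apply/smooth_uptoP => n; apply: (@diff_upto_comp2 n U U').
Qed.

Lemma smooth_fst (U : set (R * R)) : smooth_open U fst.
Proof.
refine (@smooth_linear R (R * R)%type R U fst _) => p; exact: cvg_fst.
Qed.

Lemma smooth_snd (U : set (R * R)) : smooth_open U snd.
Proof.
refine (@smooth_linear R (R * R)%type R U snd _) => p; exact: cvg_snd.
Qed.

Lemma differentiable_fst p : differentiable (fst : R * R -> R) p.
Proof. exact: (smooth_differentiable (@smooth_fst setT) (I : setT p)). Qed.

Lemma differentiable_snd p : differentiable (snd : R * R -> R) p.
Proof. exact: (smooth_differentiable (@smooth_snd setT) (I : setT p)). Qed.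

Lemma derive_fst p v : 'D_v (fst : R * R -> R) p = v.1.
Proof.
rewrite deriveE; last exact: differentiable_fst.
by rewrite (@diff_lin _ _ _ fst)// => x; exact: cvg_fst.
Qed.

Lemma derive_snd p v : 'D_v (snd : R * R -> R) p = v.2.
Proof.
rewrite deriveE; last exact: differentiable_snd.
by rewrite (@diff_lin _ _ _ snd)// => x; exact: cvg_snd.
Qed.

End Composition.

Section Pairs.
Context {R : realType} {V : normedModType R}.
Implicit Types (U : set V) (f g : V -> R).

Lemma diff_upto_pair n U f g : open U -> diff_upto n U f -> diff_upto n U g ->
  diff_upto n U (fun p => (f p, g p)).
Proof.
move=> oU; elim: n f g => [|n IH] f g [df df'] [dg dg']; split => //.
- by move=> p Up; apply: differentiable_pair; [exact: df|exact: dg].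
- by move=> p Up; apply: differentiable_pair; [exact: df|exact: dg].
move=> v; apply: (@eq_diff_upto _ _ _ _ _ (fun p => ('D_v f p, 'D_v g p))) => //.
  move=> p Up; have [dfp dgp] := (df _ Up, dg _ Up).
  rewrite [RHS]deriveE; last exact: differentiable_pair.
  by rewrite diff_pair//= -!deriveE.
by apply: IH; [exact: df'|exact: dg'].
Qed.

Lemma smooth_pair U f g : open U -> smooth_open U f -> smooth_open U g ->
  smooth_open U (fun p => (f p, g p)).
Proof.
move=> oU /smooth_uptoP sf /smooth_uptoP sg; apply/smooth_uptoP => n.
exact: diff_upto_pair.
Qed.

End Pairs.

(** * Elementary functions and calculus in the plane *)

Section OneVariable.
Context {R : realType} {V : normedModType R}.
Implicit Types (U : set V) (f : V -> R) (h : R -> R).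

Lemma derive_comp1 f h p v : differentiable f p -> derivable h (f p) 1 ->
  'D_v (h \o f) p = 'D_1 h (f p) * 'D_v f p.
Proof.
move=> df /derivable1_diffP dh; rewrite deriveE; last exact: differentiable_comp.
rewrite diff_comp//= !deriveE//; move: ('d f p v) => y.
by rewrite -[in LHS](mulr1 y) -[y * 1]/(y *: 1) linearZ/= [RHS]mulrC.
Qed.

Lemma differentiable_comp1 f h p : differentiable f p -> derivable h (f p) 1 ->
  differentiable (h \o f) p.
Proof. by move=> df /derivable1_diffP dh; exact: differentiable_comp. Qed.

Lemma diff_upto_expR n U f : open U -> diff_upto n U f ->
  diff_upto n U (expR \o f).
Proof.
move=> oU; elim: n => [|n IH] sf; split => //.
- by move=> p Up; apply: differentiable_comp1; [exact: sf.1|exact: derivable_expR].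
- by move=> p Up; apply: differentiable_comp1; [exact: sf.1|exact: derivable_expR].
move=> v; apply: (@eq_diff_upto _ _ _ _ _ (fun p => (expR \o f) p * 'D_v f p)) => //.
  move=> p Up; rewrite [RHS]derive_comp1; [|exact: sf.1|exact: derivable_expR].
  by rewrite /= derive_val.
apply: diff_uptoM => //; last exact: sf.2.
exact/IH/diff_uptoW.
Qed.

Lemma smooth_expR U f : open U -> smooth_open U f -> smooth_open U (expR \o f).
Proof.
move=> oU /smooth_uptoP sf; apply/smooth_uptoP => n; exact: diff_upto_expR.
Qed.

Lemma diff_upto_sincos n U f : open U -> diff_upto n U f ->
  diff_upto n U (sin \o f) /\ diff_upto n U (cos \o f).
Proof.
move=> oU; have dsin x : derivable (@sin R) x 1 by apply: ex_derive; exact: is_derive_sin.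
have dcos x : derivable (@cos R) x 1 by apply: ex_derive; exact: is_derive_cos.
elim: n => [|n IH] sf; split; split => //.
- by move=> p Up; apply: differentiable_comp1; [exact: sf.1|exact: dsin].
- by move=> p Up; apply: differentiable_comp1; [exact: sf.1|exact: dcos].
- by move=> p Up; apply: differentiable_comp1; [exact: sf.1|exact: dsin].
- move=> v; apply: (@eq_diff_upto _ _ _ _ _ (fun p => (cos \o f) p * 'D_v f p)) => //.
    by move=> p Up; rewrite [RHS]derive_comp1; [rewrite derive_val|exact: sf.1|exact: dsin].
  by apply: diff_uptoM => //; [exact/(IH _).2/diff_uptoW|exact: sf.2].
- by move=> p Up; apply: differentiable_comp1; [exact: sf.1|exact: dcos].
- move=> v; apply: (@eq_diff_upto _ _ _ _ _
     (fun p => (-1 * (sin \o f) p) * 'D_v f p)) => //.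
    by move=> p Up; rewrite [RHS]derive_comp1;
      [rewrite derive_val mulN1r|exact: sf.1|exact: dcos].
  apply: diff_uptoM => //; last exact: sf.2.
  by apply: diff_uptoM => //; [exact: diff_upto_cst|exact/(IH _).1/diff_uptoW].
Qed.

Lemma smooth_sin U f : open U -> smooth_open U f -> smooth_open U (sin \o f).
Proof.
move=> oU /smooth_uptoP sf; apply/smooth_uptoP => n.
by have [] := diff_upto_sincos oU (sf n).
Qed.

Lemma smooth_cos U f : open U -> smooth_open U f -> smooth_open U (cos \o f).
Proof.
move=> oU /smooth_uptoP sf; apply/smooth_uptoP => n.
by have [] := diff_upto_sincos oU (sf n).
Qed.

Lemma smoothX U f n : open U -> smooth_open U f -> smooth_open U (fun p => f p ^+ n).
Proof.
move=> oU sf; elim: n => [|n IH].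
  by apply: (eq_smooth oU _ (@smooth_cst R V R U 1)) => p _; rewrite expr0.
by apply: (eq_smooth oU _ (smoothM oU sf IH)) => p _; rewrite exprS.
Qed.

End OneVariable.

Section NullDifferential.
Context {R : realType} {V W : normedModType R}.

Lemma null_differential (f : V -> W) p :
  (forall e : R, 0 < e -> \forall q \near p, `|f q - f p| <= e * `|q - p|) ->
  differentiable f p /\ forall v, 'D_v f p = 0.
Proof.
move=> H; pose z : {linear V -> W} := \0.
have cd : continuous z by move=> x; exact: cst_continuous.
have dE : f \o shift p = cst (f p) + z +o_ 0 id.
  apply/eqaddoP => e e0.
  have sh : (fun h : V => h + p) @ 0 --> p.
    by rewrite -[X in _ --> X]add0r; apply: cvgD; [exact: cvg_id|exact: cvg_cst].
  have : \forall h \near 0, `|f (h + p) - f p| <= e * `|h + p - p|.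
    exact: sh (H e e0).
  by apply: filterS => h; rewrite addrK !fctE/= addr0.
have d0 := diff_unique cd dE.
have df : differentiable f p by apply/diff_locallyP; rewrite d0.
by split => // v; rewrite deriveE// d0.
Qed.

Lemma differentiable_near (f : V -> W) p : differentiable f p ->
  forall e : R, 0 < e -> \forall q \near p,
    `|f q - f p - 'd f p (q - p)| <= e * `|q - p|.
Proof.
move=> df e e0; have [_ dE] := (diff_locallyP p f).1 df.
have /eqaddoP/(_ e e0) H := dE.
have sh : (fun q : V => q - p) @ p --> 0.
  by rewrite -(subrr p); apply: cvgB; [exact: cvg_id|exact: cvg_cst].
have := sh _ H; rewrite nbhs_simpl/=; apply: filterS => q.
by rewrite !fctE/= subrK opprD addrA.
Qed.

End NullDifferential.

Section Plane.
Context {R : realType}.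
Implicit Types (U : set (R * R)) (f g h : R * R -> R) (p q : R * R).

Definition edir (b : bool) : R * R := if b then e2 else e1.
Definition Dword (w : seq bool) f : R * R -> R := iter_derive (map edir w) f.

Lemma Dword_cons b w f : Dword (b :: w) f = 'D_(edir b) (Dword w f).
Proof. by []. Qed.

Lemma Dword_cat w w' f : Dword (w ++ w') f = Dword w (Dword w' f).
Proof. by rewrite /Dword map_cat iter_derive_cat. Qed.

Lemma Dword_rcons w b f : Dword (rcons w b) f = Dword w ('D_(edir b) f).
Proof. by rewrite -cats1 Dword_cat. Qed.

Lemma smooth_Dword U f w : smooth_open U f -> smooth_open U (Dword w f).
Proof. exact: smooth_iter_derive. Qed.

Lemma Dword_eq U f g w : open U -> (forall p, U p -> f p = g p) ->
  forall p, U p -> Dword w f p = Dword w g p.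
Proof. exact: iter_derive_eq. Qed.

(** Directional derivatives are combinations of the two partial derivatives, so
    that words in the two basis vectors suffice. *)
Lemma smooth_basis U f : open U ->
  (forall w p, U p -> differentiable (Dword w f) p) -> smooth_open U f.
Proof.
move=> oU df; apply/smooth_uptoP => n; elim: n f df => [|n IH] f df.
  by split => // p; exact: (df [::]).
split; first by move=> p; exact: (df [::]).
move=> v; apply: (@eq_diff_upto _ _ _ _ _
  (fun p => v.1 * 'D_e1 f p + v.2 * 'D_e2 f p)) => //.
  by move=> p Up; rewrite [RHS]deriveE_plane//; exact: (df [::]).
apply: diff_uptoD => //; apply: diff_uptoM => //; try exact: diff_upto_cst.
- by apply: (IH ('D_e1 f)) => w p Up; have := df (rcons w false) p Up; rewrite Dword_rcons.
- by apply: (IH ('D_e2 f)) => w p Up; have := df (rcons w true) p Up; rewrite Dword_rcons.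
Qed.

Lemma norm_planeE p : `|p| = Num.max `|p.1| `|p.2|.
Proof. by []. Qed.

Lemma norm1_le p : `|p.1| <= `|p|.
Proof. by rewrite norm_planeE le_max lexx. Qed.

Lemma norm2_le p : `|p.2| <= `|p|.
Proof. by rewrite norm_planeE le_max lexx orbT. Qed.

Lemma norm_plane_le p e : `|p.1| <= e -> `|p.2| <= e -> `|p| <= e.
Proof. by move=> h1 h2; rewrite norm_planeE ge_max h1 h2. Qed.

Lemma nearP p (P : set (R * R)) :
  (\forall q \near p, P q) <->
  exists2 e : R, 0 < e & forall q, `|q.1 - p.1| < e -> `|q.2 - p.2| < e -> P q.
Proof.
split.
  move=> /nbhs_ballP[e /= e0 He]; exists e => // q h1 h2; apply: He.
  by split; rewrite /ball/= distrC.
move=> [e e0 He]; apply/nbhs_ballP; exists e => //= q [h1 h2].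
by apply: He; rewrite distrC.
Qed.

(** Subtracting the linear form reduces this to [null_differential]. *)
Lemma diff_eps f p l1 l2 :
  (forall e : R, 0 < e -> \forall q \near p,
    `|f q - f p - (l1 * (q.1 - p.1) + l2 * (q.2 - p.2))| <= e * `|q - p|) ->
  differentiable f p /\ forall v, 'D_v f p = l1 * v.1 + l2 * v.2.
Proof.
move=> H; pose L q := l1 * q.1 + l2 * q.2.
have sL : smooth_open setT L.
  by apply: smoothD; [exact: openT|apply: smoothZ; [exact: openT|exact: smooth_fst]
    |apply: smoothZ; [exact: openT|exact: smooth_snd]].
have dL q := smooth_differentiable sL (I : setT q).
have DL v : 'D_v L p = l1 * v.1 + l2 * v.2.
  have dfst := differentiable_fst p; have dsnd := differentiable_snd p.
  have dc (c : R) : differentiable (cst c : R * R -> R) p by exact: differentiable_cst.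
  rewrite /L deriveD; try by apply/diff_derivable/differentiableM.
  by rewrite !derive_mul// derive_fst derive_snd !derive_cst !mulr0 !addr0.
have [dr Dr] : differentiable (fun q => f q - L q) p /\
    forall v, 'D_v (fun q => f q - L q) p = 0.
  apply: null_differential => e e0; have := H e e0; apply: filterS => q.
  by congr (`|_| <= _); rewrite /L; ring.
have fE : f = (fun q => f q - L q) + L by apply/funext => q; rewrite !fctE; ring.
split; first by rewrite fE; apply: differentiableD.
move=> v; rewrite fE deriveD; try exact: diff_derivable.
by rewrite Dr DL add0r.
Qed.

Lemma diff_eps_inv f p : differentiable f p ->
  forall e : R, 0 < e -> \forall q \near p,
    `|f q - f p - ('D_e1 f p * (q.1 - p.1) + 'D_e2 f p * (q.2 - p.2))|
      <= e * `|q - p|.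
Proof.
move=> df e e0; have := differentiable_near df e0; apply: filterS => q.
rewrite -deriveE// deriveE_plane//=.
by rewrite ![_ * 'D__ f p]mulrC.
Qed.

Lemma derive_vert f (x y : R) : differentiable f (x, y) ->
  is_derive y 1 (fun t => f (x, t)) ('D_e2 f (x, y)).
Proof.
move=> df; have dc : differentiable (fun=> x : R) y by exact: differentiable_cst.
have di : differentiable (fun t : R => t) y.
  by apply/derivable1_diffP; exact: derivable_id.
apply: DeriveDef.
  exact/derivable1_diffP/(differentiable_comp2 dc di df).
by rewrite (derive_comp2 (1 : R) dc di df) derive_cst derive_id mul0r mul1r add0r.
Qed.

Lemma derive_horiz f (x y : R) : differentiable f (x, y) ->
  is_derive x 1 (fun t => f (t, y)) ('D_e1 f (x, y)).
Proof.
move=> df; have dc : differentiable (fun=> y : R) x by exact: differentiable_cst.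
have di : differentiable (fun t : R => t) x.
  by apply/derivable1_diffP; exact: derivable_id.
apply: DeriveDef.
  exact/derivable1_diffP/(differentiable_comp2 di dc df).
by rewrite (derive_comp2 (1 : R) di dc df) derive_cst derive_id mul0r mul1r addr0.
Qed.

Lemma mvt_vert f x y z : y <= z ->
  (forall t, y <= t <= z -> differentiable f (x, t)) ->
  exists2 t, y <= t <= z & f (x, z) - f (x, y) = 'D_e2 f (x, t) * (z - y).
Proof.
move=> yz df.
have fc : {within `[y, z], continuous (fun t => f (x, t))}.
  apply: derivable_within_continuous => t; rewrite in_itv/= => h.
  by apply: ex_derive; apply: derive_vert; apply: df.
have fd t : t \in `]y, z[%R -> is_derive t 1 (fun t => f (x, t))
    ('D_e2 f (x, t)).
  rewrite in_itv/= => /andP[/ltW h1 /ltW h2].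
  by apply: derive_vert; apply: df; rewrite h1.
have [t + E] := MVT_segment yz fd fc.
by rewrite in_itv/= => h; exists t.
Qed.

Lemma mvt_horiz f y x z : x <= z ->
  (forall t, x <= t <= z -> differentiable f (t, y)) ->
  exists2 t, x <= t <= z & f (z, y) - f (x, y) = 'D_e1 f (t, y) * (z - x).
Proof.
move=> yz df.
have fc : {within `[x, z], continuous (fun t => f (t, y))}.
  apply: derivable_within_continuous => t; rewrite in_itv/= => h.
  by apply: ex_derive; apply: derive_horiz; apply: df.
have fd t : t \in `]x, z[%R -> is_derive t 1 (fun t => f (t, y))
    ('D_e1 f (t, y)).
  rewrite in_itv/= => /andP[/ltW h1 /ltW h2].
  by apply: derive_horiz; apply: df; rewrite h1.
have [t + E] := MVT_segment yz fd fc.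
by rewrite in_itv/= => h; exists t.
Qed.

End Plane.

(** * Symmetry of second derivatives *)

Section Schwarz.
Context {R : realType}.
Implicit Types (U O D : set (R * R)) (f g h : R * R -> R) (p q : R * R).

Lemma mvt_line (f df : R -> R) (y z : R) : y <= z ->
  (forall t, y <= t <= z -> is_derive t 1 f (df t)) ->
  exists2 t, y <= t <= z & f z - f y = df t * (z - y).
Proof.
move=> yz dfE.
have fc : {within `[y, z], continuous f}.
  apply: derivable_within_continuous => t; rewrite in_itv/= => h.
  by apply: ex_derive; exact: dfE.
have fd t : t \in `]y, z[%R -> is_derive t 1 f (df t).
  by rewrite in_itv/= => /andP[/ltW h1 /ltW h2]; apply: dfE; rewrite h1.
have [t + E] := MVT_segment yz fd fc.
by rewrite in_itv/= => h; exists t.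
Qed.

Lemma second_difference21 f (x y k l : R) : 0 <= k -> 0 <= l ->
  (forall t s, x <= t <= x + k -> y <= s <= y + l ->
    differentiable f (t, s) /\ differentiable ('D_e2 f) (t, s)) ->
  exists t s, [/\ x <= t <= x + k, y <= s <= y + l &
    f (x + k, y + l) - f (x, y + l) - (f (x + k, y) - f (x, y)) =
    'D_e1 ('D_e2 f) (t, s) * k * l].
Proof.
move=> k0 l0 df.
have xx : x <= x <= x + k by rewrite lexx lerDl.
have xk : x <= x + k <= x + k by rewrite lexx lerDl k0.
have kx : x <= x + k by rewrite lerDl.
have ly : y <= y + l by rewrite lerDl.
have Hs s : y <= s <= y + l -> is_derive s 1 (fun s => f (x + k, s) - f (x, s))
    ('D_e2 f (x + k, s) - 'D_e2 f (x, s)).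
  move=> ys; have d1 := derive_vert (df _ _ xk ys).1.
  have d2 := derive_vert (df _ _ xx ys).1.
  by have := is_deriveB d1 d2.
have [s ys E] := mvt_line ly Hs.
have Ht t : x <= t <= x + k -> is_derive t 1 (fun t => 'D_e2 f (t, s))
    ('D_e1 ('D_e2 f) (t, s)).
  by move=> xt; apply: derive_horiz; exact: (df _ _ xt ys).2.
have [t xt Et] := mvt_line kx Ht.
exists t, s; split => //; rewrite E Et.
by rewrite [x + k]addrC addrK [y + l]addrC addrK.
Qed.

Lemma second_difference12 f (x y k l : R) : 0 <= k -> 0 <= l ->
  (forall t s, x <= t <= x + k -> y <= s <= y + l ->
    differentiable f (t, s) /\ differentiable ('D_e1 f) (t, s)) ->
  exists t s, [/\ x <= t <= x + k, y <= s <= y + l &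
    f (x + k, y + l) - f (x + k, y) - (f (x, y + l) - f (x, y)) =
    'D_e2 ('D_e1 f) (t, s) * l * k].
Proof.
move=> k0 l0 df.
have yy : y <= y <= y + l by rewrite lexx lerDl.
have yl : y <= y + l <= y + l by rewrite lexx lerDl l0.
have kx : x <= x + k by rewrite lerDl.
have ly : y <= y + l by rewrite lerDl.
have Ht t : x <= t <= x + k -> is_derive t 1 (fun t => f (t, y + l) - f (t, y))
    ('D_e1 f (t, y + l) - 'D_e1 f (t, y)).
  move=> xt; have d1 := derive_horiz (df _ _ xt yl).1.
  have d2 := derive_horiz (df _ _ xt yy).1.
  by have := is_deriveB d1 d2.
have [t xt E] := mvt_line kx Ht.
have Hs s : y <= s <= y + l -> is_derive s 1 (fun s => 'D_e1 f (t, s))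
    ('D_e2 ('D_e1 f) (t, s)).
  by move=> ys; apply: derive_vert; exact: (df _ _ xt ys).2.
have [s ys Es] := mvt_line ly Hs.
exists t, s; split => //; rewrite E Es.
by rewrite [x + k]addrC addrK [y + l]addrC addrK.
Qed.

Lemma continuous_near f p : {for p, continuous f} ->
  forall e : R, 0 < e -> \forall q \near p, `|f p - f q| <= e.
Proof. by move/cvgrPdist_le => cf e e0; exact: cf. Qed.

Lemma eq_of_near_values f g p :
  {for p, continuous f} -> {for p, continuous g} ->
  (forall d, 0 < d -> exists q r,
    [/\ `|q.1 - p.1| < d, `|q.2 - p.2| < d, `|r.1 - p.1| < d, `|r.2 - p.2| < d
      & f q = g r]) ->
  f p = g p.
Proof.
move=> cf cg H; apply/eqP; rewrite -subr_eq0 -normr_le0.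
apply/ler_addgt0Pr => e e0; rewrite add0r.
have e20 : 0 < e / 2 by rewrite divr_gt0.
have /nearP[d1 d10 H1] := continuous_near cf e20.
have /nearP[d2 d20 H2] := continuous_near cg e20.
have [|q [r [q1 q2 r1 r2 E]]] := H (Num.min d1 d2); first by rewrite lt_min d10.
rewrite !lt_min in q1 q2 r1 r2.
have {}H1 : `|f p - f q| <= e / 2.
  by apply: H1; [case/andP: q1|case/andP: q2].
have {}H2 : `|g p - g r| <= e / 2.
  by apply: H2; [case/andP: r1|case/andP: r2].
rewrite (_ : f p - g p = (f p - f q) - (g p - g r)); last by rewrite E; ring.
by rewrite (le_trans (ler_normB _ _))// [leRHS]splitr lerD.
Qed.

(** Symmetry of second derivatives: both mixed derivatives evaluate the same
    second difference at points arbitrarily close to [p]. *)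
Lemma derive_comm U f p : open U -> smooth_open U f -> U p ->
  'D_e1 ('D_e2 f) p = 'D_e2 ('D_e1 f) p.
Proof.
case: p => x y oU sf Up.
have s1 := smooth_derive e1 sf; have s2 := smooth_derive e2 sf.
apply: (eq_of_near_values (f := 'D_e1 ('D_e2 f)) (g := 'D_e2 ('D_e1 f))).
- exact: (smooth_continuous (smooth_derive e1 s2) Up).
- exact: (smooth_continuous (smooth_derive e2 s1) Up).
move=> d d0.
have /nearP[d' d'0 Hd] : \forall q \near (x, y), U q by exact: open_nbhs_nbhs.
pose k := Num.min d d' / 2.
have m0 : 0 < Num.min d d' by rewrite lt_min d0.
have k0 : 0 < k by rewrite divr_gt0.
have kd : k < Num.min d d' by rewrite /k ltr_pdivrMr// ltr_pMr// ltr1n.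
rewrite lt_min in kd; have /andP[kd1 kd2] := kd.
have near_le (u v l : R) : u <= v <= u + k -> k < l -> `|v - u| < l.
  move=> /andP[h1 h2] kl.
  by rewrite ger0_norm ?subr_ge0// ltrBlDr (le_lt_trans h2)// addrC ltrD2r.
have inU t s : x <= t <= x + k -> y <= s <= y + k -> U (t, s).
  by move=> h1 h2; apply: Hd; exact: near_le kd2.
have H21 t s : x <= t <= x + k -> y <= s <= y + k ->
    differentiable f (t, s) /\ differentiable ('D_e2 f) (t, s).
  move=> xt ys; have Uts := inU _ _ xt ys.
  by split; [exact: smooth_differentiable sf Uts|exact: smooth_differentiable s2 Uts].
have H12 t s : x <= t <= x + k -> y <= s <= y + k ->
    differentiable f (t, s) /\ differentiable ('D_e1 f) (t, s).
  move=> xt ys; have Uts := inU _ _ xt ys.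
  by split; [exact: smooth_differentiable sf Uts|exact: smooth_differentiable s1 Uts].
have [t [s [xt ys]]] := second_difference21 (ltW k0) (ltW k0) H21.
have [t' [s' [xt' ys']]] := second_difference12 (ltW k0) (ltW k0) H12.
move: ('D_e1 ('D_e2 f)) ('D_e2 ('D_e1 f)) => A B EB EA.
exists (t, s), (t', s'); split; try by apply: near_le kd1.
apply: (@mulIf _ k); first by rewrite gt_eqF.
apply: (@mulIf _ k); first by rewrite gt_eqF.
refine (etrans (esym EA) (etrans _ EB)).
move: (f (x + k, y + k)) (f (x, y + k)) (f (x + k, y)) (f (x, y)) => P Q S T.
by ring.
Qed.

End Schwarz.

(** * Flat functions extended by zero *)

Section FlatSmooth.
Context {R : realType}.
Implicit Types (U O D : set (R * R)) (f g h : R * R -> R) (p q : R * R).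

Definition ext0 f : R * R -> R := fun p => if 0 < p.2 then f p else 0.

Definition vanishes_at f p :=
  forall e : R, 0 < e -> \forall q \near p, 0 < q.2 -> `|f q| <= e.

(** For functions defined on both sides of the boundary interval, flatness is
    smoothness together with vanishing for [phi <= 0]. *)
Definition flat_smooth O f :=
  smooth_open O f /\ forall p, O p -> p.2 <= 0 -> f p = 0.

Definition upper O := O `&` [set p | 0 < p.2].

Lemma open_upper_half : open [set p : R * R | 0 < p.2].
Proof.
rewrite openE => p /= p0; apply/nearP; exists p.2 => // q _.
by rewrite ltr_distl subrr => /andP[].
Qed.

Lemma open_lower_half : open [set p : R * R | p.2 < 0].
Proof.
rewrite openE => p /= p0; apply/nearP; exists (- p.2); first by rewrite oppr_gt0.
by move=> q _; rewrite ltr_distl subrr => /andP[].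
Qed.

Lemma open_upper O : open O -> open (upper O).
Proof. by move=> oO; apply: openI => //; exact: open_upper_half. Qed.

(** The mean value theorem on vertical segments that start at a small positive
    height, since nothing is known about [f] at height 0. *)
Lemma vanishing_bound D f p : open D -> smooth_open (upper D) f ->
  D p -> p.2 = 0 ->
  (forall q, D q -> q.2 = 0 -> vanishes_at f q) -> vanishes_at ('D_e2 f) p ->
  forall e : R, 0 < e -> \forall q \near p, 0 < q.2 -> `|f q| <= e * q.2.
Proof.
move=> oD sf Dp p0 vf vdf e e0.
have /nearP[d d0 Hd] : \forall q \near p, D q by exact: open_nbhs_nbhs.
have /nearP[d' d'0 Hd'] := vdf e e0.
apply/nearP; exists (Num.min d d'); first by rewrite lt_min d0.
move=> [x y] /=; rewrite p0 subr0 !lt_min => /andP[x1 x2] /andP[y1 y2] y0.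
have box s : 0 <= s <= y -> D (x, s).
  move=> /andP[s0 sy]; apply: Hd => //=.
  by rewrite p0 subr0 ger0_norm// (le_lt_trans sy)// -(gtr0_norm y0).
apply/ler_addgt0Pr => e' e'0.
have bx0 : D (x, 0) by apply: box; rewrite lexx ltW.
have /nearP[d2 d20 Hd2] := vf (x, 0) bx0 erefl e' e'0.
pose s := Num.min (d2 / 2) y.
have s0 : 0 < s by rewrite lt_min y0 divr_gt0.
have sy : s <= y by rewrite ge_min lexx orbT.
have sd2 : s < d2.
  by rewrite (@le_lt_trans _ _ (d2 / 2))//; [rewrite ge_min lexx|rewrite ltr_pdivrMr// ltr_pMr// ltr1n].
have hs : `|f (x, s)| <= e'.
  by apply: Hd2 => //=; rewrite ?subrr ?normr0// subr0 gtr0_norm.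
have dfs t : s <= t <= y -> differentiable f (x, t).
  move=> /andP[st ty]; apply: (smooth_differentiable sf); split.
    by apply: box; rewrite ty (le_trans (ltW s0)).
  exact: lt_le_trans st.
have [t /andP[st ty] E] := mvt_vert sy dfs.
have t0 : 0 < t by exact: lt_le_trans st.
have hD : `|'D_e2 f (x, t)| <= e.
  apply: Hd' => //=; rewrite p0 subr0 gtr0_norm// (le_lt_trans ty)//.
  by rewrite -(gtr0_norm y0).
rewrite -(subrK (f (x, s)) (f (x, y))) (le_trans (ler_normD _ _))//.
apply: lerD => //; rewrite E normrM ler_pM// ger0_norm ?subr_ge0//.
by rewrite gerBl ltW.
Qed.

(** By [vanishing_bound] the zero extension of each derivative has differential
    zero at the points of the boundary interval. *)
Lemma glue_zero O f : open O -> smooth_open (upper O) f ->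
  (forall w p, O p -> p.2 = 0 -> vanishes_at (Dword w f) p) ->
  flat_smooth O (ext0 f).
Proof.
move=> oO sf vf; split; last first.
  by move=> p _ p0; rewrite /ext0 ltNge p0.
have key g : smooth_open (upper O) g ->
    (forall w p, O p -> p.2 = 0 -> vanishes_at (Dword w g) p) ->
    forall p, O p -> differentiable (ext0 g) p /\
      forall b, 'D_(edir b) (ext0 g) p = ext0 ('D_(edir b) g) p.
  move=> sg vg p Op; have [p0|p0|p0] := ltrgtP p.2 0.
  - have E : {near p, cst 0 =1 ext0 g}.
      apply: (open_near_eq open_lower_half p0) => q; rewrite inE /= => q0.
      by rewrite /ext0 ltNge (ltW q0).
    split.
      by apply: near_eq_differentiable E _; exact: differentiable_cst.
    move=> b; rewrite -(near_eq_derive _ E) derive_cst.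
    by rewrite /ext0 ltNge (ltW p0).
  - have E : {near p, g =1 ext0 g}.
      apply: (open_near_eq open_upper_half p0) => q; rewrite inE /= => q0.
      by rewrite /ext0 q0.
    have dg : differentiable g p by apply: (smooth_differentiable sg).
    split; first exact: near_eq_differentiable E dg.
    by move=> b; rewrite -(near_eq_derive _ E) /ext0 p0.
  have gp : ext0 g p = 0 by rewrite /ext0 p0 ltxx.
  have [] := @null_differential _ _ _ (ext0 g) p.
    move=> e e0.
    have := vanishing_bound oO sg Op p0 (vg [::]) (vg [:: true] p Op p0) e0.
    apply: filterS => q H; rewrite gp subr0 /ext0; case: ifPn => q0; last first.
      by rewrite normr0 mulr_ge0// ltW.
    rewrite (le_trans (H q0))// ler_pM2l//.
    by rewrite (le_trans _ (norm2_le _))//= p0 subr0 ler_norm.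
  by move=> d D0; split=> // b; rewrite D0 /ext0 p0 ltxx.
have main w : (forall p, O p -> Dword w (ext0 f) p = ext0 (Dword w f) p).
  elim: w => [//|b w IH] p Op.
  rewrite !Dword_cons (eq_derive (edir b) oO IH)//.
  apply: (key _ _ _ p Op).2; first exact: smooth_Dword.
  by move=> w'; rewrite -Dword_cat; exact: vf.
apply: smooth_basis => // w p Op.
apply: (@near_eq_differentiable _ _ _ (ext0 (Dword w f))).
  by apply: (open_near_eq oO Op) => q; rewrite inE => /main ->.
apply: (key _ _ _ p Op).1; first exact: smooth_Dword.
by move=> w'; rewrite -Dword_cat; exact: vf.
Qed.

(** On the boundary interval the derivative vanishes by continuity from below. *)
Lemma flat_smooth_derive O f b : open O -> flat_smooth O f ->
  flat_smooth O ('D_(edir b) f).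
Proof.
move=> oO [sf f0]; have sd := smooth_derive (edir b) sf.
split => // p Op p0.
have neg q : O q -> q.2 < 0 -> 'D_(edir b) f q = 0.
  move=> Oq q0; rewrite (@near_eq_derive _ _ _ _ (cst 0) q) ?derive_cst//.
  have oOl : open (O `&` [set p | p.2 < 0]) by apply: openI => //; exact: open_lower_half.
  apply: (open_near_eq oOl) => // r; rewrite inE => -[Or r0].
  by rewrite f0// ltW.
move: p0; rewrite le_eqVlt => /orP[/eqP p0|]; last exact: neg.
apply/eqP; rewrite -normr_le0; apply/ler_addgt0Pr => e e0; rewrite add0r.
have cD := smooth_continuous sd Op.
have oO' : \forall q \near p, O q by exact: open_nbhs_nbhs.
have /nearP[d d0 Hd] : \forall q \near p,
    O q /\ `|'D_(edir b) f p - 'D_(edir b) f q| <= e.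
  by apply: filterS2 oO' (continuous_near cD e0) => q; exact: conj.
have dd : d / 2 < d by rewrite ltr_pdivrMr// ltr_pMr// ltr1n.
have [||Oq] := Hd (p.1, p.2 - d / 2) => /=.
- by rewrite subrr normr0.
- by rewrite addrAC subrr sub0r normrN gtr0_norm// divr_gt0.
by rewrite (neg (p.1, p.2 - d / 2))//= ?subr0// p0 sub0r oppr_lt0 divr_gt0.
Qed.

Lemma flat_smooth_Dword O f w : open O -> flat_smooth O f ->
  flat_smooth O (Dword w f).
Proof.
by move=> oO ff; elim: w => [//|b w IH]; rewrite Dword_cons; exact: flat_smooth_derive.
Qed.

Lemma flat_smoothD O f g : open O -> flat_smooth O f -> flat_smooth O g ->
  flat_smooth O (fun p => f p + g p).
Proof.
move=> oO [sf f0] [sg g0]; split; first exact: smoothD.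
by move=> p Op p0; rewrite f0// g0// addr0.
Qed.

Lemma flat_smoothM O f g : open O -> smooth_open O f -> flat_smooth O g ->
  flat_smooth O (fun p => f p * g p).
Proof.
move=> oO sf [sg g0]; split; first exact: smoothM.
by move=> p Op p0; rewrite g0// mulr0.
Qed.

Lemma flat_smoothN O g : open O -> flat_smooth O g ->
  flat_smooth O (fun p => - g p).
Proof.
move=> oO [sg g0]; split; first exact: smoothN.
by move=> p Op p0; rewrite g0// oppr0.
Qed.

Lemma flat_smoothB O f g : open O -> flat_smooth O f -> flat_smooth O g ->
  flat_smooth O (fun p => f p - g p).
Proof. by move=> oO ff fg; apply: flat_smoothD => //; exact: flat_smoothN. Qed.

Lemma flat_smoothS O O' f : O' `<=` O -> flat_smooth O f -> flat_smooth O' f.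
Proof.
by move=> OO [sf f0]; split; [exact: smooth_openS sf|move=> p /OO; exact: f0].
Qed.

Definition box (al be eta : R) : set (R * R) :=
  [set p | al <= p.1 <= be /\ 0 <= p.2 <= eta].

Lemma compact_box al be eta : compact (box al be eta).
Proof.
have -> : box al be eta = `[al, be]%classic `*` `[0, eta]%classic.
  by apply/seteqP; split=> p /=; rewrite !in_itv.
by apply: compact_setX; exact: segment_compact.
Qed.

Lemma box_bounded O f al be eta : smooth_open O f -> box al be eta `<=` O ->
  exists2 C, 0 <= C & forall p, box al be eta p -> `|f p| <= C.
Proof.
move=> sf bO; have [b0|/set0P bn0] := eqVneq (box al be eta) set0.
  by exists 0 => // p; rewrite b0.
have [|c _ Hc] := compact_EVT_max (f := fun p => `|f p|) bn0 (@compact_box al be eta).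
  apply: continuous_in_subspaceT => p; rewrite inE => /bO Op.
  by apply: continuous_comp; [exact: smooth_continuous sf Op|exact: norm_continuous].
by exists `|f c| => // p bp; apply: Hc; rewrite inE.
Qed.

(** Repeated integration of the [phi]-derivative from the boundary gains one
    power of [phi] at each step. *)
Lemma flat_smooth_bound O f al be eta M : open O -> flat_smooth O f ->
  box al be eta `<=` O ->
  exists2 C, 0 <= C & forall p, box al be eta p -> `|f p| <= C * p.2 ^+ M.
Proof.
move=> oO + bO; elim: M f => [|M IH] f ff.
  have [C C0 H] := box_bounded ff.1 bO.
  by exists C => // p /H; rewrite expr0 mulr1.
have [C C0 H] := IH _ (flat_smooth_derive true oO ff).
exists C => // -[x y] [/= xb /andP[y0 yeta]].
have inb t : 0 <= t <= y -> box al be eta (x, t).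
  by move=> /andP[t0 ty]; split=> //=; rewrite t0 (le_trans ty).
have dfs t : 0 <= t <= y -> differentiable f (x, t).
  by move=> /inb /bO; exact: smooth_differentiable ff.1.
have [t tb E] := mvt_vert y0 dfs; have /andP[t0 ty] := tb.
rewrite -[f (x, y)]subr0 -(ff.2 (x, 0) _ (lexx _)); last first.
  by apply/bO/inb; rewrite lexx.
rewrite E subr0 normrM (ger0_norm y0) exprSr mulrA ler_wpM2r//.
rewrite (le_trans (H _ (inb _ tb)))// ler_wpM2l//.
by rewrite lerXn2r// nnegrE.
Qed.

End FlatSmooth.

(** * Flatness on adjacent domains *)

Section FlatTransfer.
Context {R : realType}.
Implicit Types (a b : \bar R) (U V W O : set (R * R)) (f g h : R * R -> R)
  (p q : R * R).

Definition collar a b V : set (R * R) :=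
  with_boundary a b V `|` [set p | p.2 < 0].

Lemma adjacent_above a b V : domain_adjacent a b V ->
  forall p, V p -> 0 < p.2.
Proof. by move=> [_ _ + _ _] p; apply. Qed.

Lemma open_collar a b V : domain_adjacent a b V -> open (collar a b V).
Proof.
move=> [oV _ _ _ adj]; rewrite openE => p [[Vp|Jp]|p0].
- have : \near p, V p by exact: open_nbhs_nbhs.
  by apply: filterS => q Vq; left; left.
- have := adj p Jp; apply: filterS => q Hq.
  by have [/Hq|q0] := leP 0 q.2; [left|right].
- have : \near p, [set p | p.2 < 0] p.
    by apply: open_nbhs_nbhs; split => //; exact: open_lower_half.
  by apply: filterS => q q0; right.
Qed.

Lemma boundary_collar a b V p : collar a b V p -> p.2 = 0 ->
  domain_adjacent a b V -> boundary_interval a b p.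
Proof.
move=> + p0 /adjacent_above H => -[[/H|//]|]; rewrite /= p0 ltxx//.
Qed.

Lemma upper_collar a b V p : domain_adjacent a b V ->
  upper (collar a b V) p <-> V p.
Proof.
move=> adj; split; last first.
  by move=> Vp; split; [left; left|exact: adjacent_above adj p Vp].
by move=> [[[//|[_ [_ p0]]]|p0] /= p1]; move: p1; rewrite ?p0 ?ltxx// ltNge ltW.
Qed.

Lemma Dword_nseq_rcons n w f U : open U -> smooth_open U f ->
  forall p, U p ->
    Dword (true :: nseq n false ++ w) f p = Dword (nseq n false ++ true :: w) f p.
Proof.
move=> oU sf; elim: n => [//|n IH] p Up.
refine (etrans _ (eq_derive (edir false) oU IH Up)).
exact: (esym (derive_comm oU (smooth_Dword (nseq n false ++ w) sf) Up)).
Qed.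

(** By symmetry of second derivatives; [flat] only speaks of the derivatives in
    this order. *)
Lemma Dword_sorted w f U : open U -> smooth_open U f ->
  exists i j, forall p, U p ->
    Dword w f p = Dword (nseq i false ++ nseq j true) f p.
Proof.
move=> oU sf; elim: w => [|[] w [i [j IH]]]; first by exists 0%N, 0%N.
- exists i, j.+1 => p Up.
  refine (etrans (eq_derive (edir true) oU IH Up) _).
  exact: Dword_nseq_rcons oU sf p Up.
- exists i.+1, j => p Up.
  exact: (eq_derive (edir false) oU IH Up).
Qed.

Lemma partialE i j f : partial i j f = Dword (nseq i false ++ nseq j true) f.
Proof.
rewrite /partial Dword_cat; elim: i => [|i IH] /=; last first.
  by rewrite IH.
by elim: j => [//|j IH] /=; rewrite IH.
Qed.

Lemma uniform_cvg0P (K : set R) (F : R -> R -> R) :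
  {uniform K, F @ 0^'+ --> (fun=> 0 : R)} <->
  forall e : R, 0 < e -> \forall y \near 0^'+, forall t, K t -> `|F y t| <= e.
Proof.
split.
  move=> cF e e0; have := cF [set h : R -> R | forall t, K t -> `|h t| <= e].
  apply; apply/uniform_nbhs.
  exists [set xy : R * R | `|xy.1 - xy.2| < e]; split.
    by rewrite -entourage_ballE; exists e.
  by move=> h /= H t /H; rewrite sub0r normrN => /ltW.
move=> H P /uniform_nbhs[E [entE EP]].
move: entE; rewrite -entourage_ballE => -[e /= e0 He].
have e20 : 0 < e / 2 by rewrite divr_gt0.
have := H _ e20; apply: filterS => y Hy; apply: EP => t Kt; apply: He => /=.
rewrite /ball/= sub0r normrN (le_lt_trans (Hy t Kt))//.
by rewrite ltr_pdivrMr// ltr_pMr// ltr1n.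
Qed.

(** Near a boundary point [f] has a smooth extension [g]. All derivatives of [g]
    vanish at that point, because those of [f] tend to zero, and so the
    derivatives of [f] vanish there in the sense of [glue_zero]. *)
Lemma flat_ext0 a b V f : domain_adjacent a b V -> flat a b V f ->
  flat_smooth (collar a b V) (ext0 f).
Proof.
move=> adj [sf f0 uf]; have oC := open_collar adj.
have [oV _ _ _ nV] := adj.
apply: glue_zero => //.
  apply: smooth_open_local => p /(upper_collar p adj) Vp.
  have [U [g [oU Up sg gf]]] := sf p (or_introl Vp).
  exists (U `&` V), g; split => //; first exact: openI.
  - by apply: smooth_openS sg => q [].
  - by move=> q [Uq Vq]; rewrite gf//; left.
move=> w p Cp p0 e e0.
have Jp := boundary_collar Cp p0 adj.
have [U [g [oU Up sg gf]]] := sf p (or_intror Jp).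
have oUV : open (U `&` V) by exact: openI.
have fgUV q : (U `&` V) q -> f q = g q by move=> [Uq Vq]; rewrite gf//; left.
have UVnear : \forall q \near p, 0 < q.2 -> (U `&` V) q.
  have h1 : \forall q \near p, U q by exact: open_nbhs_nbhs.
  apply: filterS2 h1 (nV p Jp) => q Uq Hq q0; split => //.
  by have [//|[_ [_ q00]]] := Hq (ltW q0); rewrite q00 ltxx in q0.
have [i [j Eij]] := Dword_sorted w oU sg.
have cD := smooth_continuous (smooth_Dword w sg) Up.
have gp0 : Dword w g p = 0.
  apply/eqP; rewrite -normr_le0; apply/ler_addgt0Pr => d d0; rewrite add0r.
  have d20 : 0 < d / 2 by rewrite divr_gt0.
  have K1 : compact [set p.1] by exact: compact_set1.
  have Ksub : [set p.1] `<=` [set t | (a < t%:E)%E /\ (t%:E < b)%E].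
    by move=> t ->; case: Jp => ? [].
  have /uniform_cvg0P/(_ _ d20) H1 := uf i j _ K1 Ksub.
  have /nearP[r r0 H2] : \forall q \near p,
      (0 < q.2 -> (U `&` V) q) /\ `|Dword w g p - Dword w g q| <= d / 2.
    by apply: filterS2 UVnear (continuous_near cD d20) => q; exact: conj.
  have [y [[y0 yr] Hy]] : exists y, (0 < y /\ y < r) /\
      forall t, [set p.1] t -> `|partial i j f (t, y)| <= d / 2.
    have H3 : \forall y \near 0^'+, 0 < y < r.
      by near=> y; apply/andP; split; near: y; [exact: nbhs_right_gt|exact: nbhs_right_lt].
    by have [y [/andP[y0 yr] Hy]] := filter_ex (filterI H3 H1); exists y.
  have n1 : `|(p.1, y).1 - p.1| < r by rewrite subrr normr0.
  have n2 : `|(p.1, y).2 - p.2| < r by rewrite p0 subr0 gtr0_norm.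
  have [Uq Dq] := H2 (p.1, y) n1 n2.
  have {}Hy := Hy p.1 erefl.
  rewrite partialE (Dword_eq _ oUV fgUV (Uq y0)) -Eij in Hy; last by case: (Uq y0).
  rewrite -(subrK (Dword w g (p.1, y)) (Dword w g p)).
  by rewrite (le_trans (ler_normD _ _))// [leRHS]splitr lerD.
have H4 := continuous_near cD e0.
apply: filterS2 UVnear H4 => q Hq + q0; have {}Hq := Hq q0.
by rewrite gp0 sub0r normrN (Dword_eq w oUV fgUV Hq).
Unshelve. all: by end_near. Qed.

(** The uniformity on compact sets comes from the continuity of the derivatives
    at the points of the boundary interval. *)
Lemma flat_of_flat_smooth a b W O f h : domain_adjacent a b W -> open O ->
  with_boundary a b W `<=` O -> flat_smooth O h ->
  (forall p, with_boundary a b W p -> f p = h p) -> flat a b W f.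
Proof.
move=> adj oO WO fh fE; have [oW _ _ _ nW] := adj; split.
- by move=> p /WO Op; exists O, h; split=> //; [exact: fh.1|move=> q _ /fE].
- by move=> p Jp; rewrite fE; [apply: fh.2; [apply: WO; right|case: Jp => _ [_ ->]]|right].
move=> i j K cK Kab; apply/uniform_cvg0P => e e0.
have [sD D0] := flat_smooth_Dword (nseq i false ++ nseq j true) oO fh.
have Jt t : K t -> boundary_interval a b (t, 0) by move=> /Kab[].
have /compact_near_coveringP cov := cK.
have := @cov _ (0 : R)^'+ (fun y t => 0 < y -> `|partial i j f (t, y)| <= e) _ _.
move=> H; have {}H : \forall y \near 0^'+, K `<=` (fun t => 0 < y -> `|partial i j f (t, y)| <= e).
  apply: H => t Kt.
  have Ot : O (t, 0) by apply: WO; right; exact: Jt.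
  have := continuous_near (smooth_continuous sD Ot) e0.
  rewrite D0//= => Hc.
  have /nearP[r r0 Hr] : \forall q \near (t, 0), 0 < q.2 ->
      `|partial i j f q| <= e.
    apply: filterS2 Hc (nW _ (Jt t Kt)) => q; rewrite sub0r normrN => Dq Wq q0.
    have {}Wq : W q.
      by have [//|[_ [_ q00]]] := Wq (ltW q0); rewrite q00 ltxx in q0.
    have fW q' : W q' -> f q' = h q' by move=> Wq'; apply: fE; left.
    by rewrite partialE (Dword_eq _ oW fW Wq); exact: Dq.
  exists (ball t r, [set y | 0 < y < r]) => /=.
    split; first exact: nbhsx_ballx.
    by near=> y => /=; apply/andP; split; near: y; [exact: nbhs_right_gt|exact: nbhs_right_lt].
  move=> [t' y] [/= tt' /andP[y0 yr]] _; apply: Hr => //=.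
    by move: tt'; rewrite /ball/= distrC.
  by rewrite subr0 gtr0_norm.
have H5 : \forall y \near (0 : R)^'+, 0 < y by exact: nbhs_right_gt.
by apply: filterS2 H H5 => y Hy y0 t Kt; exact: Hy.
Unshelve. all: by end_near. Qed.

End FlatTransfer.

(** * Shrinking adjacent domains *)

Section Shrink.
Context {R : realType}.
Implicit Types (a b : \bar R) (U V W O P : set (R * R)) (p q : R * R).

Lemma ereal_between a b : (a < b)%E -> exists r : R, (a < r%:E)%E /\ (r%:E < b)%E.
Proof.
case: a b => [x| |] [y| |] //= xy.
- exists ((x + y) / 2); rewrite !lte_fin in xy *.
  by split; [rewrite midf_lt|rewrite midf_lt].
- by exists (x + 1); rewrite lte_fin ltrDl ltr01 ltry.
- by exists (y - 1); rewrite lte_fin gtrBl ltr01 ltNyr.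
- by exists 0; rewrite ltNyr ltry.
Qed.

Lemma boundary_box a b P (al be : R) : (a < al%:E)%E -> (be%:E < b)%E ->
  (forall p, boundary_interval a b p -> \forall q \near p, P q) ->
  exists2 eta : R, 0 < eta &
    forall p, al <= p.1 <= be -> `|p.2| <= eta -> P p.
Proof.
move=> aal beb HP.
have /compact_near_coveringP cov := @segment_compact R al be.
have Jt t : al <= t <= be -> boundary_interval a b (t, 0).
  move=> /andP[h1 h2]; split; [|split] => //=.
    by rewrite (lt_le_trans aal)// lee_fin.
  by rewrite (le_lt_trans _ beb)// lee_fin.
have H : \forall y \near (0 : R)^'+, `[al, be]%classic `<=`
    (fun t => forall s : R, `|s| <= y -> P (t, s)).
  apply: (cov _ _ (fun y t => forall s : R, `|s| <= y -> P (t, s))).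
  move=> t; rewrite /= in_itv /= => tab.
  have /nearP[r r0 Hr] := HP _ (Jt _ tab).
  exists (ball t r, [set y | y < r]) => /=.
    split; first exact: nbhsx_ballx.
    exact: nbhs_right_lt.
  move=> [t' y] [/= tt' yr] s sy; apply: Hr => /=.
    by move: tt'; rewrite /ball/= distrC.
  by rewrite subr0 (le_lt_trans sy).
have H0 : \forall y \near (0 : R)^'+, 0 < y by exact: nbhs_right_gt.
have [eta [eta0 Heta]] := filter_ex (filterI H0 H).
by exists eta => // -[t s] /= tab sy; apply: Heta => //=; rewrite in_itv.
Qed.

(** A substitute for convexity that is enough for applying the mean value
    theorem between two points. *)
Definition staircase O := forall p q, upper O p -> upper O q -> p.2 <= q.2 ->
  (forall t, p.2 <= t <= q.2 -> O (q.1, t)) /\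
  (forall s, Num.min p.1 q.1 <= s <= Num.max p.1 q.1 -> O (s, p.2)).

Definition open_rect (al be lo hi : R) : set (R * R) :=
  [set p | al < p.1 < be /\ lo < p.2 < hi].

Lemma open_rect_open al be lo hi : open (open_rect al be lo hi).
Proof.
have -> : open_rect al be lo hi =
    fst @^-1` `]al, be[%classic `&` snd @^-1` `]lo, hi[%classic.
  by apply/seteqP; split=> p /=; rewrite !in_itv.
apply: openI; apply: open_comp; try exact: interval_open.
- by move=> p _; exact: cvg_fst.
- by move=> p _; exact: cvg_snd.
Qed.

Lemma connected_graph (I : interval R) (Y : R -> R) :
  {within [set` I], continuous Y} -> connected [set p | p.1 \in I /\ p.2 = Y p.1].
Proof.
move=> cY.
have -> : [set p | p.1 \in I /\ p.2 = Y p.1] = (fun s => (s, Y s)) @` [set` I].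
  apply/seteqP; split => [[s t] /= [sI ->]|_ [s sI <-]//].
  by exists s.
apply: connected_continuous_connected.
  by apply/connected_intervalP; exact: interval_is_interval.
have cid : {within [set` I], continuous (fun s : R => s)}.
  by apply: continuous_subspaceT => ?; exact: cvg_id.
by move=> s; exact: (cvg_pair (cid s) (cY s)).
Qed.

Lemma connected_column (I : interval R) (s : R) :
  connected [set p | p.1 = s /\ p.2 \in I].
Proof.
have -> : [set p | p.1 = s /\ p.2 \in I] = (fun t => (s, t)) @` [set` I].
  apply/seteqP; split => [[s' t] /= [-> sI]|_ [t tI <-]//].
  by exists t.
apply: connected_continuous_connected.
  by apply/connected_intervalP; exact: interval_is_interval.
apply: continuous_subspaceT => t.
exact: (cvg_pair (cvg_cst s) (@cvg_id _ (nbhs t))).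
Qed.

Lemma open_rect_connected al be lo hi : connected (open_rect al be lo hi).
Proof.
have [->|/set0P[[s0 t0] [/= h0 h1]]] := eqVneq (open_rect al be lo hi) set0.
  exact: connected0.
pose H : set (R * R) := [set p | p.1 \in `]al, be[%R /\ p.2 = t0].
pose C (s : R) : set (R * R) := [set p | p.1 = s /\ p.2 \in `]lo, hi[%R].
have -> : open_rect al be lo hi =
    \bigcup_(s in [set s | al < s < be]) (H `|` C s).
  apply/seteqP; split => [[s t] [/= h h']|[s t] [s' /= h [] /= []]].
  - by exists s => //; right; rewrite /C /= in_itv.
  - by rewrite in_itv /= => ? ->.
  - by rewrite in_itv /= => -> ?.
apply: bigcup_connected.
  by exists (s0, t0) => s _; left; rewrite /H /= in_itv.
move=> s /= hs; apply: connectedU.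
- by exists (s, t0); rewrite /H /C /= !in_itv /= hs h1.
- apply: (@connected_graph _ (fun=> t0)).
  by apply: continuous_subspaceT => ?; exact: cvg_cst.
- exact: connected_column.
Qed.

(** The set [O] is the union of open rectangles over the compact subintervals
    that contain a fixed abscissa [c]. Any two of them overlap above [c], which
    makes the upper part connected, and the lower of two points can be moved
    horizontally towards the other without leaving its rectangle or the one of
    the higher point. *)
Lemma boundary_shrink a b P : (a < b)%E ->
  (forall p, boundary_interval a b p -> \forall q \near p, P q) ->
  exists O, [/\ open O /\ boundary_interval a b `<=` O, O `<=` P,
    forall p, O p -> (a < p.1%:E)%E /\ (p.1%:E < b)%E,
    staircase O & domain_adjacent a b (upper O)].
Proof.
move=> ab HP; have [c [ac cb]] := ereal_between ab.
have /choice[E HE] : forall x : R * R, exists e : R,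
    (a < x.1%:E)%E /\ (x.2%:E < b)%E ->
    0 < e /\ forall p, x.1 <= p.1 <= x.2 -> `|p.2| <= e -> P p.
  move=> x.
  have [[h1 h2]|nx] := pselect ((a < x.1%:E)%E /\ (x.2%:E < b)%E); last by exists 0.
  by have [e e0 He] := boundary_box h1 h2 HP; exists e.
pose adm x := [/\ (a < x.1%:E)%E, x.1 < c, c < x.2 & (x.2%:E < b)%E].
pose O := \bigcup_(x in adm) open_rect x.1 x.2 (- E x) (E x).
have inO x s t : adm x -> x.1 < s < x.2 -> `|t| < E x -> O (s, t).
  by move=> ax sx tx; exists x => //; split => //=; rewrite -ltr_norml.
have oO : open O by apply: bigcup_open => x _; exact: open_rect_open.
have adm_ex t : (a < t%:E)%E -> (t%:E < b)%E -> exists2 x, adm x & x.1 < t < x.2.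
  move=> a_t tb.
  have [al [h1 h2]] : exists r : R, (a < r%:E)%E /\ (r%:E < (Num.min t c)%:E)%E.
    by apply: ereal_between; rewrite /Num.min; case: ifP.
  have [be [h3 h4]] : exists r : R, ((Num.max t c)%:E < r%:E)%E /\ (r%:E < b)%E.
    by apply: ereal_between; rewrite /Num.max; case: ifP.
  move: h2 h3; rewrite !lte_fin lt_min gt_max => /andP[h2 h2'] /andP[h3 h3'].
  by exists (al, be) => /=; [split|rewrite h2].
have adm_pos x : adm x -> 0 < E x by move=> [h1 _ _ h2]; have [] := HE x (conj h1 h2).
have JO : boundary_interval a b `<=` O.
  move=> [t s] [/= h1 [h2 ->]]; have [x ax tx] := adm_ex t h1 h2.
  by apply: (inO x) => //; rewrite normr0; exact: adm_pos.
exists O; split => //.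
- move=> [s t] [x [h1 h2 h3 h4] [/= /andP[s1 s2] ht]].
  apply: (HE x (conj h1 h4)).2 => /=; first by rewrite !ltW.
  by rewrite ler_norml; case/andP: ht => ? ?; rewrite !ltW.
- move=> [s t] [x [h1 h2 h3 h4] [/= /andP[s1 s2] ht]]; split.
    by rewrite (lt_trans h1)// lte_fin.
  by rewrite (lt_trans _ h4)// lte_fin.
- move=> [s t] [s' t'] [[x ax [/= /andP[s1 s2] /andP[_ tE]]] /= t0].
  move=> [[x' ax' [/= /andP[s1' s2'] /andP[_ tE']]] /= t0'] tt'; split.
    move=> r /andP[r1 r2]; apply: (inO x') => //; first by rewrite s1'.
    by rewrite gtr0_norm ?(lt_le_trans t0)// (le_lt_trans r2).
  move=> r /andP[r1 r2].
  have [_ x1c cx2 _] := ax; have [_ x1c' cx2' _] := ax'.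
  have [rx|rx] := boolP (x.1 < r < x.2).
    by apply: (inO x) => //; rewrite gtr0_norm.
  apply: (inO x') => //; last by rewrite gtr0_norm// (le_lt_trans tt').
  move: rx; rewrite negb_and -!leNgt => /orP[h|h]; apply/andP; split.
  + move: r1; rewrite ge_min => /orP[h'|h'].
      by have := lt_le_trans s1 (le_trans h' h); rewrite ltxx.
    exact: lt_le_trans h'.
  + by rewrite (le_lt_trans h)// (lt_trans x1c).
  + by rewrite (lt_trans _ (lt_le_trans cx2 h)).
  + move: r2; rewrite le_max => /orP[h'|h'].
      by have := lt_le_trans s2 (le_trans h h'); rewrite ltxx.
    exact: le_lt_trans h' s2'.
split.
- exact: open_upper.
- have sub x : adm x -> open_rect x.1 x.2 0 (E x) `<=` upper O.
    move=> ax [s t] [/= sx /andP[t0 tE]]; split => //.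
    by apply: (inO x) => //; rewrite gtr0_norm.
  have [U0|/set0P[p0 Up0]] := eqVneq (upper O) set0.
    by rewrite U0; exact: connected0.
  have ex p : upper O p -> exists2 x, adm x & open_rect x.1 x.2 0 (E x) p.
    move=> [[x ax [h1 /andP[h2 h3]]] /= p20]; exists x => //.
    by split => //; rewrite p20.
  have [x0 ax0 x0p0] := ex _ Up0.
  pose B x := open_rect x0.1 x0.2 0 (E x0) `|` open_rect x.1 x.2 0 (E x).
  have -> : upper O = \bigcup_(x in adm) B x.
    apply/seteqP; split => [p /ex[x ax px]|p [x ax [|]]].
    + by exists x => //; right.
    + exact: sub.
    + exact: sub.
  apply: bigcup_connected.
    by exists p0 => x _; left.
  move=> x ax; apply: connectedU; try exact: open_rect_connected.
  exists (c, Num.min (E x0) (E x) / 2).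
  have m0 : 0 < Num.min (E x0) (E x) by rewrite lt_min !adm_pos.
  have mE : Num.min (E x0) (E x) / 2 < Num.min (E x0) (E x).
    by rewrite ltr_pdivrMr// ltr_pMr// ltr1n.
  move: mE; rewrite lt_min => /andP[mE1 mE2].
  have [_ x1c cx2 _] := ax; have [_ x1c' cx2' _] := ax0.
  by split; split => /=; rewrite ?x1c ?x1c' ?cx2 ?cx2' ?mE1 ?mE2 ?andbT// divr_gt0.
- by move=> p [].
- move=> p Jp; split; last first.
    by move=> /interior_subset[_ /=]; case: Jp => _ [_ ->]; rewrite ltxx.
  move=> N Np.
  have /nearP[r r0 Hr] : \forall q \near p, O q /\ N q.
    have Op : \forall q \near p, O q by apply: open_nbhs_nbhs; split => //; exact: JO.
    by apply: filterS2 Op Np => q; exact: conj.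
  have p20 : p.2 = 0 by case: Jp => _ [].
  have r2 : 0 < r / 2 by rewrite divr_gt0.
  have n1 : `|(p.1, r / 2).1 - p.1| < r by rewrite subrr normr0.
  have n2 : `|(p.1, r / 2).2 - p.2| < r.
    by rewrite p20 subr0 gtr0_norm// ltr_pdivrMr// ltr_pMr// ltr1n.
  by have [Oq Nq] := Hr _ n1 n2; exists (p.1, r / 2).
- move=> p Jp.
  have Op : \forall q \near p, O q by apply: open_nbhs_nbhs; split => //; exact: JO.
  apply: filterS Op => q Oq; rewrite le_eqVlt => /orP[/eqP q0|q0]; last by left.
  right; move: Oq => [x [h1 _ _ h4] [/andP[s1 s2] _]]; split; last split => //.
    by rewrite (lt_trans h1)// lte_fin.
  by rewrite (lt_trans _ h4)// lte_fin.
Qed.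

End Shrink.

(** * Local surjectivity of perturbations of the identity *)

Section Inverse.
Context {R : realType}.
Implicit Types (U V W O : set (R * R)) (f g h : R * R -> R) (p q : R * R).

Lemma lipschitz_within (g : R -> R) (k lo hi : R) : lo <= hi -> 0 <= k ->
  (forall y z, lo <= y <= hi -> lo <= z <= hi -> `|g y - g z| <= k * `|y - z|) ->
  {within `[lo, hi], continuous g}.
Proof.
move=> lohi k0 lip.
apply/subspace_continuousP => y; rewrite /= in_itv /= => yI.
apply/cvgrPdist_le => e e0; have k1 : 0 < k + 1 by rewrite ltr_wpDl.
rewrite !near_withinE; near=> z; rewrite /= in_itv /= => zI.
rewrite (le_trans (lip _ _ yI zI))// (@le_trans _ _ ((k + 1) * `|y - z|))//.
  by rewrite ler_wpM2r// lerDl.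
rewrite mulrC -ler_pdivlMr//; near: z.
apply/nbhs_ballP; exists (e / (k + 1)) => /=; first exact: divr_gt0.
by move=> t; rewrite /ball/= => /ltW.
Unshelve. all: by end_near. Qed.

Lemma lipschitz_IVT (g : R -> R) (k lo hi v : R) : lo <= hi -> 0 <= k ->
  (forall y z, lo <= y <= hi -> lo <= z <= hi -> `|g y - g z| <= k * `|y - z|) ->
  g lo <= v <= g hi -> exists2 y, lo <= y <= hi & g y = v.
Proof.
move=> lohi k0 lip /andP[v1 v2].
have vb : Num.min (g lo) (g hi) <= v <= Num.max (g lo) (g hi).
  by rewrite ge_min v1 le_max v2 orbT.
have [c + E] := IVT lohi (lipschitz_within lohi k0 lip) vb.
by rewrite in_itv/= => h; exists c.
Qed.

Definition sum_dist p q : R := `|p.1 - q.1| + `|p.2 - q.2|.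

(** The mean value theorem along a vertical segment followed by a horizontal one. *)
Lemma lipschitz_corner f (c : R) (p q : R * R) :
  (forall t, Num.min p.2 q.2 <= t <= Num.max p.2 q.2 ->
    differentiable f (q.1, t) /\ `|'D_e2 f (q.1, t)| <= c) ->
  (forall s, Num.min p.1 q.1 <= s <= Num.max p.1 q.1 ->
    differentiable f (s, p.2) /\ `|'D_e1 f (s, p.2)| <= c) ->
  `|f p - f q| <= c * sum_dist p q.
Proof.
case: p q => [x y] [x' y'] /= Hv Hh; rewrite /sum_dist /= mulrDr.
rewrite -(subrKA (f (x', y))) (le_trans (ler_normD _ _))//; apply: lerD.
  case: (leP x x') Hh => [xx|/ltW xx] Hh.
    have [t tx E] := mvt_horiz xx (fun t tx => (Hh t tx).1).
    by rewrite distrC E normrM [`|x - _|]distrC ler_wpM2r// (Hh _ tx).2.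
  have [t tx E] := mvt_horiz xx (fun t tx => (Hh t tx).1).
  by rewrite E normrM ler_wpM2r// (Hh _ tx).2.
case: (leP y y') Hv => [yy|/ltW yy] Hv.
  have [t tx E] := mvt_vert yy (fun t tx => (Hv t tx).1).
  by rewrite distrC E normrM [`|y - _|]distrC ler_wpM2r// (Hv _ tx).2.
have [t tx E] := mvt_vert yy (fun t tx => (Hv t tx).1).
by rewrite E normrM ler_wpM2r// (Hv _ tx).2.
Qed.

Section Local.
Context (O : set (R * R)) (h1 h2 : R * R -> R) (oO : open O)
  (s1 : smooth_open O h1) (s2 : smooth_open O h2)
  (dh : forall p, O p ->
    [/\ `|'D_e1 h1 p| <= 4^-1, `|'D_e2 h1 p| <= 4^-1,
        `|'D_e1 h2 p| <= 4^-1 & `|'D_e2 h2 p| <= 4^-1]).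

Let H p := (p.1 + h1 p, p.2 + h2 p).

Lemma sum_dist_expand p q :
  `|h1 p - h1 q| <= 4^-1 * sum_dist p q ->
  `|h2 p - h2 q| <= 4^-1 * sum_dist p q ->
  sum_dist p q <= 2 * sum_dist (H p) (H q).
Proof.
rewrite /sum_dist /H /= => l1 l2.
have := ler_normB (p.1 + h1 p - (q.1 + h1 q)) (h1 p - h1 q).
have := ler_normB (p.2 + h2 p - (q.2 + h2 q)) (h2 p - h2 q).
have -> : p.1 + h1 p - (q.1 + h1 q) - (h1 p - h1 q) = p.1 - q.1 by ring.
have -> : p.2 + h2 p - (q.2 + h2 q) - (h2 p - h2 q) = p.2 - q.2 by ring.
by move: l1 l2; lra.
Qed.

Lemma near_lipschitz p : O p -> exists2 r : R, 0 < r &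
  (forall q, `|q.1 - p.1| <= r -> `|q.2 - p.2| <= r -> O q) /\
  forall q q', `|q.1 - p.1| <= r -> `|q.2 - p.2| <= r ->
    `|q'.1 - p.1| <= r -> `|q'.2 - p.2| <= r ->
    `|h1 q - h1 q'| <= 4^-1 * sum_dist q q' /\
    `|h2 q - h2 q'| <= 4^-1 * sum_dist q q'.
Proof.
move=> Op.
have /nearP[r r0 Hr] : \forall q \near p, O q by exact: open_nbhs_nbhs.
have r2 : r / 2 < r by rewrite ltr_pdivrMr// ltr_pMr// ltr1n.
have inO q : `|q.1 - p.1| <= r / 2 -> `|q.2 - p.2| <= r / 2 -> O q.
  by move=> n1 n2; apply: Hr; apply: le_lt_trans r2.
exists (r / 2); first by rewrite divr_gt0.
split => // q q' n1 n2 n1' n2'.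
have inb u v w z (d : R) : `|u - w| <= d -> `|v - w| <= d ->
    Num.min u v <= z <= Num.max u v -> `|z - w| <= d.
  rewrite !ler_norml !lerBrDr !lerBlDr => /andP[a1 a2] /andP[b1 b2].
  rewrite ge_min le_max => /andP[/orP[c1|c1] /orP[c2|c2]]; apply/andP; split; lra.
have bv t : Num.min q.2 q'.2 <= t <= Num.max q.2 q'.2 -> O (q'.1, t).
  by move=> ht; apply: inO => //; exact: inb ht.
have bh s : Num.min q.1 q'.1 <= s <= Num.max q.1 q'.1 -> O (s, q.2).
  by move=> hs; apply: inO => //; exact: inb hs.
split; apply: lipschitz_corner => u.
- move=> /bv Ou; have [_ d _ _] := dh Ou.
  by split; [exact: smooth_differentiable s1 Ou|exact: d].
- move=> /bh Ou; have [d _ _ _] := dh Ou.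
  by split; [exact: smooth_differentiable s1 Ou|exact: d].
- move=> /bv Ou; have [_ _ _ d] := dh Ou.
  by split; [exact: smooth_differentiable s2 Ou|exact: d].
- move=> /bh Ou; have [_ _ d _] := dh Ou.
  by split; [exact: smooth_differentiable s2 Ou|exact: d].
Qed.

(** The first equation is solved for [p.1] by monotonicity, with a solution
    that depends on [p.2] in a Lipschitz way; then the second one for [p.2]. *)
Lemma near_surjective p (r : R) : 0 < r ->
  (forall q q', `|q.1 - p.1| <= r -> `|q.2 - p.2| <= r ->
    `|q'.1 - p.1| <= r -> `|q'.2 - p.2| <= r ->
    `|h1 q - h1 q'| <= 4^-1 * sum_dist q q' /\
    `|h2 q - h2 q'| <= 4^-1 * sum_dist q q') ->
  forall v, `|v.1 - (H p).1| <= r / 4 -> `|v.2 - (H p).2| <= r / 4 ->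
  exists z, [/\ `|z.1 - p.1| <= r, `|z.2 - p.2| <= r & H z = v].
Proof.
case: p => x0 y0 r0 lip [v1 v2] /= nv1 nv2.
have xr : x0 - r <= x0 + r by lra.
have yr : y0 - r <= y0 + r by lra.
have inr u w : w - r <= u <= w + r -> `|u - w| <= r.
  by rewrite ler_norml lerBrDr lerBlDr => /andP[a1 a2]; apply/andP; split; lra.
have n0 : `|x0 - x0| <= r by rewrite subrr normr0 ltW.
have m0 : `|y0 - y0| <= r by rewrite subrr normr0 ltW.
have r4 : 4^-1 * (r + r) = r / 2 by field.
have sol1 y : y0 - r <= y <= y0 + r ->
    exists2 x, x0 - r <= x <= x0 + r & x + h1 (x, y) = v1.
  move=> hy; have ny := inr _ _ hy.
  apply: (@lipschitz_IVT (fun x => x + h1 (x, y)) 2) => //.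
    move=> x x' hx hx'.
    have [l _] := lip (x, y) (x', y) (inr _ _ hx) ny (inr _ _ hx') ny.
    rewrite opprD addrACA (le_trans (ler_normD _ _))//.
    move: l; rewrite /sum_dist /= subrr normr0.
    by have := normr_ge0 (x - x'); lra.
  have hm : x0 - r <= x0 - r <= x0 + r by rewrite lexx.
  have hp : x0 - r <= x0 + r <= x0 + r by rewrite lexx xr.
  have [l _] := lip (x0 - r, y) (x0, y0) (inr _ _ hm) ny n0 m0.
  have [l' _] := lip (x0 + r, y) (x0, y0) (inr _ _ hp) ny n0 m0.
  have e1 : sum_dist (x0 - r, y) (x0, y0) <= r + r.
    by rewrite /sum_dist /= addrAC subrr add0r normrN gtr0_norm// lerD2l.
  have e2 : sum_dist (x0 + r, y) (x0, y0) <= r + r.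
    by rewrite /sum_dist /= addrAC subrr add0r gtr0_norm// lerD2l.
  move: l l' nv1; rewrite !ler_norml => /andP[a1 a2] /andP[b1 b2] /andP[c1 c2].
  by apply/andP; split; lra.
have /choice[X HX] : forall y, exists x, y0 - r <= y <= y0 + r ->
    x0 - r <= x <= x0 + r /\ x + h1 (x, y) = v1.
  move=> y; have [/sol1[x xb E]|nb] := boolP (y0 - r <= y <= y0 + r).
    by exists x.
  by exists 0.
have lipX y y' : y0 - r <= y <= y0 + r -> y0 - r <= y' <= y0 + r ->
    `|X y - X y'| <= 2 * `|y - y'|.
  move=> hy hy'; have [xb E] := HX _ hy; have [xb' E'] := HX _ hy'.
  have [l _] := lip (X y, y) (X y', y') (inr _ _ xb) (inr _ _ hy)
    (inr _ _ xb') (inr _ _ hy').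
  have E1 : X y - X y' = - (h1 (X y, y) - h1 (X y', y')).
    by move: E E'; lra.
  have := normrN (h1 (X y, y) - h1 (X y', y')); rewrite -E1.
  move: l; rewrite /sum_dist /=.
  have := normr_ge0 (X y - X y'); have := normr_ge0 (y - y').
  lra.
have lipG y y' : y0 - r <= y <= y0 + r -> y0 - r <= y' <= y0 + r ->
    `|y + h2 (X y, y) - (y' + h2 (X y', y'))| <= 2 * `|y - y'|.
  move=> hy hy'; have [xb _] := HX _ hy; have [xb' _] := HX _ hy'.
  have [_ l] := lip (X y, y) (X y', y') (inr _ _ xb) (inr _ _ hy)
    (inr _ _ xb') (inr _ _ hy').
  rewrite opprD addrACA (le_trans (ler_normD _ _))//.
  move: l; rewrite /sum_dist /=; have := lipX _ _ hy hy'.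
  by have := normr_ge0 (y - y'); lra.
have bndG : y0 - r + h2 (X (y0 - r), y0 - r) <= v2
    <= y0 + r + h2 (X (y0 + r), y0 + r).
  have hm : y0 - r <= y0 - r <= y0 + r by rewrite lexx.
  have hp : y0 - r <= y0 + r <= y0 + r by rewrite lexx yr.
  have [xm _] := HX _ hm; have [xp _] := HX _ hp.
  have [_ l] := lip (X (y0 - r), y0 - r) (x0, y0) (inr _ _ xm) (inr _ _ hm) n0 m0.
  have [_ l'] := lip (X (y0 + r), y0 + r) (x0, y0) (inr _ _ xp) (inr _ _ hp) n0 m0.
  have e1 : sum_dist (X (y0 - r), y0 - r) (x0, y0) <= r + r.
    rewrite /sum_dist /= addrAC subrr add0r normrN (gtr0_norm r0) lerD2r.
    exact: inr.
  have e2 : sum_dist (X (y0 + r), y0 + r) (x0, y0) <= r + r.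
    rewrite /sum_dist /= addrAC subrr add0r (gtr0_norm r0) lerD2r.
    exact: inr.
  move: l l' nv2; rewrite !ler_norml => /andP[a1 a2] /andP[b1 b2] /andP[c1 c2].
  by apply/andP; split; lra.
have [y hy E] := @lipschitz_IVT (fun y => y + h2 (X y, y)) 2 _ _ _ yr ltac:(by [])
  lipG bndG.
have [xb E1] := HX _ hy.
exists (X y, y); split => /=; try exact: inr.
by rewrite /H /= E1 E.
Qed.

End Local.

End Inverse.

(** * Smoothness of the inverse *)

Section InverseMap.
Context {R : realType}.
Implicit Types (U V W O : set (R * R)) (f g h : R * R -> R) (p q : R * R).

Definition perturb h1 h2 p : R * R := (p.1 + h1 p, p.2 + h2 p).

Context (O : set (R * R)) (h1 h2 : R * R -> R) (oO : open O)
  (s1 : smooth_open O h1) (s2 : smooth_open O h2)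
  (dh : forall p, O p ->
    [/\ `|'D_e1 h1 p| <= 4^-1, `|'D_e2 h1 p| <= 4^-1,
        `|'D_e1 h2 p| <= 4^-1 & `|'D_e2 h2 p| <= 4^-1]).

Let H := perturb h1 h2.

Lemma perturb_image_open : open (H @` O).
Proof.
rewrite openE => _ [p Op <-].
have [r r0 [inO lip]] := near_lipschitz oO s1 s2 dh Op.
apply/nearP; exists (r / 4); first by rewrite divr_gt0.
move=> v /ltW v1 /ltW v2.
have [z [z1 z2 <-]] := near_surjective r0 lip v1 v2.
by exists z => //; exact: inO.
Qed.

Definition jacobian_det p : R :=
  (1 + 'D_e1 h1 p) * (1 + 'D_e2 h2 p) - 'D_e2 h1 p * 'D_e1 h2 p.

Lemma jacobian_det_ge p : O p -> 2^-1 <= jacobian_det p.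
Proof.
move=> Op; have [] := dh Op; rewrite /jacobian_det.
move: ('D_e1 h1 p) ('D_e2 h1 p) ('D_e1 h2 p) ('D_e2 h2 p) => a b c d.
rewrite !ler_norml => /andP[a1 a2] /andP[b1 b2] /andP[c1 c2] /andP[d1 d2].
have bc : b * c <= 16^-1.
  have [bc0|bc0] := leP (b * c) 0; first by rewrite (le_trans bc0).
  rewrite (le_trans (ler_norm _))// normrM.
  have -> : 16^-1 = 4^-1 * 4^-1 :> R by field.
  by rewrite ler_pM// ler_norml; apply/andP; split; lra.
have ad : (3 / 4) * (3 / 4) <= (1 + a) * (1 + d) by apply: ler_pM; lra.
lra.
Qed.

Context (K1 K2 : R * R -> R)
  (KH : forall p, O p -> K1 (H p) = p.1 /\ K2 (H p) = p.2).

Let Kat q := (K1 q, K2 q).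

Lemma inverse_at p : O p -> Kat (H p) = p.
Proof. by move=> /KH[E1 E2]; rewrite /Kat E1 E2 -surjective_pairing. Qed.

(** Cramer's rule for the linearized equations, with remainders [r1] and [r2]. *)
Lemma solve_linear (a b c d v1 v2 u1 u2 r1 r2 : R) :
  let D := (1 + a) * (1 + d) - b * c in D != 0 ->
  v1 = u1 + a * u1 + b * u2 + r1 -> v2 = u2 + c * u1 + d * u2 + r2 ->
  u1 - ((1 + d) / D * v1 + - b / D * v2) = D^-1 * (- (1 + d) * r1 + b * r2) /\
  u2 - (- c / D * v1 + (1 + a) / D * v2) = D^-1 * (c * r1 + - (1 + a) * r2).
Proof. by move=> D D0 -> ->; split; rewrite /D in D0 *; field. Qed.

Lemma sum_dist_le p q : sum_dist p q <= 2 * `|p - q|.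
Proof.
have := norm1_le (p - q); have := norm2_le (p - q).
by rewrite /sum_dist /=; lra.
Qed.

Lemma le_sum_dist p q : `|p - q| <= sum_dist p q.
Proof. by apply: norm_plane_le; rewrite /sum_dist /= ?lerDl ?lerDr. Qed.

Lemma near_preimage (P : set (R * R)) p : O p -> (\forall z \near p, P z) ->
  \forall v \near H p, exists z, [/\ P z, O z, H z = v & `|z - p| <= 4 * `|v - H p|].
Proof.
move=> Op /nearP[d d0 Hd].
have [r r0 [inO lip]] := near_lipschitz oO s1 s2 dh Op.
pose m := Num.min (d / 2) r.
have m0 : 0 < m by rewrite lt_min r0 divr_gt0.
have mr : m <= r by rewrite ge_min lexx orbT.
have md : m < d.
  by rewrite gt_min ltr_pdivrMr// ltr_pMr// ltr1n.
apply/nearP; exists (m / 4) => [|v /ltW v1 /ltW v2]; first by rewrite divr_gt0.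
have lipm z z' : `|z.1 - p.1| <= m -> `|z.2 - p.2| <= m ->
    `|z'.1 - p.1| <= m -> `|z'.2 - p.2| <= m ->
    `|h1 z - h1 z'| <= 4^-1 * sum_dist z z' /\
    `|h2 z - h2 z'| <= 4^-1 * sum_dist z z'.
  by move=> n1 n2 n3 n4; apply: lip; exact: le_trans mr.
have [z [z1 z2 zv]] := near_surjective m0 lipm v1 v2.
exists z; split => //.
- by apply: Hd; exact: le_lt_trans md.
- by apply: inO; exact: le_trans mr.
have pp (x : R) : `|x - x| <= m by rewrite subrr normr0 ltW.
have [l1 l2] := lipm z p z1 z2 (pp _) (pp _).
have := sum_dist_expand l1 l2; rewrite zv => l.
rewrite (le_trans (le_sum_dist z p))// (le_trans l)//.
rewrite (_ : 4 = 2 * 2); last by ring.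
by rewrite -mulrA ler_pM2l//; exact: sum_dist_le.
Qed.

Lemma inverse_derive q : (H @` O) q ->
  let p := Kat q in
  (differentiable K1 q /\ forall v, 'D_v K1 q =
     (1 + 'D_e2 h2 p) / jacobian_det p * v.1 +
     - 'D_e2 h1 p / jacobian_det p * v.2) /\
  (differentiable K2 q /\ forall v, 'D_v K2 q =
     - 'D_e1 h2 p / jacobian_det p * v.1 +
     (1 + 'D_e1 h1 p) / jacobian_det p * v.2).
Proof.
move=> [p0 Op <-]; rewrite inverse_at//.
have dge := jacobian_det_ge Op; have [b11 b12 b21 b22] := dh Op.
have Dpos : 0 < jacobian_det p0 by apply: lt_le_trans dge.
have df1 := smooth_differentiable s1 Op; have df2 := smooth_differentiable s2 Op.
have [K10 K20] := KH Op.
move: (diff_eps_inv df1) (diff_eps_inv df2) b11 b12 b21 b22 Dpos dge.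
rewrite /jacobian_det.
move: ('D_e1 h1 p0) ('D_e2 h1 p0) ('D_e1 h2 p0) ('D_e2 h2 p0) => a b c d H1 H2.
move=> ba bb bc bd.
set D := _ - _ => D0 D2.
have Dn0 : D != 0 by rewrite gt_eqF.
have Di : `|D^-1| <= 2.
  rewrite ger0_norm; last by rewrite invr_ge0 ltW.
  by rewrite -[leRHS]invrK lef_pV2// ?posrE ?invr_gt0.
have est x y r1 r2 (e n : R) : `|x| <= 5 / 4 -> `|y| <= 5 / 4 ->
    `|r1| <= e / 20 * n -> `|r2| <= e / 20 * n -> 0 <= e -> 0 <= n ->
    `|D^-1 * (x * r1 + y * r2)| <= e * (n / 4).
  move=> hx hy hr1 hr2 e0 n0; rewrite normrM.
  have -> : e * (n / 4) = 2 * (5 / 4 * (e / 20 * n) + 5 / 4 * (e / 20 * n)) by field.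
  rewrite ler_pM// (le_trans (ler_normD _ _))// !normrM.
  by apply: lerD; apply: ler_pM.
have a1 : `|1 + a| <= 5 / 4.
  by rewrite (le_trans (ler_normD _ _))// normr1 (_ : 5 / 4 = 1 + 4^-1) ?lerD2l//; field.
have d1 : `|1 + d| <= 5 / 4.
  by rewrite (le_trans (ler_normD _ _))// normr1 (_ : 5 / 4 = 1 + 4^-1) ?lerD2l//; field.
have b1 : `|b| <= 5 / 4 by rewrite (le_trans bb)//; lra.
have c1 : `|c| <= 5 / 4 by rewrite (le_trans bc)//; lra.
have near_sol (e : R) : 0 < e -> \forall v \near H p0, exists r1 r2 : R,
   [/\ `|r1| <= e / 20 * (4 * `|v - H p0|), `|r2| <= e / 20 * (4 * `|v - H p0|),
     v.1 - (H p0).1 = (K1 v - K1 (H p0)) + a * (K1 v - K1 (H p0)) +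
        b * (K2 v - K2 (H p0)) + r1 &
     v.2 - (H p0).2 = (K2 v - K2 (H p0)) + c * (K1 v - K1 (H p0)) +
        d * (K2 v - K2 (H p0)) + r2].
  move=> e0; have e20 : 0 < e / 20 by rewrite divr_gt0.
  have H12 : \forall z \near p0,
      `|h1 z - h1 p0 - (a * (z.1 - p0.1) + b * (z.2 - p0.2))| <= e / 20 * `|z - p0| /\
      `|h2 z - h2 p0 - (c * (z.1 - p0.1) + d * (z.2 - p0.2))| <= e / 20 * `|z - p0|.
    by apply: filterS2 (H1 _ e20) (H2 _ e20) => z; exact: conj.
  apply: filterS (near_preimage Op H12) => v [z [[R1 R2] Oz zv zn]].
  have [E1 E2] := KH Oz; rewrite zv in E1 E2.
  rewrite K10 K20 E1 E2.
  exists (h1 z - h1 p0 - (a * (z.1 - p0.1) + b * (z.2 - p0.2))).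
  exists (h2 z - h2 p0 - (c * (z.1 - p0.1) + d * (z.2 - p0.2))).
  split.
  - by apply: le_trans R1 _; rewrite ler_pM2l.
  - by apply: le_trans R2 _; rewrite ler_pM2l.
  - by rewrite -zv /H /perturb /=; ring.
  - by rewrite -zv /H /perturb /=; ring.
split.
- apply: diff_eps => e e0; apply: filterS (near_sol e e0) => v.
  move=> [r1 [r2 [R1 R2 V1 V2]]].
  have [-> _] := solve_linear (a := a) (b := b) (c := c) (d := d) Dn0 V1 V2.
  rewrite -/D (_ : `|v - H p0| = 4 * `|v - H p0| / 4); last by field.
  have e0' := ltW e0; have n0 : 0 <= 4 * `|v - H p0| by rewrite mulr_ge0.
  by apply: est => //; rewrite normrN.
- apply: diff_eps => e e0; apply: filterS (near_sol e e0) => v.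
  move=> [r1 [r2 [R1 R2 V1 V2]]].
  have [_ ->] := solve_linear (a := a) (b := b) (c := c) (d := d) Dn0 V1 V2.
  rewrite -/D (_ : `|v - H p0| = 4 * `|v - H p0| / 4); last by field.
  have e0' := ltW e0; have n0 : 0 <= 4 * `|v - H p0| by rewrite mulr_ge0.
  by apply: est => //; rewrite normrN.
Qed.

(** The derivatives of the inverse are smooth functions of the inverse, so that
    each order of differentiability yields the next one. *)
Lemma inverse_smooth : smooth_open (H @` O) K1 /\ smooth_open (H @` O) K2.
Proof.
have oHO := perturb_image_open.
have KO q : (H @` O) q -> O (K1 q, K2 q).
  by move=> [p Op <-]; rewrite -/(Kat _) inverse_at.
have sinv : smooth_open O (fun p => (jacobian_det p)^-1).
  apply: smoothV => //.
    by move=> p Op; rewrite gt_eqF// (lt_le_trans _ (jacobian_det_ge Op)).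
  have one : smooth_open O (fun=> 1 : R) by exact: smooth_cst.
  apply: smoothB => //; apply: smoothM => //; try apply: smoothD => //;
    exact: smooth_derive.
have one : smooth_open O (fun=> 1 : R) by exact: smooth_cst.
have sA : smooth_open O (fun p => (1 + 'D_e2 h2 p) / jacobian_det p).
  by apply: smoothM => //; apply: smoothD => //; exact: smooth_derive.
have sB : smooth_open O (fun p => - 'D_e2 h1 p / jacobian_det p).
  by apply: smoothM => //; apply: smoothN => //; exact: smooth_derive.
have sC : smooth_open O (fun p => - 'D_e1 h2 p / jacobian_det p).
  by apply: smoothM => //; apply: smoothN => //; exact: smooth_derive.
have sD : smooth_open O (fun p => (1 + 'D_e1 h1 p) / jacobian_det p).
  by apply: smoothM => //; apply: smoothD => //; exact: smooth_derive.
suff HK n : diff_upto n (H @` O) K1 /\ diff_upto n (H @` O) K2.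
  by split; apply/smooth_uptoP => n; have [] := HK n.
elim: n => [|n [IH1 IH2]].
  by split; split => // q /inverse_derive[[? _] [? _]].
have comp f : smooth_open O f -> diff_upto n (H @` O) (fun q => f (K1 q, K2 q)).
  by move=> /smooth_uptoP sf; apply: (@diff_upto_comp2 _ _ n _ O).
split; split.
- by move=> q /inverse_derive[[? _] _].
- move=> v; apply: (@eq_diff_upto _ _ _ n _ (fun q =>
    (1 + 'D_e2 h2 (K1 q, K2 q)) / jacobian_det (K1 q, K2 q) * v.1 +
    - 'D_e2 h1 (K1 q, K2 q) / jacobian_det (K1 q, K2 q) * v.2)) => //.
    by move=> q /inverse_derive[[_ ->] _].
  by apply: diff_uptoD => //; apply: diff_uptoM => //;
    try exact: diff_upto_cst; [exact: (comp _ sA)|exact: (comp _ sB)].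
- by move=> q /inverse_derive[_ [? _]].
- move=> v; apply: (@eq_diff_upto _ _ _ n _ (fun q =>
    - 'D_e1 h2 (K1 q, K2 q) / jacobian_det (K1 q, K2 q) * v.1 +
    (1 + 'D_e1 h1 (K1 q, K2 q)) / jacobian_det (K1 q, K2 q) * v.2)) => //.
    by move=> q /inverse_derive[_ [_ ->]].
  by apply: diff_uptoD => //; apply: diff_uptoM => //;
    try exact: diff_upto_cst; [exact: (comp _ sC)|exact: (comp _ sD)].
Qed.

End InverseMap.

(** * Inverses of flat perturbations of the identity *)

Section FlatInverse.
Context {R : realType}.
Implicit Types (a b : \bar R) (U V W O P : set (R * R)) (f g h : R * R -> R)
  (p q : R * R).

Lemma flat_near_small O f p : flat_smooth O f -> O p -> p.2 = 0 ->
  forall e : R, 0 < e -> \forall q \near p, `|f q| <= e.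
Proof.
move=> [sf f0] Op p0 e e0; have fp0 : f p = 0 by rewrite f0// p0.
have := continuous_near (smooth_continuous sf Op) e0.
by apply: filterS => q; rewrite fp0 sub0r normrN.
Qed.

Lemma flat_near_bound O f p : open O -> flat_smooth O f -> O p -> p.2 = 0 ->
  forall e : R, 0 < e -> \forall q \near p, 0 < q.2 -> `|f q| <= e * q.2.
Proof.
move=> oO ff Op p0; apply: (vanishing_bound oO _ Op p0).
- by apply: smooth_openS ff.1 => q [].
- move=> q Oq q0 e e0; have := flat_near_small ff Oq q0 e0.
  by apply: filterS => r Hr _.
- move=> e e0; have := flat_near_small (flat_smooth_derive true oO ff) Op p0 e0.
  by apply: filterS => r Hr _.
Qed.

Lemma boundary_snd a b p : boundary_interval a b p -> p.2 = 0.
Proof. by case=> _ []. Qed.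

Lemma perturb_lower O h1 h2 p : flat_smooth O h1 -> flat_smooth O h2 ->
  O p -> p.2 <= 0 -> perturb h1 h2 p = p.
Proof.
move=> f1 f2 Op p0; rewrite /perturb f1.2// f2.2// !addr0.
by rewrite -surjective_pairing.
Qed.

(** Injectivity comes from the mean value theorem along staircases in the upper
    part, and from the map being the identity below. The inverse is again a flat
    perturbation of the identity, because it is the identity below. *)
Theorem flat_inverse a b O h1 h2 : (a < b)%E -> open O ->
  boundary_interval a b `<=` O ->
  flat_smooth O h1 -> flat_smooth O h2 ->
  exists Z K1 K2, let H := perturb h1 h2 in
  [/\ [/\ open Z, boundary_interval a b `<=` Z, Z `<=` O &
        domain_adjacent a b (upper Z)],
      open (H @` Z) /\ (forall p, Z p -> K1 (H p) = p.1 /\ K2 (H p) = p.2),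
      flat_smooth (H @` Z) (fun q => K1 q - q.1) &
      flat_smooth (H @` Z) (fun q => K2 q - q.2)].
Proof.
move=> ab oO JO f1 f2.
pose Q q := [/\ O q,
  [/\ `|'D_e1 h1 q| <= 4^-1, `|'D_e2 h1 q| <= 4^-1,
      `|'D_e1 h2 q| <= 4^-1 & `|'D_e2 h2 q| <= 4^-1] &
  0 < q.2 -> `|h2 q| <= 2^-1 * q.2].
have HQ p : boundary_interval a b p -> \forall q \near p, Q q.
  move=> Jp; have Op := JO _ Jp; have p0 := boundary_snd Jp.
  have sm f bb : flat_smooth O f -> \forall q \near p, `|'D_(edir bb) f q| <= 4^-1.
    move=> ff; apply: (flat_near_small (flat_smooth_derive bb oO ff) Op p0).
    by rewrite invr_gt0.
  have n0 : \forall q \near p, O q by exact: open_nbhs_nbhs.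
  have n1 := sm h1 false f1; have n2 := sm h1 true f1.
  have n3 := sm h2 false f2; have n4 := sm h2 true f2.
  have n5 : \forall q \near p, 0 < q.2 -> `|h2 q| <= 2^-1 * q.2.
    by apply: flat_near_bound f2 Op p0 _ _ => //; rewrite invr_gt0.
  apply: filterS2 (filterI (filterI n1 n2) (filterI n3 n4))
    (filterI n0 n5) => q.
  by move=> [[d1 d2] [d3 d4]] [Oq q5]; exact: And3 Oq (And4 d1 d2 d3 d4) q5.
have [Z [[oZ JZ] ZQ _ stair adj]] := boundary_shrink ab HQ.
have ZO : Z `<=` O by move=> q /ZQ[].
have dh p : Z p -> [/\ `|'D_e1 h1 p| <= 4^-1, `|'D_e2 h1 p| <= 4^-1,
        `|'D_e1 h2 p| <= 4^-1 & `|'D_e2 h2 p| <= 4^-1] by move=> /ZQ[].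
have ff1 := flat_smoothS ZO f1; have ff2 := flat_smoothS ZO f2.
pose H := perturb h1 h2.
have Hup p : Z p -> 0 < p.2 -> 0 < (H p).2.
  move=> /ZQ[_ _ Hp] p0; have := Hp p0; rewrite /H /perturb /= ler_norml.
  by move=> /andP[]; lra.
have Hlow p : Z p -> p.2 <= 0 -> H p = p by exact: perturb_lower.
have Hinj p q : Z p -> Z q -> H p = H q -> p = q.
  move=> Op Oq E.
  have [p0|p0] := leP p.2 0; have [q0|q0] := leP q.2 0.
  - by rewrite -(Hlow p)// -(Hlow q).
  - by have := Hup q Oq q0; rewrite -E Hlow// ltNge p0.
  - by have := Hup p Op p0; rewrite E Hlow// ltNge q0.
  wlog pq : p q Op Oq E p0 q0 / p.2 <= q.2.
    move=> WL; have [pq|/ltW qp] := leP p.2 q.2; first exact: WL.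
    by apply/esym; apply: WL.
  have [Sv Sh] := stair p q (conj Op p0) (conj Oq q0) pq.
  have Sv' t : Num.min p.2 q.2 <= t <= Num.max p.2 q.2 -> Z (q.1, t).
    by rewrite (min_idPl pq) (max_idPr pq); exact: Sv.
  have l1 : `|h1 p - h1 q| <= 4^-1 * sum_dist p q.
    apply: lipschitz_corner => t.
      move=> /Sv' Ot; have [_ d _ _] := dh _ Ot.
      by split; [exact: smooth_differentiable ff1.1 Ot|exact: d].
    move=> /Sh Ot; have [d _ _ _] := dh _ Ot.
    by split; [exact: smooth_differentiable ff1.1 Ot|exact: d].
  have l2 : `|h2 p - h2 q| <= 4^-1 * sum_dist p q.
    apply: lipschitz_corner => t.
      move=> /Sv' Ot; have [_ _ _ d] := dh _ Ot.
      by split; [exact: smooth_differentiable ff2.1 Ot|exact: d].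
    move=> /Sh Ot; have [_ _ d _] := dh _ Ot.
    by split; [exact: smooth_differentiable ff2.1 Ot|exact: d].
  have := sum_dist_expand l1 l2.
  rewrite -/(perturb h1 h2 p) -/(perturb h1 h2 q) -/H E.
  have -> : sum_dist (H q) (H q) = 0 by rewrite /sum_dist !subrr normr0 addr0.
  rewrite mulr0 /sum_dist => le0.
  have n1 := normr_ge0 (p.1 - q.1); have n2 := normr_ge0 (p.2 - q.2).
  apply: injective_projections; apply/eqP; rewrite -subr_eq0 -normr_le0; lra.
have /choice[K HK] : forall q, exists p, (H @` Z) q -> Z p /\ H p = q.
  move=> q; have [[p Op E]|n] := pselect ((H @` Z) q); first by exists p.
  by exists q.
have KH p : Z p -> (K (H p)).1 = p.1 /\ (K (H p)).2 = p.2.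
  move=> Op; have [OK E] := HK (H p) (ex_intro2 _ _ p Op erefl).
  by rewrite (Hinj _ _ OK Op E).
have oHO : open (H @` Z) := perturb_image_open oZ ff1.1 ff2.1 dh.
have [sK1 sK2] := inverse_smooth oZ ff1.1 ff2.1 dh (K1 := fst \o K) (K2 := snd \o K) KH.
have Klow q : (H @` Z) q -> q.2 <= 0 -> (K q).1 = q.1 /\ (K q).2 = q.2.
  move=> [p Op <-] q0; have [E1 E2] := KH p Op.
  have p0 : p.2 <= 0 by rewrite leNgt; apply/negP => /(Hup _ Op); rewrite ltNge q0.
  by rewrite E1 E2 Hlow.
exists Z, (fst \o K), (snd \o K); split.
- by split => // q /ZQ[].
- by split.
- split; last by move=> q Hq q0; rewrite /= (Klow q Hq q0).1 subrr.
  by apply: smoothB => //; exact: smooth_fst.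
- split; last by move=> q Hq q0; rewrite /= (Klow q Hq q0).2 subrr.
  by apply: smoothB => //; exact: smooth_snd.
Qed.

End FlatInverse.

(** * Derivatives of pullbacks *)

Section Pullback.
Context {R : realType}.
Implicit Types (U V W : set (R * R)) (f g h w : R * R -> R) (p q z : R * R)
  (I J : seq bool).

Definition shear_map f1 f2 p : R * R := (p.1 + p.2 + f1 p, p.2 + f2 p).

Definition vcount I := count id I.

Context (O : set (R * R)) (f1 f2 : R * R -> R) (oO : open O)
  (ff1 : flat_smooth O f1) (ff2 : flat_smooth O f2).

Let F := shear_map f1 f2.

Lemma smooth_shear1 : smooth_open O (fun p => (F p).1).
Proof.
by apply: smoothD => //; [apply: smoothD => //; [exact: smooth_fst|exact: smooth_snd]
  |exact: ff1.1].
Qed.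

Lemma smooth_shear2 : smooth_open O (fun p => (F p).2).
Proof. by apply: smoothD => //; [exact: smooth_snd|exact: ff2.1]. Qed.

Lemma derive_shear1 p b : O p ->
  'D_(edir b) (fun p => (F p).1) p = 1 + 'D_(edir b) f1 p.
Proof.
move=> Op; have d1 := differentiable_fst p; have d2 := differentiable_snd p.
have df := smooth_differentiable ff1.1 Op.
have -> : (fun p => (F p).1) = (fst : R * R -> R) + snd + f1 by [].
have d12 : differentiable ((fst : R * R -> R) + snd) p by exact: differentiableD.
rewrite deriveD; [|exact: diff_derivable|exact: diff_derivable].
rewrite deriveD; [|exact: diff_derivable|exact: diff_derivable].
by rewrite derive_fst derive_snd; case: b; rewrite /= ?add0r ?addr0.
Qed.

Lemma derive_shear2 p b : O p ->
  'D_(edir b) (fun p => (F p).2) p = b%:R + 'D_(edir b) f2 p.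
Proof.
move=> Op; have d2 := differentiable_snd p.
have df := smooth_differentiable ff2.1 Op.
have -> : (fun p => (F p).2) = (snd : R * R -> R) + f2 by [].
rewrite deriveD; [|exact: diff_derivable|exact: diff_derivable].
by rewrite derive_snd; case: b.
Qed.

Lemma smooth_pullback U V w : open U -> U `<=` O -> (forall p, U p -> V (F p)) ->
  smooth_open V w -> smooth_open U (fun p => w (F p)).
Proof.
move=> oU UO UV sw.
apply: (@smooth_comp2 _ _ U V (fun p => (F p).1) (fun p => (F p).2)) => //.
- exact: smooth_openS smooth_shear1.
- exact: smooth_openS smooth_shear2.
Qed.

Lemma derive_pullback U V w b z : open U -> U `<=` O ->
  (forall p, U p -> V (F p)) -> smooth_open V w -> U z ->
  'D_(edir b) (fun p => w (F p)) z =
  Dword [:: b] w (F z) + b%:R * Dword [:: false] w (F z) +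
  ('D_(edir b) f1 z * Dword [:: false] w (F z) +
   'D_(edir b) f2 z * Dword [:: true] w (F z)).
Proof.
move=> oU UO UV sw Uz.
have := derive_comp2 (f := fun p => (F p).1) (g := fun p => (F p).2) (h := w) (edir b)
  (smooth_differentiable smooth_shear1 (UO _ Uz))
  (smooth_differentiable smooth_shear2 (UO _ Uz))
  (smooth_differentiable sw (UV _ Uz)).
rewrite -/(F z) => ->; rewrite derive_shear1 ?derive_shear2//; try exact: UO.
rewrite -[((F z).1, _)]/(F z) /Dword /=.
generalize ('D_(edir b) f1 z) ('D_(edir b) f2 z) => d1 d2.
case: b => /=; generalize ('D_e1 w (F z)) ('D_e2 w (F z)) => x1 x2; ring.
Qed.

Lemma derive_pullback_word U V w b J z : open U -> U `<=` O ->
  (forall p, U p -> V (F p)) -> smooth_open V w -> U z ->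
  'D_(edir b) (fun p => Dword J w (F p)) z =
  Dword (b :: J) w (F z) + b%:R * Dword (false :: J) w (F z) +
  ('D_(edir b) f1 z * Dword (false :: J) w (F z) +
   'D_(edir b) f2 z * Dword (true :: J) w (F z)).
Proof.
move=> oU UO UV sw Uz.
exact: (derive_pullback b oU UO UV (smooth_Dword J sw) Uz).
Qed.

(** Lower order terms in the derivatives of order at most [k] of a pullback:
    each either involves fewer than [m] derivatives in [phi], or has a flat
    coefficient. *)
Inductive lower_order (k m : nat) :
    ((R * R -> R) -> R * R -> R) -> Prop :=
| lower_zero : lower_order k m (fun _ _ => 0)
| lower_word J : (size J <= k)%N -> (vcount J < m)%N ->
    lower_order k m (fun w z => Dword J w (F z))
| lower_flat c J : flat_smooth O c -> (size J <= k)%N ->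
    lower_order k m (fun w z => c z * Dword J w (F z))
| lower_add S T : lower_order k m S -> lower_order k m T ->
    lower_order k m (fun w z => S w z + T w z).

Lemma lower_order_smooth k m T U V w : lower_order k m T ->
  open U -> U `<=` O -> (forall p, U p -> V (F p)) ->
  smooth_open V w -> smooth_open U (T w).
Proof.
move=> lT oU UO UV sw; elim: lT => [|J _ _|c J fc _|S S' _ IH _ IH'].
- exact: smooth_cst.
- exact: (smooth_pullback oU UO UV (smooth_Dword J sw)).
- apply: smoothM => //; first exact: smooth_openS fc.1.
  exact: (smooth_pullback oU UO UV (smooth_Dword J sw)).
- exact: smoothD.
Qed.

Lemma lower_orderW k m k' m' T : (k <= k')%N -> (m <= m')%N ->
  lower_order k m T -> lower_order k' m' T.
Proof.
move=> kk mm; elim=> [|J J1 J2|c J fc J1|S S' _ IH _ IH'].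
- exact: lower_zero.
- by apply: lower_word; [exact: leq_trans kk|exact: leq_trans mm].
- by apply: lower_flat => //; exact: leq_trans kk.
- exact: lower_add.
Qed.

Lemma lower_flat_word k m b J c : flat_smooth O c -> (size J <= k)%N ->
  exists2 T, lower_order k.+1 m T &
    forall U V w z, open U -> U `<=` O -> (forall p, U p -> V (F p)) ->
      smooth_open V w -> U z ->
      'D_(edir b) (fun p => Dword J w (F p)) z * c z = T w z.
Proof.
move=> fc Jk.
exists (fun w z => c z * Dword (b :: J) w (F z) +
  ((b%:R * c z) * Dword (false :: J) w (F z) +
  (('D_(edir b) f1 z * c z) * Dword (false :: J) w (F z) +
   ('D_(edir b) f2 z * c z) * Dword (true :: J) w (F z)))).
  do 3?apply: lower_add; apply: lower_flat => //; apply: flat_smoothM => //.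
  - exact: smooth_cst.
  - exact: (smooth_derive (edir b) ff1.1).
  - exact: (smooth_derive (edir b) ff2.1).
move=> U V w z oU UO UV sw Uz.
rewrite (derive_pullback_word b J oU UO UV sw Uz).
generalize ('D_(edir b) f1 z) ('D_(edir b) f2 z) (c z) => d1 d2 cz.
generalize (Dword (b :: J) w (F z)) => x.
generalize (Dword (false :: J) w (F z)) (Dword (true :: J) w (F z)) => x1 x2.
by ring.
Qed.

Lemma lower_order_derive k m (b : bool) T : lower_order k m T ->
  exists2 T', lower_order k.+1 (m + b) T' &
    forall U V w z, open U -> U `<=` O -> (forall p, U p -> V (F p)) ->
      smooth_open V w -> U z -> 'D_(edir b) (T w) z = T' w z.
Proof.
elim=> {T} [|J J1 J2|c J fc J1|S S' lS [T lT TE] lS' [T' lT' TE']].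
- exists (fun _ _ => 0); first exact: lower_zero.
  by move=> U V w z *; rewrite (derive_cst (0 : R)).
- exists (fun w z => Dword (b :: J) w (F z) +
    ((if b then Dword (false :: J) w (F z) else 0) +
    ('D_(edir b) f1 z * Dword (false :: J) w (F z) +
     'D_(edir b) f2 z * Dword (true :: J) w (F z)))).
    apply: lower_add; first by apply: lower_word => //; rewrite /vcount /= addnC ltn_add2r.
    apply: lower_add.
      case: b; last exact: lower_zero.
      by apply: lower_word => //; rewrite /vcount /= addn1 add0n ltnW.
    by apply: lower_add; apply: lower_flat => //; exact: flat_smooth_derive.
  move=> U V w z oU UO UV sw Uz.
  rewrite (derive_pullback_word b J oU UO UV sw Uz) -addrA.
  by congr (_ + (_ + _)); case: (b); rewrite /= ?mul1r ?mul0r.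
- have [T lT TE] := lower_flat_word (m + b) b fc J1.
  exists (fun w z => 'D_(edir b) c z * Dword J w (F z) + T w z).
    apply: lower_add => //; apply: lower_flat; first exact: flat_smooth_derive.
    exact: leqW.
  move=> U V w z oU UO UV sw Uz.
  rewrite derive_mul; last 2 first.
  + exact: smooth_differentiable fc.1 (UO _ Uz).
  + exact: smooth_differentiable (smooth_pullback oU UO UV (smooth_Dword J sw)) Uz.
  by rewrite -(TE _ _ _ _ oU UO UV sw Uz) addrC mulrC [X in _ + X]mulrC.
- exists (fun w z => T w z + T' w z); first exact: lower_add.
  move=> U V w z oU UO UV sw Uz.
  have sS := lower_order_smooth lS oU UO UV sw.
  have sS' := lower_order_smooth lS' oU UO UV sw.
  rewrite -(TE _ _ _ _ oU UO UV sw Uz) -(TE' _ _ _ _ oU UO UV sw Uz).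
  rewrite -[fun z => _]/(S w + S' w) deriveD//; apply: diff_derivable.
    exact: smooth_differentiable sS Uz.
  exact: smooth_differentiable sS' Uz.
Qed.

(** Since the shear only adds [phi] to [tau], the leading part of a derivative
    of a pullback is the pullback of the same derivative. *)
Lemma Dword_pullback I : exists2 T, lower_order (size I) (vcount I) T &
  forall U V w z, open U -> U `<=` O -> (forall p, U p -> V (F p)) ->
    smooth_open V w -> U z ->
    Dword I (fun p => w (F p)) z = Dword I w (F z) + T w z.
Proof.
elim: I => [|b I [T lT TE]].
  exists (fun _ _ => 0); first exact: lower_zero.
  by move=> U V w z *; rewrite addr0.
have [T' lT' TE'] := lower_order_derive b lT.
exists (fun w z => ((if b then Dword (false :: I) w (F z) else 0) +
    ('D_(edir b) f1 z * Dword (false :: I) w (F z) +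
     'D_(edir b) f2 z * Dword (true :: I) w (F z))) + T' w z).
  apply: lower_add; last first.
    by apply: lower_orderW lT' => //; rewrite /vcount /= addnC.
  apply: lower_add.
    case: b {lT' TE'} => /=; last exact: lower_zero.
    by apply: lower_word.
  by apply: lower_add; apply: lower_flat => //; exact: flat_smooth_derive.
move=> U V w z oU UO UV sw Uz.
have E p : U p -> Dword I (fun p => w (F p)) p = Dword I w (F p) + T w p.
  exact: (TE U V w p oU UO UV sw).
refine (etrans (eq_derive (edir b) oU E Uz) _).
have s1 := smooth_pullback oU UO UV (smooth_Dword I sw).
have s2 := lower_order_smooth lT oU UO UV sw.
rewrite -[fun p => Dword I w (F p) + T w p]/((fun p => Dword I w (F p)) + T w).
rewrite deriveD; last 2 first.
- by apply: diff_derivable; exact: smooth_differentiable s1 Uz.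
- by apply: diff_derivable; exact: smooth_differentiable s2 Uz.
rewrite (TE' _ _ _ _ oU UO UV sw Uz) (derive_pullback_word b I oU UO UV sw Uz).
rewrite -!addrA; congr (_ + (_ + _)).
by case: (b); rewrite /= ?mul1r ?mul0r.
Qed.

End Pullback.

(** * Weighted norms and the barrier *)

Section Estimates.
Context {R : realType}.
Implicit Types (U V W : set (R * R)) (f g h w : R * R -> R) (p q z : R * R)
  (I J : seq bool).

Lemma uniform_words (P : seq bool -> R -> Prop) :
  (forall I C C', C <= C' -> P I C -> P I C') ->
  (forall I, exists C, P I C) ->
  forall k, exists2 C, 0 <= C & forall I, (size I <= k)%N -> P I C.
Proof.
move=> Pmon Pex k; elim: k P Pmon Pex => [|k IH] P Pmon Pex.
  have [C PC] := Pex [::]; exists (Num.max 0 C); first by rewrite le_max lexx.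
  by case=> // _; apply: Pmon PC; rewrite le_max lexx orbT.
have [C PC] := Pex [::].
have {}IH b : exists2 C, 0 <= C & forall I, (size I <= k)%N -> P (b :: I) C.
  apply: IH => [J D D'|J]; last exact: Pex.
  exact: Pmon.
have [C1 C10 H1] := IH true; have [C2 C20 H2] := IH false.
exists (Num.max C (Num.max C1 C2)); first by rewrite !le_max C10 orbT.
case=> [_|[] J Jk].
- by apply: Pmon PC; rewrite le_max lexx.
- by apply: (Pmon _ C1); [rewrite !le_max lexx orbT|exact: H1].
- by apply: (Pmon _ C2); [rewrite !le_max lexx !orbT|exact: H2].
Qed.

Lemma vcount_size J : (vcount J <= size J)%N.
Proof. exact: count_size. Qed.

Context (O : set (R * R)) (f1 f2 : R * R -> R) (oO : open O)
  (ff1 : flat_smooth O f1) (ff2 : flat_smooth O f2).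

Let F := shear_map f1 f2.

(** Points at which one step of the map is controlled by [phi] alone. *)
Definition tame z := [/\ 0 < z.2, z.2 <= 2^-1, `|f1 z| <= 2^-1 * z.2 &
  `|f2 z| <= z.2 ^+ 2].

Lemma tame_height z : tame z -> z.2 <= (1 + 2 * z.2) * (F z).2.
Proof.
move=> [z0 z1 _]; rewrite ler_norml => /andP[l _].
have h : (1 + 2 * z.2) * (z.2 - z.2 ^+ 2) <= (1 + 2 * z.2) * (F z).2.
  rewrite ler_wpM2l//; first by lra.
  by rewrite /F /shear_map /=; lra.
apply: le_trans h; rewrite -subr_ge0.
rewrite (_ : _ - z.2 = z.2 ^+ 2 * (1 - 2 * z.2)); last by ring.
by apply: mulr_ge0; [exact: sqr_ge0|lra].
Qed.

Lemma tame_height2 z : tame z -> z.2 <= 2 * (F z).2.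
Proof.
move=> tz; have h := tame_height tz; have [z0 z1 _ _] := tz.
have F0 : 0 <= (F z).2.
  rewrite -(@pmulr_rge0 _ (1 + 2 * z.2)); last by lra.
  by apply: le_trans h; exact: ltW.
apply: (le_trans h); rewrite ler_wpM2r//; lra.
Qed.

Lemma tame_pos z : tame z -> 0 < (F z).2.
Proof. by move=> tz; have := tame_height2 tz; case: tz => z0 _ _ _; lra. Qed.

Lemma weighted_le z J (N d : R) : tame z -> 0 <= d ->
  (F z).2 ^+ vcount J * d <= N ->
  z.2 ^+ vcount J * d <= 2 ^+ vcount J * N.
Proof.
move=> tz d0 H; have [z0 _ _ _] := tz.
have F0 := tame_pos tz.
apply: (@le_trans _ _ ((2 * (F z).2) ^+ vcount J * d)).
  rewrite ler_wpM2r//; apply: lerXn2r; rewrite ?nnegrE; try exact: ltW.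
    by rewrite mulr_ge0// ltW.
  exact: tame_height2.
by rewrite exprMn -mulrA ler_wpM2l// exprn_ge0.
Qed.

(** A word with fewer derivatives in [phi] than the weight accounts for leaves a
    factor [phi], and a flat coefficient is smaller than any power of [phi]. *)
Lemma lower_order_bound k m T al be eta : lower_order O f1 f2 k m T ->
  box al be eta `<=` O ->
  exists2 C, 0 <= C & forall w z N, box al be eta z -> tame z -> 0 <= N ->
    (forall J, (size J <= k)%N -> (F z).2 ^+ vcount J * `|Dword J w (F z)| <= N) ->
    z.2 ^+ m * `|T w z| <= C * (z.2 * N).
Proof.
move=> lT bO; elim: lT => {T} [|J Jk Jm|c J fc Jk|S T _ [C1 C10 H1] _ [C2 C20 H2]].
- by exists 0 => // w z N *; rewrite normr0 mulr0 mul0r.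
- exists (2 ^+ vcount J) => [|w z N bz tz N0 H]; first exact: exprn_ge0.
  have [z0 z1 _ _] := tz.
  have -> : m = (m - (vcount J).+1 + 1 + vcount J)%N.
    by rewrite -addnA add1n subnK.
  rewrite !exprD expr1 -!mulrA.
  have h := weighted_le tz (normr_ge0 _) (H J Jk).
  apply: (@le_trans _ _ (1 * (z.2 * (2 ^+ vcount J * N)))).
    apply: ler_pM; rewrite ?exprn_ge0 ?mulr_ge0 ?exprn_ge0//; try exact: ltW.
      by apply: exprn_ile1; [exact: ltW|lra].
    by rewrite ler_pM2l.
  by rewrite mul1r mulrCA.
- have [Cc Cc0 Hc] := flat_smooth_bound k.+1 oO fc bO.
  exists (Cc * 2 ^+ vcount J) => [|w z N bz tz N0 H].
    by rewrite mulr_ge0// exprn_ge0.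
  have [z0 z1 _ _] := tz.
  have h := weighted_le tz (normr_ge0 _) (H J Jk).
  rewrite normrM.
  have kE : k.+1 = (k - vcount J + 1 + vcount J)%N.
    by rewrite addnAC subnK ?addn1// (leq_trans (vcount_size J)).
  apply: (@le_trans _ _ (1 * (Cc * z.2 ^+ k.+1 * `|Dword J w (F z)|))).
    apply: ler_pM; rewrite ?exprn_ge0 ?mulr_ge0//; try exact: ltW.
      by apply: exprn_ile1; [exact: ltW|lra].
    by rewrite ler_wpM2r// Hc.
  rewrite mul1r kE !exprD expr1 -!mulrA ler_wpM2l//.
  apply: (@le_trans _ _ (1 * (z.2 * (2 ^+ vcount J * N)))).
    apply: ler_pM; rewrite ?exprn_ge0 ?mulr_ge0 ?exprn_ge0//; try exact: ltW.
      by apply: exprn_ile1; [exact: ltW|lra].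
    by rewrite ler_pM2l.
  by rewrite mul1r mulrCA.
- exists (C1 + C2) => [|w z N bz tz N0 H]; first exact: addr_ge0.
  have [z0 _ _ _] := tz.
  rewrite mulrDl (le_trans _ (lerD (H1 w z N bz tz N0 H) (H2 w z N bz tz N0 H)))//.
  by rewrite -mulrDr ler_wpM2l ?ler_normD// exprn_ge0// ltW.
Qed.

Definition weighted_bound (k : nat) w p (N : R) :=
  forall J, (size J <= k)%N -> p.2 ^+ vcount J * `|Dword J w p| <= N.

(** Pulling back by one step multiplies the weighted norms, in which each
    derivative in [phi] is multiplied by [phi], by at most [1 + O(phi)]. *)
Lemma pullback_bound k al be eta : box al be eta `<=` O ->
  exists2 L, 0 <= L & forall U V w z N, open U -> U `<=` O ->
    (forall p, U p -> V (F p)) -> smooth_open V w -> U z ->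
    box al be eta z -> tame z -> 0 <= N -> weighted_bound k w (F z) N ->
    weighted_bound k (fun p => w (F p)) z (expR (L * z.2) * N).
Proof.
move=> bO.
have [C C0 HC] : exists2 C, 0 <= C & forall I, (size I <= k)%N ->
    (size I <= k)%N -> forall U V w z N, open U -> U `<=` O ->
    (forall p, U p -> V (F p)) -> smooth_open V w -> U z ->
    box al be eta z -> tame z -> 0 <= N -> weighted_bound k w (F z) N ->
    z.2 ^+ vcount I * `|Dword I (fun p => w (F p)) z| <=
      (1 + 2 * z.2) ^+ k * N + C * (z.2 * N).
  apply: uniform_words => [I C C' CC' H Ik U V w z N oU UO UV sw Uz bz tz N0 wb|I].
    apply: le_trans (H Ik U V w z N oU UO UV sw Uz bz tz N0 wb) _.
    have [z0 _ _ _] := tz.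
    by rewrite lerD2l ler_wpM2r// mulr_ge0// ltW.
  have [Ik|nIk] := boolP (size I <= k)%N; last by exists 0.
  have [T lT TE] := Dword_pullback oO ff1 ff2 I.
  have [C C0 HC] := lower_order_bound (lower_orderW Ik (leqnn _) lT) bO.
  exists C => _ U V w z N oU UO UV sw Uz bz tz N0 wb.
  have [z0 z1 _ _] := tz.
  rewrite (TE _ _ _ _ oU UO UV sw Uz).
  have h2 := HC w z N bz tz N0 wb.
  have zI0 : 0 <= z.2 ^+ vcount I by rewrite exprn_ge0// ltW.
  apply: le_trans (ler_wpM2l zI0 (ler_normD _ _)) _; rewrite mulrDr.
  apply: lerD => //.
  have F0 := tame_pos tz.
  apply: (@le_trans _ _ (((1 + 2 * z.2) * (F z).2) ^+ vcount I * `|Dword I w (F z)|)).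
    rewrite ler_wpM2r//; apply: lerXn2r; rewrite ?nnegrE; try exact: ltW.
      by rewrite mulr_ge0//; [lra|exact: ltW].
    exact: tame_height.
  rewrite exprMn -mulrA ler_pM//.
  - by rewrite exprn_ge0//; lra.
  - by rewrite mulr_ge0// exprn_ge0// ltW.
  - by rewrite ler_weXn2l//; [lra|rewrite (leq_trans (vcount_size I))].
  - exact: wb.
exists (2 * k%:R + C) => [|U V w z N oU UO UV sw Uz bz tz N0 wb I Ik].
  by rewrite addr_ge0// mulr_ge0.
apply: le_trans (HC I Ik Ik U V w z N oU UO UV sw Uz bz tz N0 wb) _.
have [z0 _ _ _] := tz.
rewrite mulrA -mulrDl ler_wpM2r// [X in expR X]mulrDl expRD.
apply: (@le_trans _ _ ((1 + 2 * z.2) ^+ k * (1 + C * z.2))).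
  have x1 : 1 <= (1 + 2 * z.2) ^+ k by rewrite exprn_ege1//; lra.
  have x2 : 0 <= C * z.2 by rewrite mulr_ge0// ltW.
  by rewrite mulrDr mulr1 lerD2l -[leLHS]mul1r ler_wpM2r.
apply: ler_pM.
- by rewrite exprn_ge0//; lra.
- by rewrite addr_ge0// mulr_ge0// ltW.
- rewrite (_ : 2 * k%:R * z.2 = k%:R * (2 * z.2)); last by ring.
  rewrite expRM_natl; apply: lerXn2r; rewrite ?nnegrE ?expR_ge0//; first by lra.
  exact: expR_ge1Dx.
- exact: expR_ge1Dx.
Qed.

Lemma tame_height_le z : tame z -> (F z).2 <= z.2 * expR z.2.
Proof.
move=> [z0 z1 _ g2]; apply: (@le_trans _ _ (z.2 * (1 + z.2))).
  by move: g2; rewrite ler_norml /F /shear_map /= => /andP[_];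
    rewrite mulrDr mulr1 -expr2; lra.
by rewrite ler_pM2l// expR_ge1Dx.
Qed.

Lemma tame_shift z : tame z -> z.1 + 2^-1 * z.2 <= (F z).1.
Proof.
by move=> [z0 z1 g1 _]; move: g1; rewrite ler_norml /F /shear_map /= => /andP[]; lra.
Qed.

Lemma tame_shift_le z : tame z -> (F z).1 <= z.1 + (1 + 2^-1) * z.2.
Proof.
by move=> [z0 z1 g1 _]; move: g1; rewrite ler_norml /F /shear_map /= => /andP[]; lra.
Qed.

Definition barrier (A K : R) (M : nat) z : R := A * (z.2 ^+ M * expR (- K * z.1)).

(** Since [tau] grows by at least [phi / 2], the factor [exp (- K tau)] absorbs
    the growth [exp (L phi)] of the weighted norms and the growth [exp (M phi)]
    of [phi ^ M]; a factor [exp (- phi)] remains, which leaves room for the next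
    term of the sum. *)
Lemma barrier_step (A L K : R) (M : nat) z : 0 <= A -> 0 <= L -> tame z ->
  K = 2 * (L + M%:R + 1) ->
  expR (L * z.2) * barrier A K M (F z) <= barrier A K M z * (1 - 2^-1 * z.2).
Proof.
move=> A0 L0 tz KE; have [z0 z1 g1 g2] := tz; have F0 := tame_pos tz.
rewrite /barrier mulrCA -[leRHS]mulrA ler_wpM2l//.
have e1 := tame_height_le tz.
have e2 : (F z).2 ^+ M <= z.2 ^+ M * expR (M%:R * z.2).
  rewrite expRM_natl -exprMn; apply: lerXn2r => //; rewrite nnegrE; first exact: ltW.
  by rewrite mulr_ge0 ?expR_ge0// ltW.
have e3 := tame_shift tz.
have K0 : 0 <= K by rewrite KE mulr_ge0// addr_ge0// addr_ge0.
have e4 : expR (- K * (F z).1) <= expR (- K * z.1) * expR (- (L + M%:R + 1) * z.2).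
  rewrite -expRD ler_expR.
  rewrite (_ : _ + _ = - K * (z.1 + 2^-1 * z.2)); last by rewrite KE; field.
  by rewrite !mulNr lerN2 ler_wpM2l.
have e5 : expR (- z.2) <= 1 - 2^-1 * z.2.
  have d0 : 0 < 1 + z.2 by lra.
  rewrite expRN (@le_trans _ _ (1 + z.2)^-1)//.
    by rewrite lef_pV2 ?posrE ?expR_gt0// expR_ge1Dx.
  rewrite -div1r ler_pdivrMr// -subr_ge0.
  rewrite (_ : _ - 1 = 2^-1 * z.2 * (1 - z.2)); last by field.
  by apply: mulr_ge0; [rewrite mulr_ge0// ltW|lra].
apply: (@le_trans _ _ (expR (L * z.2) * ((z.2 ^+ M * expR (M%:R * z.2)) *
   (expR (- K * z.1) * expR (- (L + M%:R + 1) * z.2))))).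
  rewrite ler_wpM2l ?expR_ge0//; apply: ler_pM => //; rewrite ?expR_ge0//.
  by rewrite exprn_ge0// ltW.
rewrite (_ : _ * _ = z.2 ^+ M * expR (- K * z.1) * expR (- z.2)).
  by rewrite ler_wpM2l// mulr_ge0 ?expR_ge0// exprn_ge0// ltW.
have -> : expR (- z.2) = expR (L * z.2) * expR (M%:R * z.2) *
    expR (- (L + M%:R + 1) * z.2).
  by rewrite -!expRD; congr expR; ring.
by ring.
Qed.

End Estimates.

(** * Sums along orbits *)

Section Dynamics.
Context {R : realType}.
Implicit Types (U V W : set (R * R)) (f h : R * R -> R) (p q z : R * R)
  (w I J : seq bool).

Lemma Dword0 w p : Dword w (fun=> 0 : R) p = 0.
Proof.
suff -> : Dword w (fun=> 0 : R) = (fun=> 0) by [].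
elim: w => [//|b w IH]; rewrite Dword_cons IH.
by apply/funext => x; rewrite (derive_cst (0 : R)).
Qed.

Lemma Dword_sub U f h w p : open U -> smooth_open U f -> smooth_open U h ->
  U p -> Dword w (fun q => f q - h q) p = Dword w f p - Dword w h p.
Proof.
move=> oU sf sh; elim: w p => [//|b w IH] p Up.
refine (etrans (eq_derive (edir b) oU IH Up) _).
have d1 := smooth_differentiable (smooth_Dword w sf) Up.
have d2 := smooth_differentiable (smooth_Dword w sh) Up.
rewrite -[fun q => _]/(Dword w f - Dword w h) deriveB//; exact: diff_derivable.
Qed.

Context (a : \bar R) (O : set (R * R)) (f1 f2 g : R * R -> R) (c1 c2 : R)
  (oO : open O)
  (ff1 : flat_smooth O f1) (ff2 : flat_smooth O f2) (fg : flat_smooth O g)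
  (tameO : forall p, O p -> 0 < p.2 -> tame f1 f2 p /\ p.2 <= (c2 - c1) / 2)
  (g0 : forall p, O p -> c1 < p.1 -> g p = 0)
  (E : R -> R) (E0 : forall al, (a < al%:E)%E -> 0 < E al)
  (boxO : forall al, (a < al%:E)%E -> box al c2 (E al) `<=` O).

Let F := shear_map f1 f2.

(** The region below a level curve of [phi * exp (-2 tau)], which is not left
    before passing [c1]. *)
Definition sector al : set (R * R) := [set p | [/\ al < p.1, p.1 < c2 &
  p.2 * expR (- 2 * p.1) < E al * expR (- 2 * c2)]].

Definition sectors : set (R * R) :=
  \bigcup_(al in [set al | (a < al%:E)%E]) upper (sector al).

Lemma continuous_lt_open f h : continuous f -> continuous h ->
  open [set p | f p < h p].
Proof.
move=> cf ch.
have -> : [set p | f p < h p] = (fun p => h p - f p) @^-1` [set x | 0 < x].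
  by apply/seteqP; split => p /=; rewrite subr_gt0.
apply: open_comp; last exact: open_gt.
by move=> p _; apply: continuousB; [exact: ch|exact: cf].
Qed.

Lemma open_sector al : open (sector al).
Proof.
have cfst : continuous (fst : R * R -> R) by move=> p; exact: cvg_fst.
have cc (c : R) : continuous (fun _ : R * R => c) by move=> p; exact: cvg_cst.
have cQ : continuous (fun p : R * R => p.2 * expR (- 2 * p.1)).
  have sQ : smooth_open setT (fun p : R * R => p.2 * expR (- 2 * p.1)).
    apply: smoothM; [exact: openT|exact: smooth_snd|].
    apply: smooth_expR; [exact: openT|].
    by apply: smoothZ; [exact: openT|exact: smooth_fst].
  by move=> p; exact: (smooth_continuous sQ).
have -> : sector al = [set p | al < p.1] `&` [set p | p.1 < c2] `&`
    [set p | p.2 * expR (- 2 * p.1) < E al * expR (- 2 * c2)].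
  by apply/seteqP; split => [p []|p [[]]].
by apply: openI; [apply: openI|]; apply: continuous_lt_open.
Qed.

Lemma open_sectors : open sectors.
Proof. by apply: bigcup_open => al _; apply: open_upper; exact: open_sector. Qed.

Lemma sector_box al p : (a < al%:E)%E -> upper (sector al) p -> box al c2 (E al) p.
Proof.
move=> aal [[p1 p2 p3] /= p0]; split; first by rewrite !ltW.
rewrite (ltW p0) /=; apply/ltW.
have : expR (- 2 * c2) <= expR (- 2 * p.1) by rewrite ler_expR !mulNr lerN2 ler_pM2l// ltW.
move=> h; rewrite -(@ltr_pM2r _ (expR (- 2 * p.1))) ?expR_gt0//.
by rewrite (lt_le_trans p3)// ler_wpM2l// ltW// E0.
Qed.

Lemma sector_sub al p : (a < al%:E)%E -> upper (sector al) p ->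
  O p /\ tame f1 f2 p.
Proof.
move=> aal up; have Op := boxO aal (sector_box aal up).
by split => //; have [] := tameO Op (proj2 up).
Qed.

Lemma sectors_sub p : sectors p -> O p /\ tame f1 f2 p.
Proof. by move=> [al aal up]; exact: sector_sub up. Qed.

(** [phi * exp (-2 tau)] does not increase along orbits. *)
Lemma sector_step al p : (a < al%:E)%E -> upper (sector al) p -> p.1 <= c1 ->
  upper (sector al) (F p).
Proof.
move=> aal up pc; have [Op tp] := sector_sub aal up.
have [[p1 p2 p3] /= p0] := up.
have h1 := tame_shift tp; have h2 := tame_shift_le tp; have h3 := tame_height_le tp.
have [_ h4] := tameO Op p0.
split; last exact: tame_pos tp.
split; rewrite -/F in h1 h2 h3 *.
- lra.
- lra.
apply: le_lt_trans p3.
apply: (@le_trans _ _ (p.2 * expR p.2 * expR (- 2 * (p.1 + 2^-1 * p.2)))).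
  apply: ler_pM => //; [exact: ltW (tame_pos tp)|].
  by rewrite ler_expR !mulNr lerN2 ler_pM2l.
by rewrite -mulrA -expRD (_ : p.2 + _ = - 2 * p.1) ?lexx//; field.
Qed.

Lemma sectors_step p : sectors p -> p.1 <= c1 -> sectors (F p).
Proof. by move=> [al aal up] pc; exists al => //; exact: sector_step. Qed.

Fixpoint forward_sum (n : nat) p : R :=
  if n is m.+1 then (if c1 < p.1 then 0 else forward_sum m (F p) - g p) else 0.

Fixpoint exits (n : nat) : set (R * R) :=
  [set p | sectors p /\
    (c1 < p.1 \/ if n is m.+1 then exits m (F p) else False)].

Lemma exitsS n p : exits n.+1 p <-> sectors p /\ (c1 < p.1 \/ exits n (F p)).
Proof. by []. Qed.

Lemma exits_sectors n p : exits n p -> sectors p.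
Proof. by case: n => [|n] []. Qed.

Lemma exits_right n p : sectors p -> c1 < p.1 -> exits n p.
Proof. by case: n => [|n] Dp cp; split => //; left. Qed.

Lemma forward_sum_right n p : c1 < p.1 -> forward_sum n p = 0.
Proof. by case: n => [//|n] /= ->. Qed.

Lemma exits_stable n m p : exits n p -> (n <= m)%N ->
  exits m p /\ forward_sum m p = forward_sum n p.
Proof.
elim: n m p => [|n IH] m p.
  by move=> [Dp [cp|//]] _; split; [exact: exits_right|rewrite !forward_sum_right].
move=> [Dp [cp|ep]]; first by split; [exact: exits_right|rewrite !forward_sum_right].
case: m => // m nm; have [em Em] := IH m (F p) ep nm.
by split; [split => //; right|rewrite /= Em].
Qed.

(** [phi * exp (4 tau)] does not decrease along orbits, so that [tau] grows by
    a definite amount at each step. *)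
Lemma exits_ex p : sectors p -> exists n, exits n p.
Proof.
move=> Dp0; pose Q p : R := p.2 * expR (4 * (p.1 - c1)).
have Qpos : 0 < Q p.
  by rewrite mulr_gt0 ?expR_gt0//; have [_ []] := sectors_sub Dp0.
have main n q : sectors q -> Q p <= Q q -> c1 - q.1 < n%:R * (2^-1 * Q p) ->
    exits n q.
  elim: n q => [|n IH] q Dq Qq nq.
    by apply: exits_right => //; move: nq; rewrite mul0r subr_lt0.
  have [cq|qc] := ltP c1 q.1; first exact: exits_right.
  have [_ tq] := sectors_sub Dq.
  have h1 := tame_shift tq; have h2 := tame_height tq; rewrite -/F in h1 h2.
  have [q0 _ _ _] := tq; have F0 := tame_pos tq; rewrite -/F in F0.
  apply/exitsS; split => //; right; apply: IH; first exact: sectors_step.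
    apply: le_trans Qq _; rewrite /Q.
    apply: (@le_trans _ _ ((1 + 2 * q.2) * (F q).2 * expR (4 * (q.1 - c1)))).
      by rewrite ler_wpM2r ?expR_ge0.
    rewrite mulrAC [leRHS]mulrC ler_wpM2r//; first exact: ltW.
    apply: (@le_trans _ _ (expR (2 * q.2) * expR (4 * (q.1 - c1)))).
      by rewrite ler_wpM2r ?expR_ge0// expR_ge1Dx.
    by rewrite -expRD ler_expR; lra.
  have Qle : Q p <= q.2.
    apply: le_trans Qq _; rewrite /Q -[leRHS]mulr1 ler_wpM2l//; first exact: ltW.
    by rewrite expR_le1; lra.
  move: nq; rewrite -natr1 mulrDl mul1r; lra.
have r0 : 0 < 2^-1 * Q p by rewrite mulr_gt0.
pose n := Num.bound `|(c1 - p.1) / (2^-1 * Q p)|.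
exists n; apply: main => //.
rewrite -ltr_pdivrMr//; apply: le_lt_trans (ler_norm _) _.
by apply: archi_boundP; exact: normr_ge0.
Qed.

Lemma open_preimage U V : open U -> U `<=` O -> open V ->
  open [set p | U p /\ V (F p)].
Proof.
move=> oU UO oV; rewrite openE => p [Up Vp].
have dF : {for p, continuous F}.
  have d1 := smooth_differentiable (smooth_shear1 f2 oO ff1) (UO _ Up).
  have d2 := smooth_differentiable (smooth_shear2 f1 oO ff2) (UO _ Up).
  exact: differentiable_continuous (differentiable_pair d1 d2).
have nV : \forall q \near p, V (F q) by apply: dF; exact: open_nbhs_nbhs.
have nU : \forall q \near p, U q by exact: open_nbhs_nbhs.
by apply: filterS2 nU nV => q; exact: conj.
Qed.

Lemma sectors_O : sectors `<=` O.
Proof. by move=> p /sectors_sub[]. Qed.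

Lemma open_right : open [set p : R * R | c1 < p.1].
Proof.
by apply: continuous_lt_open => p; [exact: cvg_cst|exact: cvg_fst].
Qed.

Lemma open_exits n : open (exits n).
Proof.
elim: n => [|n IH].
  have -> : exits 0 = sectors `&` [set p | c1 < p.1].
    by apply/seteqP; split => [p [? []]|p [? ?]]//; split => //; left.
  by apply: openI; [exact: open_sectors|exact: open_right].
have -> : exits n.+1 = (sectors `&` [set p | c1 < p.1]) `|`
    [set p | sectors p /\ exits n (F p)].
  apply/seteqP; split => [p [Dp [cp|ep]]|p [[Dp cp]|[Dp ep]]].
  - by left.
  - by right.
  - by split => //; left.
  - by split => //; right.
apply: openU; first by apply: openI; [exact: open_sectors|exact: open_right].
exact: open_preimage open_sectors sectors_O IH.
Qed.

Lemma forward_sumS n p : sectors p -> exits n (F p) ->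
  forward_sum n.+1 p = forward_sum n (F p) - g p.
Proof.
move=> Dp ep /=; case: ifPn => // cp.
have [Op tp] := sectors_sub Dp; have := tame_shift tp; have [p0 _ _ _] := tp.
rewrite -/F => h; rewrite forward_sum_right; last by lra.
by rewrite g0// subr0.
Qed.

Lemma forward_sum_smooth n : smooth_open (exits n) (forward_sum n).
Proof.
elim: n => [|n IH]; first exact: smooth_cst.
apply: smooth_open_local => p [Dp [cp|ep]].
  exists [set p | c1 < p.1], (fun=> 0); split => //.
  - exact: open_right.
  - exact: smooth_cst.
  - by move=> q cq; exact: forward_sum_right.
exists [set p | sectors p /\ exits n (F p)], (fun p => forward_sum n (F p) - g p).
have oU := open_preimage open_sectors sectors_O (@open_exits n).
have UO : [set p | sectors p /\ exits n (F p)] `<=` O by move=> q [/sectors_O].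
split => //; last by move=> q [Dq eq]; exact: forward_sumS.
apply: smoothB => //; last exact: smooth_openS fg.1.
by apply: (smooth_pullback oO ff1 ff2 oU UO _ IH) => q [].
Qed.

(** The number of terms of the sum is unbounded near the boundary. The barrier,
    which decreases along orbits, still bounds all the sums and their
    derivatives at once; the power [M] is arbitrary because [g] is flat. *)
Lemma forward_sum_bound al k M : (a < al%:E)%E -> exists A K, 0 <= A /\
  forall n p, upper (sector al) p -> exits n p ->
    weighted_bound k (forward_sum n) p (barrier A K M p).
Proof.
move=> aal; have bO := boxO aal.
have [C C0 HC] : exists2 C, 0 <= C & forall J, (size J <= k)%N ->
    forall p, box al c2 (E al) p -> tame f1 f2 p ->
      p.2 ^+ vcount J * `|Dword J g p| <= C * p.2 ^+ M.+1.
  apply: uniform_words => [J C C' CC' H p bp tp|J].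
    by apply: le_trans (H p bp tp) _; rewrite ler_wpM2r// exprn_ge0// ltW; case: tp.
  have [C C0 H] := flat_smooth_bound M.+1 oO (flat_smooth_Dword J oO fg) bO.
  exists C => p bp [p0 p1 _ _]; apply: le_trans (H p bp).
  rewrite -[leRHS]mul1r ler_wpM2r//.
  by apply: exprn_ile1; [exact: ltW|lra].
have [L L0 HL] := pullback_bound oO ff1 ff2 k bO.
pose K := 2 * (L + M%:R + 1); pose A := 2 * C * expR (K * c2).
have A0 : 0 <= A by rewrite mulr_ge0 ?expR_ge0// mulr_ge0.
have bar0 p : 0 < p.2 -> 0 <= barrier A K M p.
  by move=> p0; rewrite mulr_ge0// mulr_ge0 ?expR_ge0// exprn_ge0// ltW.
exists A, K; split => //.
have zero n p : upper (sector al) p -> c1 < p.1 ->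
    weighted_bound k (forward_sum n) p (barrier A K M p).
  move=> [_ /= p0] cp J _.
  rewrite (Dword_eq (g := fun=> 0) J open_right _ cp); last first.
    by move=> q; exact: forward_sum_right.
  by rewrite Dword0 normr0 mulr0 bar0.
elim=> [|n IH] p up; first by move=> [_ [cp|//]]; exact: zero.
have [cp|pc] := ltP c1 p.1; first by move=> _; exact: zero.
move=> [Dp [|ep]]; first by rewrite ltNge pc.
have [Op tp] := sector_sub aal up; have [p0 _ _ _] := tp.
have uFp := sector_step aal up pc.
have oU := open_preimage open_sectors sectors_O (@open_exits n).
set U := [set p | _] in oU.
have UO : U `<=` O by move=> q [/sectors_O].
have UV q : U q -> exits n (F q) by case.
have Up : U p by [].
have sS := @forward_sum_smooth n.
have FB := HL _ _ _ _ _ oU UO UV sS Up (sector_box aal up) tp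
  (bar0 _ (tame_pos tp)) (IH _ uFp ep).
move=> J Jk.
have UE q : U q -> forward_sum n.+1 q = forward_sum n (F q) - g q.
  by move=> [Dq eq]; exact: forward_sumS.
rewrite (Dword_eq J oU UE Up) (Dword_sub J oU (smooth_pullback oO ff1 ff2 oU UO UV sS)
  (smooth_openS UO fg.1) Up).
have v0 : 0 <= p.2 ^+ vcount J by rewrite exprn_ge0// ltW.
apply: le_trans (ler_wpM2l v0 (ler_normB _ _)) _; rewrite mulrDr.
have h1 := FB J Jk.
have h2 := barrier_step (M := M) A0 L0 tp erefl; rewrite -/K -/F in h2.
have h3 := HC J Jk p (sector_box aal up) tp.
have h4 : C * p.2 ^+ M.+1 <= barrier A K M p * (2^-1 * p.2).
  rewrite /barrier /A (_ : _ * (2^-1 * p.2) =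
    C * p.2 ^+ M.+1 * (expR (K * c2) * expR (- K * p.1))); last first.
    by rewrite exprS; field.
  rewrite -[leLHS]mulr1 ler_wpM2l ?mulr_ge0 ?exprn_ge0//; first exact: ltW.
  rewrite -expRD; have [[_ pc2 _] _] := up.
  have K0 : 0 <= K by rewrite /K mulr_ge0// addr_ge0// addr_ge0.
  rewrite -[leLHS]expR0 ler_expR mulNr -mulrBr mulr_ge0// subr_ge0; exact: ltW.
lra.
Qed.

End Dynamics.

(** * The cohomological equation on the left *)

Section LeftSolution.
Context {R : realType}.
Implicit Types (a b : \bar R) (U V W O Z : set (R * R)) (f g h : R * R -> R)
  (p q z : R * R).

Lemma flat_near_pow O f p M : open O -> flat_smooth O f -> O p -> p.2 = 0 ->
  \forall q \near p, 0 < q.2 -> `|f q| <= q.2 ^+ M.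
Proof.
move=> oO ff Op p0.
have /nearP[r r0 Hr] : \forall q \near p, O q by exact: open_nbhs_nbhs.
have r2 : r / 2 < r by rewrite ltr_pdivrMr// ltr_pMr// ltr1n.
have bO : box (p.1 - r / 2) (p.1 + r / 2) (r / 2) `<=` O.
  move=> q [/andP[q1 q1'] /andP[q2 q2']]; apply: Hr; apply: le_lt_trans r2.
    by rewrite ler_distl q1 q1'.
  by rewrite p0 subr0 ger0_norm.
have [C C0 HC] := flat_smooth_bound M.+1 oO ff bO.
have C1 : 0 < C + 1 by lra.
apply/nearP; exists (Num.min (r / 2) (C + 1)^-1).
  by rewrite lt_min invr_gt0 C1 divr_gt0.
move=> q; rewrite !lt_min p0 subr0 => /andP[/ltW q1 _] /andP[/ltW q2 /ltW q2'] q0.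
have qb : box (p.1 - r / 2) (p.1 + r / 2) (r / 2) q.
  split; first by rewrite -ler_distl.
  by rewrite (ltW q0) -(gtr0_norm q0).
apply: le_trans (HC q qb) _; rewrite exprS mulrA.
rewrite -[leRHS]mul1r ler_wpM2r//; first by rewrite exprn_ge0// ltW.
rewrite gtr0_norm// in q2'.
apply: (@le_trans _ _ (C * (C + 1)^-1)); first by rewrite ler_wpM2l.
by rewrite ler_pdivrMr// mul1r lerDl.
Qed.

Lemma sector_near (E : R -> R) (c2 al : R) p : 0 < E al -> al < p.1 -> p.1 < c2 ->
  p.2 = 0 -> sector c2 E al p.
Proof.
by move=> E0 h1 h2 p0; split => //; rewrite p0 mul0r mulr_gt0// expR_gt0.
Qed.

(** The cohomological equation for a right-hand side supported on the left,
    solved by [- sum_n g o F^n]. *)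
Lemma coboundary_left a b O f1 f2 g (c1 : R) : (a < c1%:E)%E -> (c1%:E < b)%E ->
  open O -> boundary_interval a b `<=` O ->
  flat_smooth O f1 -> flat_smooth O f2 -> flat_smooth O g ->
  (forall p, O p -> c1 < p.1 -> g p = 0) ->
  exists Z u, let F := shear_map f1 f2 in
    [/\ open Z, boundary_interval a b `<=` Z, flat_smooth Z u &
      forall p, Z p -> Z (F p) -> u (F p) - u p = g p].
Proof.
move=> ac1 c1b oO JO ff1 ff2 fg g0.
have [c2 [c12 c2b]] := ereal_between c1b; rewrite lte_fin in c12.
pose P q := O q /\ (0 < q.2 -> tame f1 f2 q /\ q.2 <= (c2 - c1) / 2).
have HP p : boundary_interval a b p -> \forall q \near p, P q.
  move=> Jp; have Op := JO _ Jp; have p0 := boundary_snd Jp.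
  have n0 : \forall q \near p, O q by exact: open_nbhs_nbhs.
  have i2 : 0 < (2^-1 : R) by rewrite invr_gt0.
  have n1 := flat_near_bound oO ff1 Op p0 i2.
  have n2 := flat_near_pow 2 oO ff2 Op p0.
  have n3 : \forall q \near p, q.2 <= 2^-1 /\ q.2 <= (c2 - c1) / 2.
    apply/nearP; exists (Num.min 2^-1 ((c2 - c1) / 2)).
      by rewrite lt_min i2 divr_gt0// subr_gt0.
    move=> q _; rewrite p0 subr0 lt_min => /andP[/ltW h1 /ltW h2].
    by split; [apply: le_trans h1|apply: le_trans h2]; exact: ler_norm.
  apply: filterS2 (filterI n0 n1) (filterI n2 n3) => q [Oq q1] [q2 [q3 q4]].
  split=> // q0; split => //; exact: And4 q0 q3 (q1 q0) (q2 q0).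
have [X [[oX JX] XP strip _ _]] := boundary_shrink (lt_trans ac1 c1b) HP.
have XO : X `<=` O by move=> q /XP[].
have gf1 := flat_smoothS XO ff1; have gf2 := flat_smoothS XO ff2.
have gg := flat_smoothS XO fg.
have tameO p : X p -> 0 < p.2 -> tame f1 f2 p /\ p.2 <= (c2 - c1) / 2.
  by move=> /XP[].
have g0' p : X p -> c1 < p.1 -> g p = 0 by move=> /XO; exact: g0.
have /choice[E HE] : forall al : R, exists e : R, (a < al%:E)%E -> 0 < e /\
    forall p, al <= p.1 <= c2 -> `|p.2| <= e -> X p.
  move=> al; have [aal|nal] := pselect (a < al%:E)%E; last by exists 0.
  have nX p : boundary_interval a b p -> \forall q \near p, X q.
    by move=> /JX Op; exact: open_nbhs_nbhs.
  by have [e e0 He] := boundary_box aal c2b nX; exists e.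
have E0 al : (a < al%:E)%E -> 0 < E al by move=> /HE[].
have boxO al : (a < al%:E)%E -> box al c2 (E al) `<=` X.
  move=> aal q [q1 /andP[q2 q3]]; apply: (HE al aal).2 => //.
  by rewrite ger0_norm.
have exN := exits_ex tameO E0 boxO.
pose D := sectors a c2 E; pose ex := exits a f1 f2 c1 c2 E.
have /choice[N HN] : forall p, exists n, D p -> ex n p.
  move=> p; have [Dp|nDp] := pselect (D p); last by exists 0%N.
  by have [n en] := exN p Dp; exists n.
pose S := forward_sum f1 f2 g c1.
pose u p := if c1 < p.1 then 0 else S (N p) p.
have uE n p : ex n p -> u p = S n p.
  move=> en; rewrite /u /S; case: ifPn => cp; first by rewrite [RHS]forward_sum_right.
  have eN := HN p (exits_sectors en).
  have [_ <-] := exits_stable g en (leq_maxl n (N p)).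
  by have [_ <-] := exits_stable g eN (leq_maxr n (N p)).
pose Z := X `&` ([set p | c1 < p.1] `|`
  \bigcup_(al in [set al | (a < al%:E)%E]) sector c2 E al).
have oZ : open Z.
  apply: openI => //; apply: openU; first exact: open_right.
  by apply: bigcup_open => al _; exact: open_sector.
have JZ : boundary_interval a b `<=` Z.
  move=> p Jp; split; first exact: JX.
  have [cp|pc] := ltP c1 p.1; [by left|right].
  have [ap _] := Jp; have [al [aal alp]] := ereal_between ap.
  rewrite lte_fin in alp.
  exists al => //; apply: sector_near (E0 _ aal) alp _ (boundary_snd Jp).
  exact: le_lt_trans c12.
have Zup p : upper Z p -> c1 < p.1 \/ D p.
  by move=> [[_ [cp|[al aal sp]]] p0]; [left|right; exists al].
have su : smooth_open (upper Z) u.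
  apply: smooth_open_local => p /Zup[cp|Dp].
    exists [set p | c1 < p.1], (fun=> 0); split => //.
    - exact: open_right.
    - exact: smooth_cst.
    - by move=> q /= cq; rewrite /u cq.
  exists (ex (N p)), (S (N p)); split.
  - exact: (@open_exits _ a X f1 f2 c1 c2 oX gf1 gf2 tameO E E0 boxO).
  - exact: HN.
  - exact: (@forward_sum_smooth _ a _ f1 f2 g c1 c2 oX gf1 gf2 gg tameO g0' E E0 boxO).
  - by move=> q eq; exact: uE.
have vu w p : Z p -> p.2 = 0 -> vanishes_at (Dword w u) p.
  move=> [Xp Zp] p0 e e0.
  have [cp|pc] := ltP c1 p.1.
    have nc : \forall q \near p, c1 < q.1.
      by apply: open_nbhs_nbhs; split => //; exact: open_right.
    apply: filterS nc => q cq _.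
    rewrite (Dword_eq (g := fun=> 0) w (@open_right _ c1) _ cq).
      by rewrite Dword0 normr0 ltW.
    by move=> r /= cr; rewrite /u cr.
  case: Zp => [|[al aal sp]]; first by rewrite /= ltNge pc.
  have [A [K [A0 HB]]] := forward_sum_bound oX gf1 gf2 gg tameO g0' E0 boxO
    (size w) (size w).+1 aal.
  have ns : \forall q \near p, sector c2 E al q.
    by apply: open_nbhs_nbhs; split => //; exact: open_sector.
  pose B := A * Num.max (expR (- K * al)) (expR (- K * c2)) + 1.
  have B0 : 0 < B.
    by rewrite /B ltr_wpDl// mulr_ge0// le_max expR_ge0.
  have ne : \forall q \near p, q.2 <= 2^-1 /\ q.2 <= e / B.
    apply/nearP; exists (Num.min 2^-1 (e / B)).
      by rewrite lt_min invr_gt0// divr_gt0// andbT.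
    move=> q _; rewrite p0 subr0 lt_min => /andP[/ltW h1 /ltW h2].
    by split; [apply: le_trans h1|apply: le_trans h2]; exact: ler_norm.
  apply: filterS2 ns ne => q sq [q2 qe] q0.
  have upq : upper (sector c2 E al) q by [].
  have Dq : D q by exists al.
  have exq := HN q Dq.
  have oex := @open_exits _ a X f1 f2 c1 c2 oX gf1 gf2 tameO E E0 boxO (N q).
  rewrite (Dword_eq (g := S (N q)) w oex _ exq); last by move=> r er; exact: uE.
  have := HB (N q) q upq exq w (leqnn _).
  set d := `|_| => Hd.
  have v0 : 0 < q.2 ^+ size w by rewrite exprn_gt0.
  have q1 : q.2 <= 1 by lra.
  rewrite -(ler_pM2l v0).
  apply: (@le_trans _ _ (q.2 ^+ vcount w * d)).
    rewrite ler_wpM2r//; first exact: normr_ge0.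
    by rewrite ler_wiXn2l ?vcount_size// ltW.
  apply: le_trans Hd _; rewrite /barrier exprSr mulrA mulrCA -mulrA ler_pM2l//.
  have [[q3 q4 _] _] := upq.
  apply: (@le_trans _ _ (q.2 * B)); last by rewrite -ler_pdivlMr.
  rewrite -mulrA mulrCA ler_pM2l// /B.
  apply: (@le_trans _ _ (A * Num.max (expR (- K * al)) (expR (- K * c2)))).
    rewrite ler_wpM2l// le_max !ler_expR.
    have [K0|K0] := leP 0 K.
      by rewrite !mulNr !lerN2 (ler_wpM2l K0)// ltW.
    by apply/orP; right; rewrite ler_pM2l ?oppr_gt0// ltW.
  by rewrite lerDl.
have fu := glue_zero oZ su vu.
exists Z, (ext0 u); split => // p Zp ZFp.
have Xp := proj1 Zp.
have [p0|p0] := leP p.2 0.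
  have F0 : (shear_map f1 f2 p).2 <= 0 by rewrite /= gf2.2// addr0.
  by rewrite (fu.2 _ ZFp F0) (fu.2 _ Zp p0) gg.2// subr0.
have [tp _] := tameO p Xp p0.
have F0 := tame_pos tp.
rewrite /ext0 p0 F0.
have [cp|pc] := ltP c1 p.1.
  have h := tame_shift tp.
  have cF : c1 < (shear_map f1 f2 p).1 by lra.
  by rewrite /u cp cF g0'// subr0.
have Dp : D p by case: (Zup p (conj Zp p0)) => //; rewrite ltNge pc.
have DF : D (shear_map f1 f2 p) by exact: (sectors_step tameO E0 boxO Dp pc).
have eF := HN _ DF.
have ep : ex (N (shear_map f1 f2 p)).+1 p by apply/exitsS; split => //; right.
rewrite (uE _ _ eF) (uE _ _ ep) /S.
have := forward_sumS tameO g0' E0 boxO Dp eF.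
by move=> ->; ring.
Qed.

End LeftSolution.

(** * Flat oscillating functions *)

Section Oscillation.
Context {R : realType}.
Implicit Types (f g : R * R -> R) (p q : R * R) (w : seq bool).

Notation half := (upper [set: R * R]).

Lemma open_half : open half.
Proof. by apply: open_upper; exact: openT. Qed.

Definition flat_exp p : R := expR (- p.2^-1).
Definition turns p : R := 2 * pi * (p.1 * p.2^-1).

(** The algebra that the derivatives of [sin (2 pi tau / phi)] live in. *)
Inductive oscillatory : (R * R -> R) -> Prop :=
| osc_cst c : oscillatory (fun=> c)
| osc_fst : oscillatory fst
| osc_inv : oscillatory (fun p => p.2^-1)
| osc_sin : oscillatory (fun p => sin (turns p))
| osc_cos : oscillatory (fun p => cos (turns p))
| osc_add f g : oscillatory f -> oscillatory g -> oscillatory (fun p => f p + g p)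
| osc_mul f g : oscillatory f -> oscillatory g -> oscillatory (fun p => f p * g p).

Lemma half_neq0 p : half p -> p.2 != 0.
Proof. by move=> [_ /= p0]; rewrite gt_eqF. Qed.

Lemma smooth_inv : smooth_open half (fun p : R * R => p.2^-1).
Proof.
apply: smoothV; [exact: open_half|exact: half_neq0|exact: smooth_snd].
Qed.

Lemma smooth_turns : smooth_open half turns.
Proof.
apply: smoothZ; first exact: open_half.
by apply: smoothM; [exact: open_half|exact: smooth_fst|exact: smooth_inv].
Qed.

Lemma smooth_flat_exp : smooth_open half flat_exp.
Proof.
apply: smooth_expR; first exact: open_half.
by apply: smoothN; [exact: open_half|exact: smooth_inv].
Qed.

Lemma oscillatory_smooth f : oscillatory f -> smooth_open half f.
Proof.
elim=> {f} [c|||||f g _ IHf _ IHg|f g _ IHf _ IHg].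
- exact: smooth_cst.
- exact: smooth_fst.
- exact: smooth_inv.
- by apply: smooth_sin; [exact: open_half|exact: smooth_turns].
- by apply: smooth_cos; [exact: open_half|exact: smooth_turns].
- by apply: smoothD => //; exact: open_half.
- by apply: smoothM => //; exact: open_half.
Qed.

Lemma derive_inv b p : half p ->
  'D_(edir b) (fun p : R * R => p.2^-1) p = - b%:R * (p.2^-1 * p.2^-1).
Proof.
move=> hp; rewrite deriveV ?half_neq0//; last first.
  apply: diff_derivable.
  exact: differentiable_snd.
rewrite derive_snd (_ : (edir b).2 = b%:R); last by case: b.
rewrite -[_ *: _]/(_ * _) mulrC mulNr mulrN.
by rewrite -exprVn expr2.
Qed.

Lemma derive_turns b p : half p ->
  'D_(edir b) turns p =
    2 * pi * ((~~ b)%:R * p.2^-1 - b%:R * (p.1 * (p.2^-1 * p.2^-1))).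
Proof.
move=> hp; have d1 := differentiable_fst p.
have d2 := smooth_differentiable smooth_inv hp.
have d12 : differentiable (fun q : R * R => q.1 * q.2^-1) p.
  exact: differentiableM.
have dc : differentiable (fun _ : R * R => 2 * pi : R) p by exact: differentiable_cst.
rewrite /turns derive_mul// (derive_cst (2 * pi : R)) mulr0 addr0.
rewrite derive_mul// derive_fst derive_inv//; congr (_ * _).
by case: b => /=; ring.
Qed.

Lemma derive_sin_turns b p : half p ->
  'D_(edir b) (fun p => sin (turns p)) p = cos (turns p) * 'D_(edir b) turns p.
Proof.
move=> hp; rewrite (derive_comp1 (h := sin)) ?derive_val//.
exact: smooth_differentiable smooth_turns hp.
Qed.

Lemma derive_cos_turns b p : half p ->
  'D_(edir b) (fun p => cos (turns p)) p = - sin (turns p) * 'D_(edir b) turns p.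
Proof.
move=> hp; rewrite (derive_comp1 (h := cos)) ?derive_val//.
exact: smooth_differentiable smooth_turns hp.
Qed.

Lemma derive_flat_exp b p : half p ->
  'D_(edir b) flat_exp p = flat_exp p * (b%:R * (p.2^-1 * p.2^-1)).
Proof.
move=> hp; have d2 := smooth_differentiable smooth_inv hp.
have dn : differentiable (fun q : R * R => - q.2^-1) p by exact: differentiableN.
rewrite (derive_comp1 (h := expR)); [|exact: dn|exact: derivable_expR].
rewrite derive_val; congr (_ * _).
rewrite -[fun q => _]/(- (fun q : R * R => q.2^-1)) deriveN; last exact: diff_derivable.
by rewrite derive_inv// mulNr opprK.
Qed.

Lemma osc_turns_derive b : exists2 g, oscillatory g &
  forall p, half p -> 'D_(edir b) turns p = g p.
Proof.
exists (fun p => 2 * pi * ((~~ b)%:R * p.2^-1 + (- b%:R) * (p.1 * (p.2^-1 * p.2^-1)))).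
  apply: osc_mul; first exact: osc_cst.
  apply: osc_add; apply: osc_mul; try exact: osc_cst; try exact: osc_inv.
  by apply: osc_mul; [exact: osc_fst|apply: osc_mul; exact: osc_inv].
by move=> p hp; rewrite derive_turns// mulNr.
Qed.

Lemma oscillatory_derive f b : oscillatory f -> exists2 g, oscillatory g &
  forall p, half p -> 'D_(edir b) f p = g p.
Proof.
elim=> {f} [c|||||f g of_ [f' of' Ef] og [g' og' Eg]|f g of_ [f' of' Ef] og [g' og' Eg]].
- by exists (fun=> 0); [exact: osc_cst|move=> p _; rewrite (derive_cst (c : R))].
- exists (fun=> (~~ b)%:R); first exact: osc_cst.
  by move=> p _; rewrite derive_fst; case: b.
- exists (fun p => - b%:R * (p.2^-1 * p.2^-1)); last exact: derive_inv.
  by apply: osc_mul; [exact: osc_cst|apply: osc_mul; exact: osc_inv].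
- have [g og Eg] := osc_turns_derive b.
  exists (fun p => cos (turns p) * g p); first by apply: osc_mul => //; exact: osc_cos.
  by move=> p hp; rewrite derive_sin_turns// Eg.
- have [g og Eg] := osc_turns_derive b.
  exists (fun p => (-1 * sin (turns p)) * g p).
    apply: osc_mul => //; apply: osc_mul; [exact: osc_cst|exact: osc_sin].
  by move=> p hp; rewrite derive_cos_turns// Eg// mulN1r.
- exists (fun p => f' p + g' p); first exact: osc_add.
  move=> p hp; rewrite -(Ef p hp) -(Eg p hp).
  rewrite -[fun p => _]/(f + g) deriveD//; apply: diff_derivable.
    exact: smooth_differentiable (oscillatory_smooth of_) hp.
  exact: smooth_differentiable (oscillatory_smooth og) hp.
- exists (fun p => f p * g' p + g p * f' p).
    by apply: osc_add; apply: osc_mul.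
  move=> p hp; rewrite -(Ef p hp) -(Eg p hp) derive_mul//.
    exact: smooth_differentiable (oscillatory_smooth of_) hp.
  exact: smooth_differentiable (oscillatory_smooth og) hp.
Qed.

Lemma oscillatory_bound f p : oscillatory f -> exists C m,
  0 <= C /\ forall q, `|q.1 - p.1| < 1 -> 0 < q.2 -> q.2 < 1 ->
    `|f q| <= C * (q.2^-1) ^+ m.
Proof.
have inv1 (y : R) : 0 < y -> y < 1 -> 1 <= y^-1.
  by move=> y0 y1; rewrite -[leLHS]invr1 lef_pV2 ?posrE// ltW.
elim=> {f} [c|||||f g _ [C [m [C0 HC]]] _ [C' [m' [C0' HC']]]
  |f g _ [C [m [C0 HC]]] _ [C' [m' [C0' HC']]]].
- by exists `|c|, 0%N; split => // q *; rewrite expr0 mulr1.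
- exists (`|p.1| + 1), 0%N; split=> [|q q1 _ _]; first by rewrite addr_ge0.
  rewrite expr0 mulr1 -[q.1](subrK p.1) addrC.
  by rewrite (le_trans (ler_normD _ _))// lerD2l ltW.
- exists 1, 1%N; split => // q _ q0 q1.
  by rewrite mul1r expr1 ger0_norm// invr_ge0 ltW.
- exists 1, 0%N; split => // q _ q0 q1.
  by rewrite expr0 mulr1 ler_norml sin_geN1 sin_le1.
- exists 1, 0%N; split => // q _ q0 q1.
  by rewrite expr0 mulr1 ler_norml cos_geN1 cos_le1.
- exists (C + C'), (m + m')%N; split=> [|q q1 q0 ql]; first exact: addr_ge0.
  rewrite (le_trans (ler_normD _ _))// mulrDl; apply: lerD.
    rewrite (le_trans (HC q q1 q0 ql))// ler_wpM2l// ler_weXn2l ?inv1//.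
    exact: leq_addr.
  rewrite (le_trans (HC' q q1 q0 ql))// ler_wpM2l// ler_weXn2l ?inv1//.
  exact: leq_addl.
- exists (C * C'), (m + m')%N; split=> [|q q1 q0 ql]; first exact: mulr_ge0.
  rewrite normrM exprD mulrACA ler_pM//; [exact: HC|exact: HC'].
Qed.

Lemma flat_exp_bound (y : R) m : 0 < y ->
  expR (- y^-1) * (y^-1) ^+ m <= m.+1`!%:R * y.
Proof.
move=> y0; have yi : 0 < y^-1 by rewrite invr_gt0.
have F0 : 0 < (m.+1`!%:R : R) by rewrite ltr0n fact_gt0.
rewrite expRN mulrC ler_pdivrMr ?expR_gt0//.
have := expR_ge1Dxn m (ltW yi).
rewrite -(ler_pM2l (mulr_gt0 F0 y0)) => h; apply: le_trans h.
rewrite mulrDr exprS mulr1.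
rewrite [X in _ <= _ + X](_ : _ = y^-1 ^+ m); first by rewrite lerDr mulr_ge0// ltW.
by field; rewrite !gt_eqF.
Qed.

(** Functions in this algebra grow at most like a power of [1 / phi]. *)
Lemma flat_exp_vanishes f p : oscillatory f -> p.2 = 0 ->
  vanishes_at (fun q => flat_exp q * f q) p.
Proof.
move=> of_ p0 e e0; have [C [m [C0 HC]]] := oscillatory_bound p of_.
have K0 : 0 < C * m.+1`!%:R + 1 by rewrite ltr_wpDl// mulr_ge0.
apply/nearP; exists (Num.min 1 (e / (C * m.+1`!%:R + 1))).
  by rewrite lt_min ltr01 divr_gt0.
move=> q; rewrite !lt_min p0 subr0 => /andP[q1 _] /andP[q2 qe] q0.
rewrite gtr0_norm// in q2 qe.
rewrite normrM gtr0_norm ?expR_gt0//.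
apply: (@le_trans _ _ (C * (m.+1`!%:R * q.2))).
  apply: (@le_trans _ _ (flat_exp q * (C * q.2^-1 ^+ m))).
    by rewrite ler_wpM2l ?expR_ge0// HC.
  by rewrite mulrCA ler_wpM2l// flat_exp_bound.
rewrite mulrA; apply: (@le_trans _ _ ((C * m.+1`!%:R + 1) * q.2)).
  by rewrite ler_wpM2r ?lerDl// ltW.
by rewrite mulrC -ler_pdivlMr// ltW.
Qed.

Lemma flat_exp_osc_flat f : oscillatory f ->
  flat_smooth [set: R * R] (ext0 (fun q => flat_exp q * f q)).
Proof.
move=> of_; apply: glue_zero; first exact: openT.
  by apply: smoothM; [exact: open_half|exact: smooth_flat_exp|exact: oscillatory_smooth].
move=> w p _ p0.
have [g og Eg] : exists2 g, oscillatory g &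
    forall q, half q -> Dword w (fun q => flat_exp q * f q) q = flat_exp q * g q.
  elim: w => [|b w [g og Eg]]; first by exists f.
  have [g' og' Eg'] := oscillatory_derive b og.
  exists (fun q => g' q + b%:R * (q.2^-1 * q.2^-1) * g q).
    apply: osc_add => //; apply: osc_mul => //.
    by apply: osc_mul; [exact: osc_cst|apply: osc_mul; exact: osc_inv].
  move=> q hq; refine (etrans (eq_derive (edir b) open_half Eg hq) _).
  rewrite derive_mul; last 2 first.
  - exact: smooth_differentiable smooth_flat_exp hq.
  - exact: smooth_differentiable (oscillatory_smooth og) hq.
  by rewrite derive_flat_exp// Eg'//; ring.
move=> e e0; have := flat_exp_vanishes og p0 e0.
by apply: filterS => q Hq q0; rewrite Eg//; exact: Hq.
Qed.

Definition osc (j : nat) : R * R -> R :=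
  ext0 (fun q => flat_exp q * sin (turns q) ^+ j).

Lemma oscillatoryX f n : oscillatory f -> oscillatory (fun p => f p ^+ n).
Proof.
move=> of_; elim: n => [|n IH].
  have -> : (fun p => f p ^+ 0) = (fun=> 1) by apply/funext => p; rewrite expr0.
  exact: osc_cst.
have -> : (fun p => f p ^+ n.+1) = (fun p => f p * f p ^+ n).
  by apply/funext => p; rewrite exprS.
exact: osc_mul.
Qed.

Lemma osc_flat j : flat_smooth [set: R * R] (osc j).
Proof. by apply: flat_exp_osc_flat; apply: oscillatoryX; exact: osc_sin. Qed.

(** The quotient [A / (A + B)] for the flat functions [A] and [B] of the
    distances to [c1] and [c0]. *)
Lemma smooth_cutoff (c0 c1 : R) : c0 < c1 -> exists rho : R * R -> R,
  [/\ smooth_open [set: R * R] rho, forall p, p.1 <= c0 -> rho p = 1 &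
      forall p, c1 <= p.1 -> rho p = 0].
Proof.
move=> c01; have oT : open [set: R * R] by exact: openT.
pose A p := osc 0 (0, c1 - p.1); pose B p := osc 0 (0, p.1 - c0).
have osc0E y : osc 0 (0, y) = if 0 < y then expR (- y^-1) else 0.
  by rewrite /osc /ext0 /= expr0 mulr1.
have sA : smooth_open setT A.
  apply: (@smooth_comp2 _ _ _ setT (fun=> 0) (fun p => c1 - p.1)) => //.
  - exact: smooth_cst.
  - by apply: smoothB => //; [exact: smooth_cst|exact: smooth_fst].
  - exact: (osc_flat 0).1.
have sB : smooth_open setT B.
  apply: (@smooth_comp2 _ _ _ setT (fun=> 0) (fun p => p.1 - c0)) => //.
  - exact: smooth_cst.
  - by apply: smoothB => //; [exact: smooth_fst|exact: smooth_cst].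
  - exact: (osc_flat 0).1.
have osc_ge0 y : 0 <= osc 0 (0, y) by rewrite osc0E; case: ifP => // _; exact: expR_ge0.
have osc_gt0 y : 0 < y -> 0 < osc 0 (0, y) by move=> y0; rewrite osc0E y0 expR_gt0.
have osc_eq0 y : y <= 0 -> osc 0 (0, y) = 0 by move=> y0; rewrite osc0E ltNge y0.
have AB0 p : A p + B p != 0.
  rewrite gt_eqF//; have [h|h] := ltP p.1 c1.
    by rewrite ltr_pwDl ?osc_ge0// osc_gt0// subr_gt0.
  by rewrite ltr_wpDl ?osc_ge0// osc_gt0// subr_gt0 (lt_le_trans c01).
exists (fun p => A p / (A p + B p)); split.
- apply: smoothM => //; apply: smoothV => //; exact: smoothD.
- move=> p pc; have B0 : B p = 0 by apply: osc_eq0; rewrite subr_le0.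
  by have := AB0 p; rewrite B0 addr0 => A0; rewrite divff.
- by move=> p pc; rewrite /A osc_eq0 ?mul0r// subr_le0.
Qed.

End Oscillation.

(** * The cohomological equation *)

Section Cohomology.
Context {R : realType}.
Implicit Types (a b : \bar R) (U V W O Z : set (R * R)) (f g h m : R * R -> R)
  (p q z : R * R).

Lemma open_smooth_preimage U V m1 m2 : open U -> smooth_open U m1 ->
  smooth_open U m2 -> open V -> open [set p | U p /\ V (m1 p, m2 p)].
Proof.
move=> oU s1 s2 oV; rewrite openE => p [Up Vp].
have d1 := smooth_differentiable s1 Up; have d2 := smooth_differentiable s2 Up.
have cm : {for p, continuous (fun q => (m1 q, m2 q))}.
  exact: differentiable_continuous (differentiable_pair d1 d2).
have nV : \forall q \near p, V (m1 q, m2 q) by apply: cm; exact: open_nbhs_nbhs.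
have nU : \forall q \near p, U q by exact: open_nbhs_nbhs.
by apply: filterS2 nU nV => q; exact: conj.
Qed.

Lemma flat_smooth_comp U V m1 m2 f : open U -> smooth_open U m1 ->
  smooth_open U m2 -> (forall p, U p -> V (m1 p, m2 p)) ->
  (forall p, U p -> p.2 <= 0 -> m2 p <= 0) ->
  flat_smooth V f -> flat_smooth U (fun p => f (m1 p, m2 p)).
Proof.
move=> oU s1 s2 UV neg [sf f0]; split; first exact: (smooth_comp2 oU UV s1 s2 sf).
by move=> p Up p0; apply: f0; [exact: UV|exact: neg].
Qed.

Definition mirror p : R * R := (- p.1, p.2).

Lemma mirror_boundary a b p : boundary_interval (- b)%E (- a)%E p ->
  boundary_interval a b (mirror p).
Proof.
move=> [h1 [h2 h3]]; split; [|split] => //=.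
  by rewrite EFinN lteNr.
by rewrite EFinN lteNl.
Qed.

Lemma mirror_boundaryN a b p : boundary_interval a b p ->
  boundary_interval (- b)%E (- a)%E (mirror p).
Proof.
move=> [h1 [h2 h3]]; split; [|split] => //=; by rewrite EFinN lteN2.
Qed.

(** The reflection of [tau] conjugates the inverse of the map to a map of the
    same form, and exchanges left and right. *)
Lemma coboundary_right a b O f1 f2 g (c0 : R) : (a < c0%:E)%E -> (c0%:E < b)%E ->
  open O -> boundary_interval a b `<=` O ->
  flat_smooth O f1 -> flat_smooth O f2 -> flat_smooth O g ->
  (forall p, O p -> p.1 < c0 -> g p = 0) ->
  exists Z u, let F := shear_map f1 f2 in
    [/\ open Z, boundary_interval a b `<=` Z, flat_smooth Z u &
      forall p, Z p -> Z (F p) -> u (F p) - u p = g p].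
Proof.
move=> ac cb oO JO ff1 ff2 fg g0; have oT : open [set: R * R] by exact: openT.
pose h1 p := f1 p - f2 p.
have fh1 : flat_smooth O h1 by exact: flat_smoothB.
have [Y [K1 [K2 [[oY JY YO _] [oHY KH] fk1 fk2]]]] :=
  flat_inverse (lt_trans ac cb) oO JO fh1 ff2.
pose H := perturb h1 f2; pose HY := H @` Y.
have lowY p : Y p -> p.2 <= 0 -> H p = p.
  by move=> /YO Op; exact: perturb_lower fh1 ff2 Op.
pose m1 p : R := - p.1 - p.2.
have sm1 U : smooth_open U m1.
  apply: (@smooth_openS _ _ _ setT) => //; apply: smoothB => //; last exact: smooth_snd.
  by apply: smoothN => //; exact: smooth_fst.
pose X0 : set (R * R) := [set p | [set: R * R] p /\ HY (m1 p, p.2)].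
have oX0 : open X0 by apply: open_smooth_preimage => //; exact: smooth_snd.
have JX0 : boundary_interval (- b)%E (- a)%E `<=` X0.
  move=> p Jp; split => //; exists (mirror p); first exact/JY/mirror_boundary.
  rewrite lowY ?(boundary_snd Jp)//; first by rewrite /mirror /m1 (boundary_snd Jp) subr0.
    exact/JY/mirror_boundary.
  by rewrite /= (boundary_snd Jp).
have X0HY p : X0 p -> HY (m1 p, p.2) by case.
pose k1 q := K1 q - q.1; pose k2 q := K2 q - q.2.
pose e1' p := - k1 (m1 p, p.2); pose e2' p := k2 (m1 p, p.2).
have fe1 : flat_smooth X0 e1'.
  apply: flat_smoothN => //; apply: (flat_smooth_comp oX0 (sm1 _) _ X0HY _ fk1) => //.
  exact: smooth_snd.
have fe2 : flat_smooth X0 e2'.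
  by apply: (flat_smooth_comp oX0 (sm1 _) _ X0HY _ fk2) => //; exact: smooth_snd.
pose P p := X0 p /\ (0 < p.2 -> `|e1' p| <= 1 * p.2).
have HP p : boundary_interval (- b)%E (- a)%E p -> \forall q \near p, P q.
  move=> Jp; have n0 : \forall q \near p, X0 q.
    by apply: open_nbhs_nbhs; split => //; exact: JX0.
  have n1 := flat_near_bound oX0 fe1 (JX0 _ Jp) (boundary_snd Jp) ltr01.
  by apply: filterS2 n0 n1 => q; exact: conj.
have ba : (- b < - a)%E by rewrite lteN2; exact: lt_trans ac cb.
have [X [[oX JX] XP _ _ _]] := boundary_shrink ba HP.
have XX0 : X `<=` X0 by move=> p /XP[].
have KHq q : HY q -> [/\ Y (K1 q, K2 q), H (K1 q, K2 q) = q &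
    q.2 <= 0 -> K1 q = q.1 /\ K2 q = q.2].
  move=> [p Yp <-]; have [E1 E2] := KH p Yp; rewrite E1 E2 -surjective_pairing.
  split => // Hp0.
  have /eqP : k2 (H p) = 0 by apply: fk2.2 => //; exists p.
  have /eqP : k1 (H p) = 0 by apply: fk1.2 => //; exists p.
  by rewrite /k1 /k2 !subr_eq0 E1 E2 => /eqP-> /eqP->.
have sK1 : smooth_open HY K1.
  apply: (@eq_smooth _ _ _ _ (fun q => k1 q + q.1)) => //.
    by move=> q _; rewrite /k1 subrK.
  by apply: smoothD => //; [exact: fk1.1|exact: smooth_fst].
have sK2 : smooth_open HY K2.
  apply: (@eq_smooth _ _ _ _ (fun q => k2 q + q.2)) => //.
    by move=> q _; rewrite /k2 subrK.
  by apply: smoothD => //; [exact: fk2.1|exact: smooth_snd].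
pose gK q := g (K1 q, K2 q).
have fgK : flat_smooth HY gK.
  apply: flat_smooth_comp fg => //.
    by move=> q /KHq[/YO].
  by move=> q /KHq[_ _ HK] q0; have [_ ->] := HK q0.
pose g' p := - gK (m1 p, p.2).
have fg' : flat_smooth X0 g'.
  apply: flat_smoothN => //; apply: (flat_smooth_comp oX0 (sm1 _) _ X0HY _ fgK) => //.
  exact: smooth_snd.
have g'0 p : X p -> - c0 < p.1 -> g' p = 0.
  move=> Xp cp; have [p0|p0] := leP p.2 0; first exact: fg'.2 (XX0 _ Xp) p0.
  have [YK _ _] := KHq _ (X0HY _ (XX0 _ Xp)).
  rewrite /g' /gK g0 ?oppr0//; first exact: YO.
  have [_ /(_ p0)] := XP _ Xp; rewrite /e1' /k1 /= ler_norml mul1r => /andP[h _].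
  by move: h; rewrite /m1; lra.
have bc : (- b < (- c0)%:E)%E by rewrite EFinN lteN2.
have ca : ((- c0)%:E < - a)%E by rewrite EFinN lteN2.
have [Z' [u' [oZ' JZ' fu' EQ]]] := coboundary_left bc ca oX JX
  (flat_smoothS XX0 fe1) (flat_smoothS XX0 fe2) (flat_smoothS XX0 fg') g'0.
have sm U : smooth_open U (fun p : R * R => - p.1).
  by apply: (@smooth_openS _ _ _ setT) => //; apply: smoothN => //; exact: smooth_fst.
pose Z := [set p | Y p /\ Z' (mirror p)].
have oZ : open Z by apply: open_smooth_preimage => //; exact: smooth_snd.
exists Z, (fun p => u' (mirror p)); split => //.
- by move=> p Jp; split; [exact: JY|exact/JZ'/mirror_boundaryN].
- apply: (flat_smooth_comp oZ (sm _) _ _ _ fu') => //; first exact: smooth_snd.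
  by move=> p [].
move=> p [Yp Zp] [_ ZFp].
have [E1 E2] := KH p Yp.
have HE : (m1 (mirror (shear_map f1 f2 p)), (shear_map f1 f2 p).2) = H p.
  by rewrite /m1 /H /perturb /h1 /=; congr (_, _); ring.
have FE : shear_map e1' e2' (mirror (shear_map f1 f2 p)) = mirror p.
  rewrite {1}/shear_map /e1' /e2' HE /k1 /k2 -/H E1 E2 /H /perturb /h1 /mirror /=.
  by congr (_, _); ring.
have := EQ _ ZFp; rewrite FE => /(_ Zp); rewrite /g' HE /gK E1 E2 -surjective_pairing.
by move=> h; rewrite -[g p]opprK -h; ring.
Qed.

(** A cutoff function splits the right-hand side into a part supported on the
    left and one supported on the right, whose solutions are added. *)
Theorem coboundary a b O f1 f2 g : (a < b)%E ->
  open O -> boundary_interval a b `<=` O ->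
  flat_smooth O f1 -> flat_smooth O f2 -> flat_smooth O g ->
  exists Z u, let F := shear_map f1 f2 in
    [/\ open Z, boundary_interval a b `<=` Z, flat_smooth Z u &
      forall p, Z p -> Z (F p) -> u (F p) - u p = g p].
Proof.
move=> ab oO JO ff1 ff2 fg.
have [c0 [ac0 c0b]] := ereal_between ab.
have [c1 [c01 c1b]] := ereal_between c0b.
have ac1 := lt_trans ac0 c01; rewrite lte_fin in c01.
have [rho [srho rho1 rho0]] := smooth_cutoff c01.
have sr : smooth_open O rho by apply: smooth_openS srho.
have fgl : flat_smooth O (fun p => rho p * g p) by exact: flat_smoothM.
have fgr : flat_smooth O (fun p => (1 - rho p) * g p).
  by apply: flat_smoothM => //; apply: smoothB => //; exact: smooth_cst.
have [|Zl [ul [oZl JZl ful El]]] := coboundary_left ac1 c1b oO JO ff1 ff2 fgl.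
  by move=> p _ /ltW cp; rewrite rho0// mul0r.
have [|Zr [ur [oZr JZr fur Er]]] := coboundary_right ac0 c0b oO JO ff1 ff2 fgr.
  by move=> p _ /ltW cp; rewrite rho1// subrr mul0r.
have oZ : open (Zl `&` Zr) by exact: openI.
exists (Zl `&` Zr), (fun p => ul p + ur p); split => //.
- by move=> p Jp; split; [exact: JZl|exact: JZr].
- apply: flat_smoothD => //.
    by apply: flat_smoothS ful => p [].
  by apply: flat_smoothS fur => p [].
move=> p [Zlp Zrp] [ZlF ZrF].
by rewrite opprD addrACA El// Er//; ring.
Qed.

End Cohomology.

(** * Invariant functions and normal coordinates *)

Section NormalForm.
Context {R : realType}.
Implicit Types (a b : \bar R) (U V W O Z : set (R * R)) (f g h : R * R -> R)
  (p q z : R * R) (F : R * R -> R * R).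

Lemma dphi_rightE f p : differentiable f p -> dphi_right f p = 'D_e2 f p.
Proof.
case: p => x y df; rewrite /dphi_right /=.
have [dv <-] := derive_vert df; apply: cvg_lim => //.
have {}dv : (fun h : R => h^-1 *: (((fun t => f (x, t)) \o shift y) (h *: 1) - f (x, y)))
    @ 0^' --> 'D_1 (fun t => f (x, t)) y by exact: dv.
have := cvg_dnbhs_at_right dv; apply: cvg_trans; apply: near_eq_cvg.
apply: nearW => h /=; rewrite -[h *: 1]/(h * 1) mulr1 [h + y]addrC.
by [].
Qed.

Lemma derive_add_snd u p : differentiable u p ->
  'D_e2 (fun q : R * R => q.2 + u q) p = 1 + 'D_e2 u p.
Proof.
move=> du; have d2 := differentiable_snd p.
rewrite -[fun q => _]/((snd : R * R -> R) + u) deriveD; try exact: diff_derivable.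
by rewrite derive_snd.
Qed.

Lemma shear_of_flat a b V F : domain_adjacent a b V ->
  flat a b V (fun p => (F p).1 - (p.1 + p.2)) ->
  flat a b V (fun p => (F p).2 - p.2) ->
  exists f1 f2, [/\ flat_smooth (collar a b V) f1, flat_smooth (collar a b V) f2 &
    forall p, with_boundary a b V p -> F p = shear_map f1 f2 p].
Proof.
move=> adj F1 F2.
exists (ext0 (fun p => (F p).1 - (p.1 + p.2))), (ext0 (fun p => (F p).2 - p.2)).
split; [exact: flat_ext0|exact: flat_ext0|].
move=> p [Vp|Jp]; rewrite /shear_map /ext0.
  by rewrite (adjacent_above adj Vp) [p.1 + _ + _]addrC [p.2 + _]addrC !subrK -surjective_pairing.
have p0 := boundary_snd Jp; rewrite p0 ltxx !addr0.
have [_ /(_ p Jp) E1 _] := F1; have [_ /(_ p Jp) E2 _] := F2.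
move/eqP: E1 E2; rewrite subr_eq0 => /eqP E1 /eqP; rewrite subr_eq0 => /eqP E2.
by rewrite -[p.1]addr0 -{1}p0 -E1 -p0 -E2 -surjective_pairing.
Qed.

Lemma with_boundary_upper a b O : boundary_interval a b `<=` O ->
  with_boundary a b (upper O) `<=` O.
Proof. by move=> JO p [[]//|/JO]. Qed.

Lemma upper_collar_sub a b V O : domain_adjacent a b V -> O `<=` collar a b V ->
  upper O `<=` V.
Proof. by move=> adj OV p [/OV Vp p0]; apply/(upper_collar p adj). Qed.

Lemma first_integral_of_flat a b O F u : open O -> boundary_interval a b `<=` O ->
  domain_adjacent a b (upper O) -> flat_smooth O u ->
  (forall p, O p -> -1 < 'D_e2 u p) ->
  invariant_on (with_boundary a b (upper O)) F (fun p => p.2 + u p) ->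
  flat_first_integral a b (upper O) F (fun p => p.2 + u p).
Proof.
move=> oO JO adj fu du inv; have sub := with_boundary_upper JO.
split => //.
- move=> p /sub Op; exists O, (fun p => p.2 + u p); split => //.
  by apply: smoothD => //; [exact: smooth_snd|exact: fu.1].
- apply: (flat_of_flat_smooth adj oO sub fu) => p _.
  by rewrite addrC addKr.
- move=> p /sub Op; have d := smooth_differentiable fu.1 Op.
  rewrite dphi_rightE; last first.
    apply: differentiableD => //.
    exact: differentiable_snd.
  by rewrite derive_add_snd// -ltrBlDl sub0r du.
Qed.

Lemma near_derive_small O u p : open O -> flat_smooth O u -> O p -> p.2 = 0 ->
  forall e : R, 0 < e -> \forall q \near p, `|'D_e2 u q| <= e.
Proof.
move=> oO fu Op p0; exact: flat_near_small (flat_smooth_derive true oO fu) Op p0.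
Qed.

(** The function [phi + u] is invariant if [u o F - u = - f2]. *)
Lemma flat_first_integral_exists a b V F : (a < b)%E -> domain_adjacent a b V ->
  flat a b V (fun p => (F p).1 - (p.1 + p.2)) ->
  flat a b V (fun p => (F p).2 - p.2) ->
  exists W phi,
     [/\ W `<=` V, domain_adjacent a b W & flat_first_integral a b W F phi].
Proof.
move=> ab adj F1 F2; have [f1 [f2 [ff1 ff2 FE]]] := shear_of_flat adj F1 F2.
have oV := open_collar adj.
have JV : boundary_interval a b `<=` collar a b V by move=> p Jp; left; right.
have [Z [u [oZ JZ fu EQ]]] := coboundary ab oV JV ff1 ff2 (flat_smoothN oV ff2).
pose P q := [/\ collar a b V q, Z q & `|'D_e2 u q| <= 2^-1].
have HP p : boundary_interval a b p -> \forall q \near p, P q.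
  move=> Jp; have n0 : \forall q \near p, collar a b V q.
    by apply: open_nbhs_nbhs; split => //; exact: JV.
  have n1 : \forall q \near p, Z q.
    by apply: open_nbhs_nbhs; split => //; exact: JZ.
  have n2 := near_derive_small oZ fu (JZ _ Jp) (boundary_snd Jp) (e := 2^-1)
    ltac:(by rewrite invr_gt0).
  by apply: filterS3 n0 n1 n2 => q; exact: And3.
have [Y [[oY JY] YP _ _ adjY]] := boundary_shrink ab HP.
have YV : Y `<=` collar a b V by move=> q /YP[].
have YZ : Y `<=` Z by move=> q /YP[].
exists (upper Y), (fun p => p.2 + u p); split => //.
  exact: upper_collar_sub adj YV.
apply: first_integral_of_flat => //; first exact: flat_smoothS fu.
  by move=> p /YP[_ _]; rewrite ler_norml => /andP[]; lra.
have sub := with_boundary_upper JY.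
move=> p Ap AFp; have FEp : F p = shear_map f1 f2 p.
  apply: FE; case: Ap => [Op|Jp]; last by right.
  by left; exact: (upper_collar_sub adj YV).
have := EQ p (YZ _ (sub _ Ap)); rewrite -FEp => /(_ (YZ _ (sub _ AFp))) E.
rewrite -[u (F p)](subrK (u p)) E FEp /=; ring.
Qed.

(** If [phi + v] is invariant, then [tau + w] completes it to a conjugacy with
    the shear as soon as [w o F - w = v - f1]. *)
Lemma normalizing_chart_exists a b V F W phi : (a < b)%E -> domain_adjacent a b V ->
  flat a b V (fun p => (F p).1 - (p.1 + p.2)) ->
  flat a b V (fun p => (F p).2 - p.2) ->
  W `<=` V -> domain_adjacent a b W -> flat_first_integral a b W F phi ->
  exists W' tau,
    let A := with_boundary a b W' in
    let H := fun p => (tau p, phi p) in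
    [/\ W' `<=` W /\ domain_adjacent a b W',
        smooth_on A tau /\ flat a b W' (fun p => tau p - p.1),
        smooth_embedding A H &
        forall z, A z -> A (F z) -> H (F z) = shear (H z)].
Proof.
move=> ab adjV F1 F2 WV adj [sphi fphi inv _].
have [f1 [f2 [ff1 ff2 FE]]] := shear_of_flat adjV F1 F2.
have oW := open_collar adj.
have CWV : collar a b W `<=` collar a b V.
  by move=> p [[/WV Vp|Jp]|p0]; [left; left|left; right|right].
have JW : boundary_interval a b `<=` collar a b W by move=> p Jp; left; right.
have fv := flat_ext0 adj fphi; set v := ext0 _ in fv.
have gf1 := flat_smoothS CWV ff1; have gf2 := flat_smoothS CWV ff2.
have [Z [w [oZ JZ fw EQ]]] := coboundary ab oW JW gf1 gf2 (flat_smoothB oW fv gf1).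
have oZW : open (Z `&` collar a b W) by exact: openI.
have JZW : boundary_interval a b `<=` Z `&` collar a b W.
  by move=> p Jp; split; [exact: JZ|exact: JW].
have fw' : flat_smooth (Z `&` collar a b W) w by apply: flat_smoothS fw => p [].
have fv' : flat_smooth (Z `&` collar a b W) v by apply: flat_smoothS fv => p [].
have [Y [K1 [K2 [[oY JY YZW adjY] [oHY KH] fk1 fk2]]]] :=
  flat_inverse ab oZW JZW fw' fv'.
have sub := with_boundary_upper JY.
have YC : Y `<=` collar a b W by move=> p /YZW[].
have UW := upper_collar_sub adj YC.
have sw : smooth_open Y w by apply: smooth_openS fw'.1.
have sv : smooth_open Y v by apply: smooth_openS fv'.1.
have phiE p : with_boundary a b W p -> phi p = p.2 + v p.
  move=> [Wp|Jp]; rewrite /v /ext0.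
    by rewrite (adjacent_above adj Wp) addrC subrK.
  have [_ /(_ p Jp) E _] := fphi; rewrite (boundary_snd Jp) ltxx.
  by rewrite -[phi p](subrK p.2) E (boundary_snd Jp) !addr0.
have AW : with_boundary a b (upper Y) `<=` with_boundary a b W.
  by move=> p [/UW Wp|Jp]; [left|right].
have HE p : with_boundary a b (upper Y) p -> (p.1 + w p, phi p) = perturb w v p.
  by move=> /AW Ap; rewrite phiE.
exists (upper Y), (fun p => p.1 + w p); split.
- by [].
- split.
    move=> p /sub Op; exists Y, (fun p => p.1 + w p); split => //.
    by apply: smoothD => //; exact: smooth_fst.
  apply: (flat_of_flat_smooth adjY oY sub (flat_smoothS YZW fw')) => p _.
  by rewrite addrC addKr.
- split.
    move=> p Ap; exists Y, (perturb w v); split => //.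
    + exact: sub.
    + apply: smooth_pair => //; apply: smoothD => //; [exact: smooth_fst|exact: smooth_snd].
    + by move=> q _ Aq; rewrite HE.
  exists (fun q => (K1 q, K2 q)); split; last first.
    move=> p Ap; rewrite HE//; have [E1 E2] := KH p (sub _ Ap).
    by rewrite E1 E2 -surjective_pairing.
  move=> _ [p Ap <-]; exists (perturb w v @` Y), (fun q => (K1 q, K2 q)).
  split => //.
  + by rewrite HE//; exists p => //; exact: sub.
  + apply: smooth_pair => //.
      apply: (@eq_smooth _ _ _ _ (fun q => (K1 q - q.1) + q.1)) => //.
        by move=> q _; rewrite subrK.
      by apply: smoothD => //; [exact: fk1.1|exact: smooth_fst].
    apply: (@eq_smooth _ _ _ _ (fun q => (K2 q - q.2) + q.2)) => //.
      by move=> q _; rewrite subrK.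
    by apply: smoothD => //; [exact: fk2.1|exact: smooth_snd].
- move=> p Ap AFp; rewrite /shear /=.
  have invp := inv p (AW _ Ap) (AW _ AFp); rewrite invp; congr (_, _).
  have FEp : F p = shear_map f1 f2 p.
    by apply: FE; case: (AW _ Ap) => [/WV Vp|Jp]; [left|right].
  have [Zp _] := YZW _ (sub _ Ap); have [ZFp _] := YZW _ (sub _ AFp).
  have := EQ p Zp; rewrite -FEp => /(_ ZFp) E.
  rewrite (phiE _ (AW _ Ap)) -[w (F p)](subrK (w p)) E FEp /=; ring.
Qed.

End NormalForm.

(** * The cardinality of a set of polynomials *)

Section Cardinality.
Context {R : realType}.

Lemma card_le_inj {T U : Type} (f : T -> U) (A : set T) (B : set U) :
  {in A &, injective f} -> (forall x, A x -> B (f x)) -> (A #<= B)%card.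
Proof.
move=> fi fAB; rewrite -(card_le_eql (inj_card_eq fi)).
by apply: subset_card_le => _ [x /fAB Bx <-].
Qed.

Definition ternary_sum (b : nat -> bool) (n : nat) : R :=
  \sum_(i < n) (b i)%:R * 3^-1 ^+ i.

Lemma ternary_sumS b n :
  ternary_sum b n.+1 = ternary_sum b n + (b n)%:R * 3^-1 ^+ n.
Proof. by rewrite /ternary_sum big_ord_recr. Qed.

Lemma ternary_sum_le b n k : ternary_sum b n <= ternary_sum b (n + k).
Proof.
elim: k => [|k IH]; first by rewrite addn0.
by rewrite addnS ternary_sumS (le_trans IH)// lerDl mulr_ge0// exprn_ge0.
Qed.

Lemma ternary_tail b n k : ternary_sum b (n + k) <=
  ternary_sum b n + 3 / 2 * (3^-1 ^+ n - 3^-1 ^+ (n + k)).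
Proof.
elim: k => [|k IH]; first by rewrite addn0 subrr mulr0 addr0.
rewrite addnS ternary_sumS exprS.
have h0 : 0 <= (3^-1 : R) ^+ (n + k) by rewrite exprn_ge0// invr_ge0.
have h1 : (b (n + k)%N)%:R * 3^-1 ^+ (n + k) <= 3^-1 ^+ (n + k) :> R.
  by rewrite ler_piMl//; case: (b _).
move: IH h0 h1; move: (3^-1 ^+ (n + k)) (3^-1 ^+ n) => x y; lra.
Qed.

(** In base 3, unlike base 2, an expansion with digits 0 and 1 is unique. *)
Definition ternary b : R := sup (range (ternary_sum b)).

Lemma ternary_has_sup b : has_sup (range (ternary_sum b)).
Proof.
split; first by exists (ternary_sum b 0); exists 0%N.
exists (3 / 2) => _ [n _ <-].
have := ternary_tail b 0 n; rewrite add0n /(ternary_sum b 0) big_ord0 add0r expr0.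
have : 0 <= (3^-1 : R) ^+ n by rewrite exprn_ge0// invr_ge0.
lra.
Qed.

Lemma ternary_lt (b b' : nat -> bool) n : (forall i, (i < n)%N -> b i = b' i) -> b n -> ~~ b' n ->
  ternary b' < ternary b.
Proof.
move=> eqb bn b'n.
have e : ternary_sum b n = ternary_sum b' n.
  by apply: eq_bigr => i _; rewrite eqb.
have y0 : 0 < (3^-1 : R) ^+ n by rewrite exprn_gt0// invr_gt0.
apply: (@le_lt_trans _ _ (ternary_sum b' n + 2^-1 * 3^-1 ^+ n)).
  apply: ge_sup; first by exists (ternary_sum b' 0); exists 0%N.
  move=> _ [m _ <-]; have [mn|nm] := leqP m n.
    apply: (@le_trans _ _ (ternary_sum b' n)); first by rewrite -(subnKC mn) ternary_sum_le.
    by rewrite lerDl mulr_ge0// ltW.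
  have := ternary_tail b' n.+1 (m - n.+1); rewrite subnKC// ternary_sumS (negbTE b'n) mul0r addr0.
  have : 0 <= (3^-1 : R) ^+ m by rewrite exprn_ge0// invr_ge0.
  rewrite exprS; move: (3^-1 ^+ n) (3^-1 ^+ m) => x y; lra.
apply: (@lt_le_trans _ _ (ternary_sum b n.+1)).
  by rewrite ternary_sumS bn mul1r e ltrD2l; lra.
by apply: ub_le_sup; [have [] := ternary_has_sup b|exists n.+1].
Qed.

Lemma ternary_inj : injective ternary.
Proof.
move=> b b' E; apply/funext => n; apply/eqP/negPn/negP => nE.
have ex : exists n, b n != b' n by exists n.
have [m mE mmin] := ex_minnP ex.
have eqb i : (i < m)%N -> b i = b' i.
  by move=> im; apply/eqP/negPn/negP => /mmin; rewrite leqNgt im.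
move: mE; case bm: (b m); case b'm: (b' m) => // _.
  by have := ternary_lt eqb bm (negbT b'm); rewrite E ltxx.
have eqb' i : (i < m)%N -> b' i = b i by move=> /eqb.
by have := ternary_lt eqb' b'm (negbT bm); rewrite E ltxx.
Qed.

(** The Dedekind cuts of all coefficients, through an enumeration of
    [nat * rat]. *)
Definition cuts (P : {poly R}) (n : nat) : bool :=
  if unpickle n is Some (k, q) then ratr q < P`_k else false.

Lemma cuts_inj : injective cuts.
Proof.
have lt_cut (P P' : {poly R}) k : P`_k < P'`_k -> cuts P <> cuts P'.
  move=> /rat_in_itvoo[q]; rewrite in_itv/= => /andP[q1 q2] E.
  have := congr1 (fun f => f (pickle (k, q))) E.
  by rewrite /cuts pickleK q2 ltNge (ltW q1).
move=> P P' E; apply/polyP => k.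
by have [/lt_cut//|/lt_cut/(_ (esym E))//|] := ltgtP P`_k P'`_k.
Qed.

Lemma card_poly_le : ([set: {poly R}] #<= [set: R])%card.
Proof.
apply: (card_le_inj (f := ternary \o cuts)) => // P P' _ _ /=.
by move=> /ternary_inj/cuts_inj.
Qed.

(** The weights compensate the linear growth in [j] of the derivatives of
    [osc j]. *)
Definition admissible (P : {poly R}) :=
  \sum_(i < size P) `|P`_i| * (i + 2)%:R <= 1.

Lemma atan_lt2 (x : R) : `|atan x| < 2.
Proof.
have p2 := @pihalf_lt2 R; rewrite ltr_norml.
have := atan_gtNpi2 x; have := atan_ltpi2 x.
by move=> h1 h2; apply/andP; split; lra.
Qed.

Lemma card_admissible : ([set P | admissible P] #= [set: R])%card.
Proof.
rewrite card_eq_le; apply/andP; split.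
  by apply: card_le_trans card_poly_le; exact: subset_card_le.
apply: (card_le_inj (f := fun x : R => (atan x / 4)%:P)) => [x y _ _|x _].
  by move=> /polyC_inj/(mulIf _) h; apply: (can_inj (@atanK R)); apply: h; rewrite invr_eq0.
rewrite /= /admissible; have := atan_lt2 x.
have [->|c0] := eqVneq (atan x / 4) 0; first by rewrite size_poly0 big_ord0.
rewrite size_polyC c0 big_ord1 coefC/= add0n normrM (_ : `|4^-1| = 4^-1 :> R).
  by move=> h; move: (`|atan x|) h => t; lra.
by rewrite ger0_norm// invr_ge0.
Qed.

End Cardinality.

(** * Foliations by level curves *)

Section Foliations.
Context {R : realType}.
Implicit Types (a b : \bar R) (U V W A X : set (R * R)) (f h : R * R -> R)
  (p q : R * R).

Lemma level_is_foliation A f : is_foliation A (level_foliation A f).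
Proof.
split=> [p Ap|p q Ap Lq].
  split.
  - by apply: connected_component_refl.
  - by move=> q /connected_component_sub[].
  - exact: component_connected.
have [_ /= fE] := connected_component_sub Lq.
by rewrite /level_foliation fE (same_connected_component Lq).
Qed.

(** The leaves stay in [U], so that restricting them to [U] does not change
    them. *)
Lemma level_locally_level A U f : A `<=` U ->
  (forall q, U q -> exists v : R * R, 'D_v f q != 0) ->
  locally_level A (level_foliation A f) U f.
Proof.
move=> AU df; split => // q Aq Uq.
have [/(_ q Aq)[Lqq LA cL] _] := level_is_foliation A f.
have -> : A `&` U = A by apply/seteqP; split=> [p []//|p Ap]; split=> //; exact: AU.
rewrite /restrict_foliation; set L := level_foliation A f q in Lqq LA cL *.
have -> : L `&` U = L by apply/seteqP; split=> [p []//|p Lp]; split=> //; exact/AU/LA.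
by rewrite connected_component_id.
Qed.

Lemma level_smooth_foliation A X f : open X -> A `<=` X -> smooth_open X f ->
  (forall q, X q -> 'D_e2 f q != 0) -> smooth_foliation A (level_foliation A f).
Proof.
move=> oX AX sf df; split; first exact: level_is_foliation.
move=> p Ap; exists X, f; split => //; first exact: AX.
  by move=> q Xq; exists X, f; split.
by apply: level_locally_level => // q /df; exists e2.
Qed.

Lemma boundary_interval_connected a b : connected (boundary_interval a b).
Proof.
have -> : boundary_interval a b =
    (fun t : R => (t, 0)) @` [set t | (a < t%:E)%E /\ (t%:E < b)%E].
  apply/seteqP; split=> [[s t] [/= h1 [h2 ->]]|_ [t [h1 h2] <-]]; first by exists s.
  by split.
apply: connected_continuous_connected.
  apply/connected_intervalP => x y [h1 h2] [h3 h4] z /andP[xz zy]; split.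
    by rewrite (lt_le_trans h1)// lee_fin.
  by rewrite (le_lt_trans _ h4)// lee_fin.
apply: continuous_subspaceT => t.
exact: (cvg_pair (@cvg_id _ (nbhs t)) (cvg_cst (0 : R))).
Qed.

Lemma level_boundary_leaf a b X f p :
  (forall q, boundary_interval a b q -> f q = 0) ->
  (forall q, upper X q -> 0 < f q) -> boundary_interval a b p ->
  level_foliation (with_boundary a b (upper X)) f p = boundary_interval a b.
Proof.
move=> f0 fpos Jp; rewrite /level_foliation.
have -> : with_boundary a b (upper X) `&` [set q | f q = f p] = boundary_interval a b.
  apply/seteqP; split=> [q [[Wq /=|//]]|q Jq].
    by rewrite (f0 p)// => fq0; have := fpos q Wq; rewrite fq0 ltxx.
  by split; [right|rewrite /= !f0].
by apply: connected_component_id => //; exact: boundary_interval_connected.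
Qed.

End Foliations.

(** * Level curves as graphs *)

Section LevelCurves.
Context {R : realType}.
Implicit Types (X : set (R * R)) (f g : R * R -> R) (p q : R * R).

Lemma horiz_within_continuous X g (lo hi y : R) : smooth_open X g ->
  (forall s, lo <= s <= hi -> X (s, y)) ->
  {within `[lo, hi], continuous (fun s => g (s, y))}.
Proof.
move=> sg HX; apply: derivable_within_continuous => s; rewrite in_itv /= => hs.
by apply: ex_derive; apply/derive_horiz/(smooth_differentiable sg)/HX.
Qed.

Lemma vert_within_continuous X g (s lo hi : R) : smooth_open X g ->
  (forall y, lo <= y <= hi -> X (s, y)) ->
  {within `[lo, hi], continuous (fun y => g (s, y))}.
Proof.
move=> sg HX; apply: derivable_within_continuous => y; rewrite in_itv /= => hs.
by apply: ex_derive; apply/derive_vert/(smooth_differentiable sg)/HX.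
Qed.

Lemma graph_within_continuous X g (Y : R -> R) (lo hi : R) : smooth_open X g ->
  {within `[lo, hi], continuous Y} -> (forall s, lo <= s <= hi -> X (s, Y s)) ->
  {within `[lo, hi], continuous (fun s => g (s, Y s))}.
Proof.
move=> sg /subspace_continuousP cY HX; apply/subspace_continuousP => s sI.
have cg : {for (s, Y s), continuous g}.
  apply: (smooth_continuous sg); apply: HX; by move: sI; rewrite /= in_itv.
apply: (@cvg_comp _ _ _ (fun s => (s, Y s)) g) cg.
apply: (@cvg_pair _ _ _ (within `[lo, hi]%classic (nbhs s)) (nbhs s) (nbhs (Y s))).
  exact: cvg_within.
exact: cY.
Qed.

(** The implicit function theorem for a function increasing in [phi]: the graph
    is Lipschitz, because the [tau]-derivative is bounded on the box. *)
Lemma level_graph X f (lo hi eta c : R) : smooth_open X f -> lo <= hi -> 0 <= eta ->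
  box lo hi eta `<=` X -> (forall q, box lo hi eta q -> 2^-1 <= 'D_e2 f q) ->
  (forall s, lo <= s <= hi -> f (s, 0) <= c <= f (s, eta)) ->
  exists Y : R -> R, [/\ {within `[lo, hi], continuous Y},
    forall s, lo <= s <= hi -> 0 <= Y s <= eta /\ f (s, Y s) = c &
    forall s y, lo <= s <= hi -> 0 <= y <= eta -> f (s, y) = c -> Y s = y].
Proof.
move=> sf lohi eta0 bX df fc.
have ex s : exists y, lo <= s <= hi -> 0 <= y <= eta /\ f (s, y) = c.
  have [hs|] := boolP (lo <= s <= hi); last by exists 0.
  have cs : {within `[0, eta], continuous (fun y => f (s, y))}.
    by apply: (vert_within_continuous sf) => y hy; apply: bX; split.
  have vb : Num.min (f (s, 0)) (f (s, eta)) <= c <= Num.max (f (s, 0)) (f (s, eta)).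
    by have /andP[h1 h2] := fc s hs; rewrite ge_min h1 le_max h2 orbT.
  have [y + E] := IVT eta0 cs vb.
  by rewrite in_itv/= => hy; exists y.
have /choice[Y HY] := ex.
have [C C0 HC] := box_bounded (smooth_derive e1 sf) bX.
have mono s y z : lo <= s <= hi -> 0 <= y -> y <= z -> z <= eta ->
    2^-1 * (z - y) <= f (s, z) - f (s, y).
  move=> hs y0 yz ze.
  have inb t : y <= t <= z -> box lo hi eta (s, t).
    by move=> /andP[h1 h2]; split => //=; rewrite (le_trans y0)// (le_trans h2).
  have [|t ht ->] := @mvt_vert _ f s y z yz.
    by move=> t /inb /bX; exact: smooth_differentiable sf.
  by rewrite ler_wpM2r ?subr_ge0//; apply: df; exact: inb.
have dist s y z : lo <= s <= hi -> 0 <= y <= eta -> 0 <= z <= eta ->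
    `|y - z| <= 2 * `|f (s, y) - f (s, z)|.
  move=> hs; wlog yz : y z / y <= z => [H|].
    by have [/H//|/ltW/H h] := leP y z; rewrite distrC [`|f _ - _|]distrC => *; exact: h.
  move=> /andP[y0 _] /andP[_ ze].
  have := mono s y z hs y0 yz ze; have := ler_norm (f (s, z) - f (s, y)).
  rewrite [`|y - z|]distrC [`|f (s, y) - _|]distrC (ger0_norm (x := z - y)) ?subr_ge0//.
  move: `|f (s, z) - f (s, y)| (f (s, z) - f (s, y)) => u v; lra.
exists Y; split.
- apply: (@lipschitz_within _ _ (2 * C)) => //; first by rewrite mulr_ge0.
  suff main s t : lo <= s <= hi -> lo <= t <= hi -> s <= t ->
      `|Y s - Y t| <= 2 * C * `|s - t|.
    move=> s t hs ht; have [/main|/ltW/main h] := leP s t; first exact.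
    by rewrite distrC [`|s - t|]distrC; exact: h.
  move=> hs ht st; have [Ys fs] := HY s hs; have [Yt ft] := HY t ht.
  apply: le_trans (dist s _ _ hs Ys Yt) _; rewrite fs -ft.
  have inb r : s <= r <= t -> box lo hi eta (r, Y t).
    move: hs ht => /andP[h1 _] /andP[_ h2] /andP[h3 h4].
    by split => //=; rewrite (le_trans h1)// (le_trans h4).
  have [|r hr ->] := @mvt_horiz _ f (Y t) s t st.
    by move=> r /inb /bX; exact: smooth_differentiable sf.
  rewrite normrM mulrA [`|t - s|]distrC ler_wpM2r// ler_wpM2l//.
  exact/HC/inb.
- by move=> s; exact: HY.
- move=> s y hs hy fy; have [Ys fs] := HY s hs.
  apply/eqP; rewrite -subr_eq0 -normr_le0.
  by have := dist s _ _ hs Ys hy; rewrite fs fy subrr normr0 mulr0.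
Qed.

(** The range is an interval contained in a finite set. *)
Lemma root_valued_constant (Q : {poly R}) (g : R -> R) (lo hi s0 s : R) :
  {within `[lo, hi], continuous g} -> (forall t, lo <= t <= hi -> root Q (g t)) ->
  lo <= s0 <= hi -> lo <= s <= hi -> Q != 0 -> g s0 = 0 -> g s = 0.
Proof.
move=> cg rg h0 hs Q0 g0; apply/eqP/negPn/negP => v0.
have conn : connected (g @` `[lo, hi]).
  by apply: connected_continuous_connected => //; exact: segment_connected.
have /connected_intervalP int := conn.
have rt (t : R) : 0 <= t <= 1 -> root Q (t * g s).
  move=> /andP[t0 t1].
  suff [r + <-] : (g @` `[lo, hi]) (t * g s) by rewrite /= in_itv => /rg.
  have i0 : (g @` `[lo, hi]) 0 by exists s0 => //=; rewrite in_itv.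
  have is_ : (g @` `[lo, hi]) (g s) by exists s => //=; rewrite in_itv.
  have [gs|gs] := leP 0 (g s).
    by apply: (int _ _ i0 is_); rewrite mulr_ge0// ler_piMl.
  apply: (int _ _ is_ i0); apply/andP; split; last by rewrite mulr_ge0_le0// ltW.
  by rewrite -[leLHS]mul1r ler_wnM2r// ltW.
have /negP := Q0; apply; apply/eqP.
apply: (@roots_geq_poly_eq0 _ _ [seq i.+1%:R^-1 * g s | i <- iota 0 (size Q)]).
- apply/allP => _ /mapP[i _ ->]; apply: rt.
  by rewrite invr_ge0 ler0n invf_le1 ?ltr0n// ler1n.
- rewrite map_inj_uniq ?iota_uniq// => i j /(mulIf v0)/invr_inj/eqP.
  by rewrite eqr_nat => /eqP[].
- by rewrite size_map size_iota.
Qed.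

End LevelCurves.

(** * Invariant functions indexed by polynomials *)

Section Ripples.
Context {R : realType}.
Implicit Types (X : set (R * R)) (f g u w : R * R -> R) (p q z : R * R)
  (P : {poly R}).

Notation half := (upper [set: R * R]).

Lemma sin_int_turns (m : int) (x : R) : sin (x + 2 * pi * m%:~R) = sin x.
Proof.
have per (n : nat) y : sin (y + 2 * pi * n%:R) = sin y :> R.
  by rewrite -[RHS](periodicn (@sinD2pi R) n y); rewrite -mulrnA -(mulr_natl pi) natrM mulrAC.
case: m => n; first exact: per.
by rewrite NegzE mulrNz -[LHS](per n.+1) mulrN subrK.
Qed.

Lemma oscE j q : 0 < q.2 -> osc j q = flat_exp q * sin (turns q) ^+ j.
Proof. by move=> q0; rewrite /osc /ext0 q0. Qed.

(** One step of the normal form adds exactly one turn. *)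
Lemma osc_shear j z : osc j (shear z) = osc j z.
Proof.
rewrite /osc /ext0 /shear /=; case: ifP => // z0.
rewrite /flat_exp /turns /= (mulrDl z.1 z.2) divff ?gt_eqF// (mulrDr (2 * pi)).
by have := sin_int_turns 1 (2 * pi * (z.1 / z.2)); rewrite mulr1z => ->.
Qed.

Lemma derive_osc b j z : half z -> 'D_(edir b) (osc j.+1) z =
  flat_exp z * (b%:R * (z.2^-1 * z.2^-1)) * sin (turns z) ^+ j.+1 +
  j.+1%:R * sin (turns z) ^+ j * cos (turns z) * (flat_exp z * 'D_(edir b) turns z).
Proof.
move=> hz.
have oscH q : half q -> osc j.+1 q = flat_exp q * sin (turns q) ^+ j.+1.
  by move=> [_ q0]; rewrite oscE.
rewrite (eq_derive (edir b) open_half oscH hz).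
have ds : differentiable (fun q : R * R => sin (turns q)) z.
  exact: (smooth_differentiable (smooth_sin open_half smooth_turns) hz).
have dX : differentiable (fun q : R * R => sin (turns q) ^+ j.+1) z.
  exact: (smooth_differentiable (smoothX _ open_half (smooth_sin open_half smooth_turns)) hz).
rewrite derive_mul//; last exact: (smooth_differentiable smooth_flat_exp hz).
rewrite derive_flat_exp//.
rewrite (derive_comp1 (h := fun t => t ^+ j.+1) (f := fun q => sin (turns q)))//;
  last exact: exprn_derivable.
rewrite exp_derive derive_sin_turns//.
rewrite -[_ *: _]/(_ * 1) -[_ *: _]/(_ * _).
by move: ('D_(edir b) turns z) (flat_exp z) => t y /=; ring.
Qed.

Lemma derive_osc_le b j z : half z -> `|'D_(edir b) (osc j.+1) z| <=
  (j + 2)%:R * (flat_exp z * (z.2^-1 * z.2^-1) + `|flat_exp z * 'D_(edir b) turns z|).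
Proof.
move=> hz; rewrite derive_osc//.
have s1 : `|sin (turns z)| <= 1 by rewrite ler_norml sin_geN1 sin_le1.
have c1 : `|cos (turns z)| <= 1 by rewrite ler_norml cos_geN1 cos_le1.
have sX k : `|sin (turns z) ^+ k| <= 1 by rewrite normrX exprn_ile1.
have b0 : 0 <= flat_exp z * (z.2^-1 * z.2^-1).
  by rewrite mulr_ge0 ?expR_ge0// -expr2 sqr_ge0.
move: ('D_(edir b) turns z) => t.
rewrite (le_trans (ler_normD _ _))// mulrDr; apply: lerD.
  rewrite normrM -[leRHS]mulr1 ler_pM//.
  apply: (@le_trans _ _ (flat_exp z * (z.2^-1 * z.2^-1))).
    rewrite ger0_norm; last by case: b; rewrite ?mul1r// mul0r mulr0.
    by case: b; rewrite ?mul1r// mul0r mulr0.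
  by rewrite -[leLHS]mul1r ler_wpM2r// ler1n addn2.
rewrite normrM ler_wpM2r// 2!normrM -[leRHS]mulr1 ler_pM//.
rewrite -[leRHS]mulr1 ler_pM// normr_nat ler_nat addn2.
exact: leqnSn.
Qed.

(** The neighborhood does not depend on [j]: the derivative of the power of the
    sine costs a factor that is linear in [j], and the rest is a fixed function
    that vanishes at the boundary. *)
Lemma near_derive_osc p (e : R) : p.2 = 0 -> 0 < e ->
  \forall z \near p, 0 < z.2 -> forall j b,
    `|'D_(edir b) (osc j.+1) z| <= (j + 2)%:R * e.
Proof.
move=> p0 e0; have e20 : 0 < e / 2 by rewrite divr_gt0.
have [g0 og0 E0] := @osc_turns_derive R false.
have [g1 og1 E1] := @osc_turns_derive R true.
have oi : oscillatory (fun z : R * R => z.2^-1 * z.2^-1).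
  by apply: osc_mul; exact: osc_inv.
have n0 := flat_exp_vanishes oi p0 e20.
have n1 := flat_exp_vanishes og0 p0 e20; have n2 := flat_exp_vanishes og1 p0 e20.
apply: filterS3 n0 n1 n2 => z H0 H1 H2 z0 j b.
have hz : half z by split.
apply: le_trans (derive_osc_le b j hz) _; rewrite ler_wpM2l// [leRHS]splitr.
apply: lerD; first by rewrite (le_trans (ler_norm _))// H0.
by case: b; rewrite ?E0 ?E1//; [exact: H2|exact: H1].
Qed.

(** A flat invariant function for every polynomial: by [osc_shear], functions of
    the normal coordinates [perturb w u] built from [osc] are invariant. *)
Definition ripple w u P q : R :=
  \sum_(i < size P) P`_i * osc i.+1 (perturb w u q).

Definition level_fun w u P q : R := q.2 + (u q + ripple w u P q).

Lemma rippleE w u P q : 0 < q.2 + u q -> ripple w u P q =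
  flat_exp (perturb w u q) * (P * 'X).[sin (turns (perturb w u q))].
Proof.
move=> q0; rewrite /ripple hornerMX horner_coef big_distrl mulr_sumr /=.
by apply: eq_bigr => i _; rewrite oscE// exprSr; ring.
Qed.

Lemma ripple_shear w u P q q' : perturb w u q' = shear (perturb w u q) ->
  ripple w u P q' = ripple w u P q.
Proof. by move=> E; apply: eq_bigr => i _; rewrite E osc_shear. Qed.

Lemma derive_lin_comb n (c : 'I_n -> R) (g : 'I_n -> R * R -> R) v p :
  (forall i, differentiable (g i) p) ->
  'D_v (fun q => \sum_(i < n) c i * g i q) p = \sum_(i < n) c i * 'D_v (g i) p.
Proof.
move=> dg.
have -> : (fun q => \sum_(i < n) c i * g i q) = \sum_(i < n) (fun q => c i * g i q).
  by apply/funext => q; rewrite fct_sumE.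
have dc i : differentiable (fun _ : R * R => c i) p by exact: differentiable_cst.
rewrite derive_sum => [|i].
  by apply: eq_bigr => i _; rewrite derive_mul// (derive_cst (c i)) mulr0 addr0.
by apply: diff_derivable; exact: differentiableM.
Qed.

Lemma admissible_sum P (c : R) (G : nat -> R) : admissible P -> 0 <= c ->
  (forall i, `|G i| <= c * (i + 2)%:R) -> `|\sum_(i < size P) P`_i * G i| <= c.
Proof.
move=> aP c0 HG; apply: le_trans (ler_norm_sum _ _ _) _.
rewrite -[leRHS]mulr1; apply: le_trans (ler_wpM2l c0 aP).
rewrite mulr_sumr; apply: ler_sum => i _; rewrite normrM.
by rewrite mulrCA ler_wpM2l.
Qed.

Section Estimates.
Context (X : set (R * R)) (w u : R * R -> R) (oX : open X)
  (fw : flat_smooth X w) (fu : flat_smooth X u)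
  (uX : forall q, upper X q -> `|u q| <= 4^-1 * q.2)
  (duX : forall q, upper X q -> `|'D_e2 u q| <= 4^-1)
  (dwX : forall q, upper X q -> `|'D_e2 w q| <= 1)
  (flat_expX : forall q, upper X q -> flat_exp (perturb w u q) <= 4^-1 * q.2)
  (oscX : forall q, upper X q -> forall j b,
    `|'D_(edir b) (osc j.+1) (perturb w u q)| <= (j + 2)%:R * 12^-1).

Lemma normal_pos q : upper X q -> 0 < q.2 + u q.
Proof.
move=> Xq; have := uX Xq; rewrite ler_norml => /andP[h _].
by have [_ /= q0] := Xq; move: h; lra.
Qed.

Lemma flat_osc_comp j : flat_smooth X (fun q => osc j (perturb w u q)).
Proof.
apply: (@flat_smooth_comp _ X setT (fun q => q.1 + w q) (fun q => q.2 + u q)) => //.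
- by apply: smoothD => //; [exact: smooth_fst|exact: fw.1].
- by apply: smoothD => //; [exact: smooth_snd|exact: fu.1].
- by move=> q Xq q0; rewrite fu.2// addr0.
- exact: osc_flat.
Qed.

Lemma flat_ripple P : flat_smooth X (ripple w u P).
Proof.
split.
  apply: smooth_sum => // i; apply: smoothZ => //; exact: (flat_osc_comp _).1.
move=> q Xq q0; apply: big1 => i _.
by rewrite (flat_osc_comp _).2// mulr0.
Qed.

Lemma ripple_le P q : admissible P -> upper X q -> `|ripple w u P q| <= 4^-1 * q.2.
Proof.
move=> aP Xq; have [_ /= q0] := Xq; have n0 := normal_pos Xq.
apply: (admissible_sum aP (G := fun i => osc i.+1 (perturb w u q))) => [|i].
  by rewrite mulr_ge0// ltW.
rewrite oscE// normrM ger0_norm ?expR_ge0// ler_pM ?expR_ge0//; first exact: flat_expX.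
rewrite normrX (@le_trans _ _ 1)//; last by rewrite ler1n addn2.
by rewrite exprn_ile1// ler_norml sin_geN1 sin_le1.
Qed.

Lemma derive_osc_comp_le q j : upper X q ->
  `|'D_e2 (fun q => osc j.+1 (perturb w u q)) q| <= 4^-1 * (j + 2)%:R.
Proof.
move=> Xq; have [Xq' _] := Xq.
have d1 : differentiable (fun q => q.1 + w q) q.
  apply: (smooth_differentiable (U := X)) => //.
  by apply: smoothD => //; [exact: smooth_fst|exact: fw.1].
have d2 : differentiable (fun q => q.2 + u q) q.
  apply: (smooth_differentiable (U := X)) => //.
  by apply: smoothD => //; [exact: smooth_snd|exact: fu.1].
have d3 : differentiable (osc j.+1) (perturb w u q).
  exact: (smooth_differentiable (osc_flat _).1 (Logic.I : setT _)).
rewrite (derive_comp2 e2 d1 d2 d3) derive_add_snd; last first.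
  exact: smooth_differentiable fu.1 Xq'.
have -> : 'D_e2 (fun q => q.1 + w q) q = 'D_e2 w q.
  have df := differentiable_fst q.
  have dw := smooth_differentiable fw.1 Xq'.
  rewrite -[fun q => _]/((fst : R * R -> R) + w) deriveD; try exact: diff_derivable.
  by rewrite derive_fst add0r.
move: (oscX Xq j false) (oscX Xq j true) (dwX Xq) (duX Xq).
rewrite -[edir false]/e1 -[edir true]/e2.
move: ('D_e1 (osc j.+1) _) ('D_e2 (osc j.+1) _) ('D_e2 w q) ('D_e2 u q).
have k0 : 0 <= (j + 2)%:R * 12^-1 :> R by rewrite mulr_ge0// invr_ge0.
(* The constant 12 is chosen for [1 + (1 + 4^-1) <= 12 / 4]. *)
have kE : 4^-1 * (j + 2)%:R = 3 * ((j + 2)%:R * 12^-1) :> R by field.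
rewrite kE; move: ((j + 2)%:R * 12^-1) k0 => k k0 d1' d2' dw du h1 h2 h3 h4.
apply: (@le_trans _ _ (1 * k + (1 + 4^-1) * k)).
  rewrite (le_trans (ler_normD _ _))// !normrM; apply: lerD; first exact: ler_pM.
  by rewrite ler_pM// (le_trans (ler_normD _ _))// normr1 lerD2l.
by rewrite -mulrDl ler_wpM2r//; lra.
Qed.

Lemma derive_ripple_le P q : admissible P -> upper X q ->
  `|'D_e2 (ripple w u P) q| <= 4^-1.
Proof.
move=> aP Xq; rewrite derive_lin_comb => [|i]; last first.
  by case: Xq => Xq _; exact: smooth_differentiable (flat_osc_comp _).1 Xq.
apply: (admissible_sum aP (G := fun i => 'D_e2 (fun q => osc i.+1 (perturb w u q)) q)).
  by rewrite invr_ge0.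
by move=> i; exact: derive_osc_comp_le.
Qed.

Lemma flat_level P : flat_smooth X (fun q => u q + ripple w u P q).
Proof. by apply: flat_smoothD => //; exact: flat_ripple. Qed.

Lemma smooth_level P : smooth_open X (level_fun w u P).
Proof.
by apply: smoothD => //; [exact: smooth_snd|exact: (flat_level P).1].
Qed.

Lemma derive_level_small P q : admissible P -> X q ->
  `|'D_e2 (fun q => u q + ripple w u P q) q| <= 2^-1.
Proof.
move=> aP Xq; have [q0|q0] := leP q.2 0.
  by rewrite (flat_smooth_derive true oX (flat_level P)).2// normr0 invr_ge0.
have Xq' : upper X q by split.
have du := smooth_differentiable fu.1 Xq.
have dr := smooth_differentiable (flat_ripple P).1 Xq.
rewrite -[fun q => _]/(u + ripple w u P) deriveD; try exact: diff_derivable.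
rewrite (le_trans (ler_normD _ _))//.
move: (duX Xq') (derive_ripple_le aP Xq').
move: ('D_e2 u q) ('D_e2 (ripple w u P) q) => x y; lra.
Qed.

Lemma derive_level_ge P q : admissible P -> X q -> 2^-1 <= 'D_e2 (level_fun w u P) q.
Proof.
move=> aP Xq; have d := smooth_differentiable (flat_level P).1 Xq.
rewrite derive_add_snd//; have := derive_level_small aP Xq.
rewrite ler_norml => /andP[+ _]; move: ('D_e2 _ q) => x; lra.
Qed.

Lemma level_bounds P q : admissible P -> upper X q ->
  2^-1 * q.2 <= level_fun w u P q <= 3 / 2 * q.2.
Proof.
move=> aP Xq; have := uX Xq; have := ripple_le aP Xq.
rewrite /level_fun !ler_norml; move: (u q) (ripple w u P q) (q.2) => x y z; lra.
Qed.

Lemma level_lower P q : X q -> q.2 <= 0 -> level_fun w u P q = q.2.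
Proof. by move=> Xq q0; rewrite /level_fun (flat_level P).2// addr0. Qed.

End Estimates.

End Ripples.

(** * Germs of the foliations at the boundary *)

Section DistinctGerms.
Context {R : realType}.
Implicit Types (f g : R * R -> R) (p q z : R * R) (P : {poly R}).
Context (a b : \bar R) (X : set (R * R)) (w u : R * R -> R) (oX : open X)
  (JX : boundary_interval a b `<=` X)
  (fw : flat_smooth X w) (fu : flat_smooth X u)
  (uX : forall q, upper X q -> `|u q| <= 4^-1 * q.2)
  (duX : forall q, upper X q -> `|'D_e2 u q| <= 4^-1)
  (dwX : forall q, upper X q -> `|'D_e2 w q| <= 1)
  (bumpX : forall q, upper X q -> flat_exp (perturb w u q) <= 4^-1 * q.2)
  (oscX : forall q, upper X q -> forall j b,
    `|'D_(edir b) (osc j.+1) (perturb w u q)| <= (j + 2)%:R * 12^-1).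

Notation A := (with_boundary a b (upper X)).
Notation F := (level_fun w u).

Lemma floor_multiple (t y : R) : 0 < y ->
  (Num.floor (t / y))%:~R * y <= t /\ t < (Num.floor (t / y))%:~R * y + y.
Proof.
move=> y0; have /andP[h1 h2] := floor_itv (t / y).
split; first by rewrite -ler_pdivlMr.
by move: h2; rewrite intrD ltr_pdivrMr// mulrDl mul1r.
Qed.

Lemma smooth_sin_normal :
  smooth_open (upper X) (fun q => sin (turns (perturb w u q))).
Proof.
have oU := open_upper oX.
apply: (@smooth_comp2 _ _ _ (upper [set: R * R]) (fun q => q.1 + w q)
  (fun q => q.2 + u q) (fun z => sin (turns z))) => //.
- by move=> q Xq; split => //=; exact: normal_pos uX _ Xq.
- apply: smoothD => //; first exact: smooth_fst.
  by apply: smooth_openS fw.1 => q [].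
- apply: smoothD => //; first exact: smooth_snd.
  by apply: smooth_openS fu.1 => q [].
- exact: smooth_sin open_half smooth_turns.
Qed.

(** The first normal coordinate minus [m] times the second one, where [m] is the
    integer part of [t / y], changes sign along the horizontal segment. *)
Lemma resonant_point (lo hi y t : R) : lo <= hi -> 0 < y ->
  (forall s, lo <= s <= hi -> upper X (s, y)) ->
  (forall s, lo <= s <= hi -> `|w (s, y)| <= y /\ `|u (s, y)| <= y ^+ 2) ->
  lo + 4 * ((`|t| + 1) * y) <= t <= hi - 4 * ((`|t| + 1) * y) -> y <= 1 ->
  exists2 s, lo <= s <= hi & sin (turns (perturb w u (s, y))) = 0.
Proof.
move=> lohi y0 HX small /andP[tlo thi] y1.
pose m := Num.floor (t / y).
have [m1 m2] : m%:~R * y <= t /\ t < m%:~R * y + y by exact: floor_multiple.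
have my : `|m%:~R| * y <= `|t| + 1.
  rewrite -[X in _ * X](gtr0_norm y0) -normrM ler_norml.
  have := ler_norm t; have := ler_norm (- t); rewrite normrN.
  by move: (m%:~R * y) m1 m2 => k; lra.
have T1 : 1 <= `|t| + 1 by rewrite lerDr.
have yT : y <= (`|t| + 1) * y by rewrite ler_peMl// ltW.
have mu s : lo <= s <= hi -> `|m%:~R * u (s, y)| <= (`|t| + 1) * y.
  move=> /small[_ hu]; rewrite normrM; apply: le_trans (ler_wpM2l _ hu) _ => //.
  by rewrite expr2 mulrA ler_wpM2r// ltW.
have sX g : smooth_open X g -> smooth_open (upper X) g.
  by apply: smooth_openS => q [].
have oU := open_upper oX.
have sg : smooth_open (upper X) (fun q => (q.1 + w q) - m%:~R * (q.2 + u q)).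
  apply: smoothB => //.
    by apply: smoothD => //; [exact: smooth_fst|exact: sX fw.1].
  by apply: smoothZ => //; apply: smoothD => //; [exact: smooth_snd|exact: sX fu.1].
have cg := horiz_within_continuous sg HX.
have hlo : lo <= lo <= hi by rewrite lexx.
have hhi : lo <= hi <= hi by rewrite lexx lohi.
have vb : Num.min ((fun s => (s + w (s, y)) - m%:~R * (y + u (s, y))) lo)
    ((fun s => (s + w (s, y)) - m%:~R * (y + u (s, y))) hi) <= 0 <=
    Num.max ((fun s => (s + w (s, y)) - m%:~R * (y + u (s, y))) lo)
    ((fun s => (s + w (s, y)) - m%:~R * (y + u (s, y))) hi).
  rewrite ge_min le_max !mulrDr.
  move: (mu _ hlo) (mu _ hhi) (small _ hlo).1 (small _ hhi).1; rewrite !ler_norml.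
  move: (m%:~R * u (lo, y)) (m%:~R * u (hi, y)) (w (lo, y)) (w (hi, y)).
  move: (m%:~R * y) ((`|t| + 1) * y) m1 m2 yT tlo thi => k T m1 m2 yT tlo thi.
  move=> u1 u2 w1 w2 /andP[a1 a2] /andP[a3 a4] /andP[a5 a6] /andP[a7 a8].
  by apply/andP; split; apply/orP; [left|right]; lra.
have [s + E] := IVT lohi cg vb; rewrite in_itv /= => hs.
exists s => //; have pos := normal_pos uX (HX s hs).
have -> : turns (perturb w u (s, y)) = 0 + 2 * pi * m%:~R.
  rewrite /turns /perturb /=; move/eqP: E; rewrite subr_eq0 => /eqP /= ->.
  by rewrite mulfK ?gt_eqF// add0r.
by rewrite sin_int_turns sin0.
Qed.

(** Both leaves through a resonant point have the same level there, so on a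
    common leaf the polynomial [(P - P') * 'X] vanishes at the values of
    [sin (turns _)]. If it is not zero, the sine is constantly zero along the
    leaf; then the leaf is a level curve of the second normal coordinate, on
    which the sine does take the value 1. *)
Lemma distinct_germs P P' p : admissible P -> admissible P' ->
  boundary_interval a b p ->
  same_germ A (level_foliation A (F P)) (level_foliation A (F P')) p -> P = P'.
Proof.
move=> aP aP' Jp [U [oU Up germ]].
have p0 := boundary_snd Jp; have Xp := JX Jp.
have /nearP[r r0 Hr] : \forall q \near p, (X q /\ U q) /\
    (0 < q.2 -> `|w q| <= q.2 /\ `|u q| <= q.2 ^+ 2).
  have n1 : \forall q \near p, X q by exact: open_nbhs_nbhs.
  have n2 : \forall q \near p, U q by exact: open_nbhs_nbhs.
  have n12 : \forall q \near p, X q /\ U q.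
    by apply: filterS2 n1 n2 => q; exact: conj.
  have n3 := flat_near_pow 1 oX fw Xp p0; have n4 := flat_near_pow 2 oX fu Xp p0.
  by apply: filterS3 n12 n3 n4 => q h3 h4 h5; split => // q0; split; auto.
pose e := r / 2; have e0 : 0 < e by rewrite divr_gt0.
have er : e < r by rewrite /e ltr_pdivrMr// ltr_pMr// ltr1n.
pose lo := p.1 - e; pose hi := p.1 + e.
have lohi : lo <= hi by rewrite /lo /hi; lra.
have inb q : lo <= q.1 <= hi -> 0 <= q.2 <= e -> (X q /\ U q) /\
    (0 < q.2 -> `|w q| <= q.2 /\ `|u q| <= q.2 ^+ 2).
  move=> h1 /andP[h2 h3]; apply: Hr.
    by apply: le_lt_trans er; rewrite ler_distl.
  by rewrite p0 subr0 ger0_norm// (le_lt_trans h3).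
have bX : box lo hi e `<=` X by move=> q [h1 h2]; have [[]] := inb q h1 h2.
pose T := `|p.1| + 1; have T1 : 1 <= T by rewrite /T lerDr.
have T0 : 0 < T by apply: lt_le_trans T1.
(* Low enough for the errors in [resonant_point] and for [c] to be small
   compared with the width of the box. *)
pose y := Num.min 1 (e / (8 * T)).
have y0 : 0 < y by rewrite lt_min ltr01 divr_gt0// mulr_gt0.
have y1 : y <= 1 by rewrite ge_min lexx.
have Ty : 8 * (T * y) <= e.
  by rewrite mulrA mulrC -ler_pdivlMr ?mulr_gt0// /y ge_min lexx orbT.
have yT : y <= T * y by rewrite ler_peMl// ltW.
have ye : 0 <= y <= e by apply/andP; split; lra.
have hX s : lo <= s <= hi -> upper X (s, y).
  by move=> hs; have [[]] := inb (s, y) hs ye.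
have [s0 hs0 sin0] : exists2 s, lo <= s <= hi & sin (turns (perturb w u (s, y))) = 0.
  apply: (resonant_point (t := p.1)) => //.
    by move=> s hs; have [_ /(_ y0)] := inb (s, y) hs ye.
  by rewrite -/T /lo /hi; apply/andP; split; lra.
pose q0 : R * R := (s0, y); have Xq0 := hX s0 hs0.
pose c := y + u q0.
have cy : 3 / 4 * y <= c <= 5 / 4 * y.
  by have := uX Xq0; rewrite /c ler_norml /=; move: (u q0) => x; lra.
have c0 : 0 < c by case/andP: cy => h _; lra.
have Fq0 Q : F Q q0 = c.
  by rewrite /level_fun rippleE ?(normal_pos uX)// sin0 hornerMX mulr0 mulr0 addr0.
have df q : box lo hi e q -> 2^-1 <= 'D_e2 (F P) q.
  by move=> /bX Xq; apply: (derive_level_ge oX fw fu duX dwX).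
have fc s : lo <= s <= hi -> F P (s, 0) <= c <= F P (s, e).
  move=> hs; have Xs t : 0 <= t <= e -> X (s, t) by move=> ht; apply: bX.
  rewrite (level_lower oX fw fu)//=; last by apply: Xs; rewrite lexx ltW.
  have Xe : upper X (s, e) by split=> //; apply: Xs; rewrite lexx ltW.
  have /andP[h1 _] := level_bounds uX bumpX aP Xe.
  rewrite (ltW c0) (le_trans _ h1)//=; case/andP: cy => _ h; lra.
have [Y [cY HY uY]] := level_graph (smooth_level oX fw fu P) lohi (ltW e0) bX df fc.
have Y0 s : lo <= s <= hi -> 0 < Y s.
  move=> hs; have [/andP[]] := HY s hs; rewrite le_eqVlt => /orP[/eqP<-|//].
  have Xs : X (s, 0) by apply: bX; split=> //=; rewrite lexx ltW.
  by rewrite (level_lower oX fw fu _ Xs)//= => _ E; rewrite E ltxx in c0.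
have XY s : lo <= s <= hi -> upper X (s, Y s).
  by move=> hs; split; [apply: bX; split=> //=; case: (HY s hs)|exact: Y0].
pose G : set (R * R) := [set q | q.1 \in `[lo, hi] /\ q.2 = Y q.1].
have GE q : G q -> q = (q.1, Y q.1) /\ lo <= q.1 <= hi.
  by case: q => s t [/=]; rewrite in_itv /= => hs ->.
have cG : connected G by exact: connected_graph.
have Gq0 : G q0 by split; rewrite /= ?in_itv//= (uY s0 y).
have GA : G `<=` A by move=> q /GE[-> hs]; left; exact: XY.
have GU : G `<=` U.
  by move=> q /GE[-> hs]; have [h _] := HY _ hs; have [[]] := inb (_, _) hs h.
have GL : G `<=` level_foliation A (F P) q0.
  apply: connected_component_max => // q Gq; split; first exact: GA.
  by rewrite /= Fq0; have [-> /HY[]] := GE _ Gq.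
have GL' q : G q -> F P' q = c.
  move=> Gq; have : restrict_foliation (level_foliation A (F P)) U q0 q.
    apply: (connected_component_max (B := G)) => // z Gz.
    by split; [exact: GL|exact: GU].
  rewrite germ; [|exact: GA|exact: GU].
  by move=> /connected_component_sub[/connected_component_sub[_ /= ->]].
apply/eqP/negPn/negP => PP'.
pose sg s := sin (turns (perturb w u (s, Y s))).
have Q0 : (P - P') * 'X != 0 by rewrite mulf_neq0 ?polyX_eq0// subr_eq0.
have root_sg s : lo <= s <= hi -> root ((P - P') * 'X) (sg s).
  move=> hs; have pos := normal_pos uX (XY s hs).
  have E : F P (s, Y s) = F P' (s, Y s).
    by rewrite GL'; [case: (HY s hs)|split; rewrite /= ?in_itv].
  move: E; rewrite /level_fun => /addrI/addrI; rewrite !rippleE// => E.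
  have b0 : flat_exp (perturb w u (s, Y s)) != 0 by rewrite gt_eqF// expR_gt0.
  by rewrite /root mulrBl hornerD hornerN (mulfI b0 E) subrr.
have csg : {within `[lo, hi], continuous sg}.
  exact: (graph_within_continuous smooth_sin_normal cY XY).
have sg0 s : lo <= s <= hi -> sg s = 0.
  move=> hs; apply: (root_valued_constant csg root_sg hs0 hs Q0).
  by rewrite /sg (uY s0 y).
have normal2 s : lo <= s <= hi -> Y s + u (s, Y s) = c.
  move=> hs; have [_ <-] := HY s hs; have := sg0 s hs; rewrite /sg => E.
  by rewrite /level_fun rippleE ?(normal_pos uX) ?E ?hornerMX ?mulr0 ?addr0//; exact: XY.
have wY s : lo <= s <= hi -> `|w (s, Y s)| <= 5 / 2 * y.
  move=> hs; have [h fY] := HY s hs; have [_ /(_ (Y0 s hs))[+ _]] := inb (s, Y s) hs h.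
  move=> /= h1; apply: le_trans h1 _.
  have /andP[+ _] := level_bounds uX bumpX aP (XY s hs); rewrite fY /=.
  by case/andP: cy => _; lra.
pose k := Num.floor (p.1 / c).
have [k1 k2] : k%:~R * c <= p.1 /\ p.1 < k%:~R * c + c by exact: floor_multiple.
have sN : smooth_open (upper X) (fun q => q.1 + w q).
  apply: smoothD; [exact: open_upper|exact: smooth_fst|].
  by apply: smooth_openS fw.1 => q [].
have cN := graph_within_continuous sN cY XY.
(* A quarter turn beyond an integer number of turns. *)
pose v := k%:~R * c + 4^-1 * c.
have hlo : lo <= lo <= hi by rewrite lexx.
have hhi : lo <= hi <= hi by rewrite lexx lohi.
have vb : Num.min ((fun s => s + w (s, Y s)) lo) ((fun s => s + w (s, Y s)) hi) <= v
    <= Num.max ((fun s => s + w (s, Y s)) lo) ((fun s => s + w (s, Y s)) hi).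
  rewrite ge_min le_max /v /lo /hi.
  move: (wY _ hlo) (wY _ hhi); rewrite !ler_norml -/lo -/hi.
  move: (w (lo, Y lo)) (w (hi, Y hi)) (k%:~R * c) k1 k2 => w1 w2 kc k1 k2.
  move: cy => /andP[cy1 cy2] /andP[a1 a2] /andP[a3 a4].
  by rewrite /lo /hi; apply/andP; split; apply/orP; [left|right]; lra.
have [s + E] := IVT lohi cN vb; rewrite in_itv /= => hs.
have := sg0 s hs; rewrite /sg.
have -> : turns (perturb w u (s, Y s)) = pi / 2 + 2 * pi * k%:~R.
  rewrite /turns /perturb /= normal2// E /v -mulrDl mulfK ?gt_eqF//.
  by move: (k%:~R : R) (pi : R) => x t; field.
by rewrite sin_int_turns sin_pihalf => /eqP; rewrite oner_eq0.
Qed.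

End DistinctGerms.

(** * Finite-parameter subfamilies *)

Section Families.
Context {R : realType}.
Implicit Types (P : {poly R}) (q : R * R).

Lemma smooth_continuous_linear {V W : normedModType R} (U : set V) (f : V -> W) :
  linear f -> continuous f -> smooth_open U f.
Proof.
move=> lf cf; pose g : {linear V -> W} := HB.pack f (GRing.isLinear.Build R V W *:%R f lf).
exact: (@smooth_linear _ _ _ U g).
Qed.

Lemma sum_size_widen P n (G : nat -> R -> R) : (forall i, G i 0 = 0) ->
  (size P <= n)%N -> \sum_(i < size P) G i P`_i = \sum_(i < n) G i P`_i.
Proof.
move=> G0 Pn; rewrite (big_ord_widen n (fun i => G i P`_i) Pn) big_mkcond /=.
by apply: eq_bigr => i _; case: ltnP => // h; rewrite nth_default.
Qed.

Definition row_poly n (s : 'rV[R]_n.+1) : {poly R} :=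
  \poly_(i < n.+1) s ord0 (inord i).

Lemma coef_row_poly n (s : 'rV[R]_n.+1) (i : 'I_n.+1) :
  (row_poly s)`_i = s ord0 i.
Proof. by rewrite coef_poly ltn_ord inord_val. Qed.

Lemma row_poly_inj n : injective (@row_poly n).
Proof.
by move=> s t E; apply/rowP => i; rewrite -!coef_row_poly E.
Qed.

Lemma row_poly_admissible n (s : 'rV[R]_n.+1) :
  (forall i, `|s ord0 i| <= ((n.+1 * n.+2)%:R)^-1) -> admissible (row_poly s).
Proof.
move=> Hs; rewrite /admissible.
rewrite (sum_size_widen (n := n.+1) (G := fun i x => `|x| * (i + 2)%:R)) ?size_poly//;
  last by move=> i; rewrite normr0 mul0r.
apply: (@le_trans _ _ (\sum_(i < n.+1) ((n.+1 * n.+2)%:R)^-1 * n.+2%:R)).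
  apply: ler_sum => i _; rewrite coef_row_poly ler_pM//.
  by rewrite ler_nat addn2 ltnS ltn_ord.
rewrite sumr_const card_ord -[X in X <= 1]mulr_natr natrM.
have : n.+1%:R != 0 :> R by rewrite pnatr_eq0.
have : n.+2%:R != 0 :> R by rewrite pnatr_eq0.
move: (n.+1%:R) (n.+2%:R) => x y y0 x0.
by rewrite (_ : _ * _ = 1)//; field; apply/andP; split.
Qed.

Lemma ripple_row_poly w u n (s : 'rV[R]_n.+1) q :
  ripple w u (row_poly s) q =
  \sum_(i < n.+1) s ord0 i * osc i.+1 (perturb w u q).
Proof.
rewrite /ripple (sum_size_widen (n := n.+1) (G := fun i x => x * osc i.+1 (perturb w u q))).
- by apply: eq_bigr => i _; rewrite coef_row_poly.
- by move=> i; rewrite mul0r.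
- exact: size_poly.
Qed.

Definition row_level w u n (x : 'rV[R]_n.+1 * (R * R)) : R :=
  x.2.2 + (u x.2 + \sum_(i < n.+1) x.1 ord0 i * osc i.+1 (perturb w u x.2)).

Lemma row_level_smooth (X : set (R * R)) w u n : open X ->
  flat_smooth X w -> flat_smooth X u ->
  smooth_on ([set: 'rV[R]_n.+1] `*` X) (@row_level w u n).
Proof.
move=> oX fw fu [s0 q0] [_ /= Xq0].
pose U : set ('rV[R]_n.+1 * (R * R)) := [set: 'rV[R]_n.+1] `*` X.
have oU : open U.
  have -> : U = snd @^-1` X by apply/seteqP; split=> [x []//|x].
  by apply: open_comp => // x _; exact: cvg_snd.
exists U, (@row_level w u n); split => //.
have s21 : smooth_open U (fun x => x.2.1).
  apply: smooth_continuous_linear => [k x y|x]; first by [].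
  by apply: continuous_comp; [exact: cvg_snd|exact: cvg_fst].
have s22 : smooth_open U (fun x => x.2.2).
  apply: smooth_continuous_linear => [k x y|x]; first by [].
  by apply: continuous_comp; [exact: cvg_snd|exact: cvg_snd].
have s1 i : smooth_open U (fun x => x.1 ord0 i).
  apply: smooth_continuous_linear => [k x y|x]; first by rewrite /= !mxE.
  have c1 := @coord_continuous R 1 n.+1 ord0 i x.1.
  have cf : (fun x : 'rV[R]_n.+1 * (R * R) => x.1) @ x --> x.1 by exact: cvg_fst.
  exact: cvg_comp cf c1.
have s2 (g : R * R -> R) : smooth_open X g -> smooth_open U (fun x => g x.2).
  move=> sg; apply: (@eq_smooth _ _ _ _ (fun x => g (x.2.1, x.2.2))) => //.
    by move=> [s [x y]] _.
  have UX x : U x -> X (x.2.1, x.2.2) by case: x => s [t y] [].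
  exact: (smooth_comp2 oU UX s21 s22 sg).
apply: smoothD => //; apply: smoothD => //; first exact/s2/fu.1.
apply: smooth_sum => // i; apply: smoothM => //.
exact: (s2 (fun q => osc i.+1 (perturb w u q)) (flat_osc_comp oX fw fu _).1).
Qed.

End Families.

(** * The infinite-dimensional family *)

Section InfiniteFamily.
Context {R : realType}.
Implicit Types (p q z : R * R) (P : {poly R}) (F : R * R -> R * R).

(** The functions [level_fun w u P] for the admissible polynomials [P]; the
    perturbations are uniformly small, so that all of them live on the same
    domain. *)
Lemma first_integral_family_exists (a b : \bar R) (V : set (R * R)) F :
  (a < b)%E -> domain_adjacent a b V ->
  flat a b V (fun p => (F p).1 - (p.1 + p.2)) ->
  flat a b V (fun p => (F p).2 - p.2) ->
  exists (W : set (R * R)) (Phi : set (R * R -> R)),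
     [/\ W `<=` V /\ domain_adjacent a b W,
         (Phi #= [set: R])%card,
         forall phi, Phi phi -> flat_first_integral a b W F phi &
         infinite_dimensional_family a b W Phi
           (level_foliation (with_boundary a b W))].
Proof.
move=> ab adj F1 F2; have [f1 [f2 [ff1 ff2 FE]]] := shear_of_flat adj F1 F2.
have oV := open_collar adj.
have JV : boundary_interval a b `<=` collar a b V by move=> p Jp; left; right.
have [Z1 [u [oZ1 JZ1 fu EQu]]] := coboundary ab oV JV ff1 ff2 (flat_smoothN oV ff2).
pose V1 := collar a b V `&` Z1.
have oV1 : open V1 by exact: openI.
have JV1 : boundary_interval a b `<=` V1.
  by move=> p Jp; split; [exact: JV|exact: JZ1].
have V1V : V1 `<=` collar a b V by move=> q [].
have fu1 : flat_smooth V1 u by apply: flat_smoothS fu => q [].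
have gf1 := flat_smoothS V1V ff1; have gf2 := flat_smoothS V1V ff2.
have [Z2 [w [oZ2 JZ2 fw EQw]]] := coboundary ab oV1 JV1 gf1 gf2 (flat_smoothB oV1 fu1 gf1).
pose V2 := V1 `&` Z2.
have oV2 : open V2 by exact: openI.
have JV2 : boundary_interval a b `<=` V2.
  by move=> p Jp; split; [exact: JV1|exact: JZ2].
have V2V1 : V2 `<=` V1 by move=> q [].
have fu2 : flat_smooth V2 u by exact: flat_smoothS fu1.
have fw2 : flat_smooth V2 w by apply: flat_smoothS fw => q [].
pose good q := 0 < q.2 -> [/\ `|u q| <= 4^-1 * q.2, `|'D_e2 u q| <= 4^-1,
  `|'D_e2 w q| <= 1, `|osc 0 (perturb w u q)| <= 4^-1 * q.2 &
  forall j c, `|'D_(edir c) (osc j.+1) (perturb w u q)| <= (j + 2)%:R * 12^-1].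
have HP p : boundary_interval a b p -> \forall q \near p, V2 q /\ good q.
  move=> Jp; have Vp := JV2 _ Jp; have p0 := boundary_snd Jp.
  have i4 : 0 < 4^-1 :> R by rewrite invr_gt0.
  have i12 : 0 < 12^-1 :> R by rewrite invr_gt0.
  have n0 : \forall q \near p, V2 q by exact: open_nbhs_nbhs.
  have n1 := flat_near_bound oV2 fu2 Vp p0 i4.
  have n2 := near_derive_small oV2 fu2 Vp p0 i4.
  have n3 := near_derive_small oV2 fw2 Vp p0 ltr01.
  have n4 := flat_near_bound oV2 (flat_osc_comp oV2 fw2 fu2 0) Vp p0 i4.
  have Pp : perturb w u p = p by apply: (perturb_lower fw2 fu2 Vp); rewrite p0.
  have cP : {for p, continuous (perturb w u)}.
    apply: differentiable_continuous; apply: differentiable_pair.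
      apply: (smooth_differentiable (U := V2)) => //.
      by apply: smoothD => //; [exact: smooth_fst|exact: fw2.1].
    apply: (smooth_differentiable (U := V2)) => //.
    by apply: smoothD => //; [exact: smooth_snd|exact: fu2.1].
  have n5 := near_derive_osc p0 i12; rewrite -{1}Pp in n5.
  have {}n5 := cP _ n5.
  have n01 : \forall q \near p, V2 q /\ (0 < q.2 -> `|u q| <= 4^-1 * q.2).
    by apply: filterS2 n0 n1 => q; exact: conj.
  have n23 : \forall q \near p, `|'D_e2 u q| <= 4^-1 /\ `|'D_e2 w q| <= 1.
    by apply: filterS2 n2 n3 => q; exact: conj.
  have n45 : \forall q \near p, (0 < q.2 -> `|osc 0 (perturb w u q)| <= 4^-1 * q.2) /\
      (0 < (perturb w u q).2 -> forall j c,
        `|'D_(edir c) (osc j.+1) (perturb w u q)| <= (j + 2)%:R * 12^-1).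
    by apply: filterS2 n4 n5 => q; exact: conj.
  apply: filterS3 n01 n23 n45 => q [h0 h1] [h2 h3] [h4 h5]; split => // q0.
  split => //; [exact: h1|exact: h4|apply: h5].
  by have := h1 q0; rewrite ler_norml /= => /andP[+ _]; move: q0; lra.
have [X [[oX JX] XP _ _ adjX]] := boundary_shrink ab HP.
have XV2 : X `<=` V2 by move=> q /XP[].
have XV : X `<=` collar a b V by move=> q /XV2[/V1V].
have gfu := flat_smoothS XV2 fu2; have gfw := flat_smoothS XV2 fw2.
have sub := with_boundary_upper JX.
have Xgood q : upper X q -> [/\ `|u q| <= 4^-1 * q.2, `|'D_e2 u q| <= 4^-1,
  `|'D_e2 w q| <= 1, `|osc 0 (perturb w u q)| <= 4^-1 * q.2 &
  forall j c, `|'D_(edir c) (osc j.+1) (perturb w u q)| <= (j + 2)%:R * 12^-1].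
  by move=> [/XP[_ h] /h].
have uX q : upper X q -> `|u q| <= 4^-1 * q.2 by case/Xgood.
have duX q : upper X q -> `|'D_e2 u q| <= 4^-1 by case/Xgood.
have dwX q : upper X q -> `|'D_e2 w q| <= 1 by case/Xgood.
have expX q : upper X q -> flat_exp (perturb w u q) <= 4^-1 * q.2.
  move=> Xq; have [_ _ _ + _] := Xgood q Xq.
  rewrite oscE ?expr0 ?mulr1; last exact: (normal_pos uX Xq).
  by apply: le_trans; exact: ler_norm.
have oscX q : upper X q -> forall j c,
    `|'D_(edir c) (osc j.+1) (perturb w u q)| <= (j + 2)%:R * 12^-1 by case/Xgood.
pose A := with_boundary a b (upper X).
pose f := level_fun w u.
have [t [at_ tb]] := ereal_between ab.
have Jt : boundary_interval a b (t, 0) by [].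
have shearF p : A p -> A (F p) -> perturb w u (F p) = shear (perturb w u p).
  move=> Ap AFp; have Vp := XV2 _ (sub _ Ap); have VFp := XV2 _ (sub _ AFp).
  have FEp : F p = shear_map f1 f2 p.
    apply: FE; case: Ap => [Op|Jp]; last by right.
    by left; exact: (upper_collar_sub adj XV).
  have := EQu p Vp.1.2; rewrite -FEp => /(_ VFp.1.2) Eu.
  have := EQw p Vp.2; rewrite -FEp => /(_ VFp.2) Ew.
  rewrite /perturb -[w (F p)](subrK (w p)) Ew -[u (F p)](subrK (u p)) Eu FEp.
  by rewrite /shear /=; congr (_, _); ring.
have fJ P q : boundary_interval a b q -> f P q = 0.
  move=> Jq; rewrite /f (level_lower oX gfw gfu) ?(boundary_snd Jq)//; exact: JX.
have fpos P : admissible P -> forall q, upper X q -> 0 < f P q.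
  move=> aP q Xq; have /andP[h _] := level_bounds uX expX aP Xq.
  by apply: lt_le_trans h; rewrite mulr_gt0// ?invr_gt0//; case: Xq.
have df P : admissible P -> forall q, X q -> 'D_e2 (f P) q != 0.
  move=> aP q Xq; rewrite gt_eqF//.
  by apply: lt_le_trans (derive_level_ge oX gfw gfu duX dwX oscX aP Xq); rewrite invr_gt0.
have inj P P' : admissible P -> admissible P' -> forall p, boundary_interval a b p ->
    same_germ A (level_foliation A (f P)) (level_foliation A (f P')) p -> P = P'.
  move=> aP aP' p; exact: (distinct_germs oX JX gfw gfu uX duX dwX expX oscX aP aP').
have finj P P' : admissible P -> admissible P' -> f P = f P' -> P = P'.
  move=> aP aP' E; apply: (inj P P' aP aP' (t, 0) Jt).
  by exists setT; split => //; [exact: openT|rewrite E].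
exists (upper X), (f @` [set P | admissible P]); split.
- by split => //; exact: upper_collar_sub adj XV.
- apply: card_eq_trans (inj_card_eq _) card_admissible.
  by move=> P P'; rewrite !inE => aP aP'; exact: finj.
- move=> _ [P aP <-]; apply: first_integral_of_flat => //.
  + exact: (flat_level oX gfw gfu P).
  + move=> p Xp; have := derive_level_small oX gfw gfu duX dwX oscX aP Xp.
    by rewrite ler_norml => /andP[+ _]; move: ('D_e2 _ p) => x; lra.
  + move=> p Ap AFp; have E := shearF p Ap AFp; rewrite !addrA (ripple_shear P E).
    by congr (_ + _); have := congr1 snd E.
- split.
  + move=> _ [P aP <-]; split.
      exact: (level_smooth_foliation oX sub (smooth_level oX gfw gfu P) (df P aP)).
    by move=> p; apply: level_boundary_leaf; [exact: fJ|exact: fpos].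
  + move=> _ _ [P aP <-] [P' aP' <-] ne p Jp germ; apply: ne.
    by rewrite (inj P P' aP aP' p Jp germ).
  move=> N; pose r : R := ((N.+1 * N.+2)%:R)^-1.
  have r0 : 0 < r by rewrite invr_gt0 ltr0n muln_gt0.
  have rP (s : 'rV[R]_N.+1) : ball 0 r s -> admissible (row_poly s).
    rewrite -ball_normE /= sub0r normrN => /ltW Hs.
    apply: row_poly_admissible => i; apply: le_trans Hs.
    rewrite -[leRHS]/(mx_norm s) mx_normrE.
    exact: (le_bigmax _ (fun ij => `|s ij.1 ij.2|) (ord0, i)).
  exists (ball 0 r), (fun s => f (row_poly s)); split.
  + split; first exact: ball_open.
    by exists 0; exact: ballxx.
  + by move=> s Bs; exists (row_poly s) => //; exact: rP.
  + by move=> s t' Bs Bt /finj/row_poly_inj; apply; exact: rP.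
  split.
    move=> s /rP aP.
    exact: (level_smooth_foliation oX sub (smooth_level oX gfw gfu _) (df _ aP)).
  move=> s0 p Bs0 Ap; exists setT, X, (@row_level R w u N); split.
  + by split => //; exact: openT.
  + by split => //; exact: sub.
  + exact: row_level_smooth.
  + move=> s _ /rP aP.
    have -> : (fun q => row_level w u (s, q)) = f (row_poly s).
      by apply/funext => q; rewrite /row_level /f /level_fun ripple_row_poly.
    by apply: level_locally_level => // q /(df _ aP); exists e2.
Qed.

End InfiniteFamily.

Unset Implicit Arguments.

Theorem theorem1p27 (R : realType) (a b : \bar R) (V : set (R * R))
    (F : R * R -> R * R)
    (ltab : (a < b)%E)
    (adjV : domain_adjacent a b V)
    (smoothF : smooth_on (with_boundary a b V) F)
    (F_half_plane : forall p, with_boundary a b V p -> 0 <= (F p).2)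
    (F_tau : flat a b V (fun p => (F p).1 - (p.1 + p.2)))
    (F_phi : flat a b V (fun p => (F p).2 - p.2)) :
  (exists (W : set (R * R)) (phi : R * R -> R),
     [/\ W `<=` V, domain_adjacent a b W & flat_first_integral a b W F phi])
  /\
  (forall (W : set (R * R)) (phi : R * R -> R),
     W `<=` V -> domain_adjacent a b W -> flat_first_integral a b W F phi ->
     exists (W' : set (R * R)) (tau : R * R -> R),
       let A := with_boundary a b W' in
       let H := fun p => (tau p, phi p) in
       [/\ W' `<=` W /\ domain_adjacent a b W',
           smooth_on A tau /\ flat a b W' (fun p => tau p - p.1),
           smooth_embedding A H &
           forall z, A z -> A (F z) -> H (F z) = shear (H z)])
  /\
  (exists (W : set (R * R)) (Phi : set (R * R -> R)),
     [/\ W `<=` V /\ domain_adjacent a b W,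
         (Phi #= [set: R])%card,
         forall phi, Phi phi -> flat_first_integral a b W F phi &
         infinite_dimensional_family a b W Phi
           (level_foliation (with_boundary a b W))]).
Proof.
split; first exact: flat_first_integral_exists F_tau F_phi.
split; last exact: first_integral_family_exists F_tau F_phi.
by move=> W phi WV adjW intphi; exact: normalizing_chart_exists F_tau F_phi WV adjW intphi.
Qed.
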